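(* Let $(R,\mathfrak m)$ be either a Noetherian local ring with infinite residue field $k$, or a homogeneous algebra over an infinite field $k$ with irrelevant maximal ideal $\mathfrak m$. Let $\mathrm{Deg}(-)$ be a cohomological degree on $\mathcal M(R)$ and let $M$ be a module in $\mathcal M(R)$. If $\nu(M)=\mathrm{Deg}(M)$, then the associated graded module $\mathrm{gr}_{\mathfrak m}(M)$ has a linear resolution.
   Context: A homogeneous $k$-algebra is a graded ring $R=\bigoplus_{i\ge 0}R_{\langle i\rangle}$ with $R_{\langle 0\rangle}=k$, $\dim_k R_{\langle 1\rangle}<\infty$, and $R=k[R_{\langle 1\rangle}]$; its irrelevant maximal ideal is $\mathfrak m=\bigoplus_{i\ge1}R_{\langle i\rangle}$. $\mathcal M(R)$ is the category of finitely generated $R$-modules (finitely generated graded $R$-modules if $R$ is homogeneous). $\nu(M)=\dim_k M/\mathfrak mM$ is the minimal number of generators, $\ell$ is length, $\Gamma_{\mathfrak m}(M)=\{z\in M: \mathfrak m^t z=0 \text{ for } t\gg0\}$, and $\deg(M)$ is the multiplicity of $M$ with respect to $\mathfrak m$ ($=\ell(M)$ if $\dim M=0$). Notion of genericity. If $R$ is local, it is a function $U$ assigning to each isomorphism class of modules $M$ in $\mathcal M(R)$ a non-empty subset $U(M)\subseteq\mathfrak m\setminus\mathfrak m^2$ such that: (i) if $f-g\in\mathfrak m^2$ then $f\in U(M)\iff g\in U(M)$; (ii) the image of $U(M)$ in $\mathfrak m/\mathfrak m^2$ contains a nonempty Zariski-open subset; (iii) if $\mathrm{depth}(M)>0$,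 every $f\in U(M)$ is regular on $M$. If $R$ is homogeneous, $U(M)$ is a non-empty subset of $R_{\langle1\rangle}$ containing a nonempty Zariski-open subset of $R_{\langle 1\rangle}$ and satisfying (iii). Cohomological degree. A cohomological degree on $\mathcal M(R)$ (with respect to a notion of genericity $U$) is a function $\mathrm{Deg}(-)$ from isomorphism classes of $\mathcal M(R)$ to $\mathbf R$ such that for all $M$: (1) if $L=\Gamma_{\mathfrak m}(M)$ then $\mathrm{Deg}(M)=\mathrm{Deg}(M/L)+\ell(L)$; (2) if $\mathrm{depth}(M)>0$ and $x\in U(M)$ then $\mathrm{Deg}(M)\ge\mathrm{Deg}(M/xM)$; (3) if $M$ is Cohen-Macaulay, then $\mathrm{Deg}(M)=\deg(M)$. Linear resolution. $\mathrm{gr}_{\mathfrak m}(M)=\bigoplus_{i\ge0}\mathfrak m^iM/\mathfrak m^{i+1}M$ is a graded module over the homogeneous $k$-algebra $\mathrm{gr}_{\mathfrak m}(R)$, hence over a standard graded polynomial ring $T=k[y_1,\dots,y_N]$ mapping onto $\mathrm{gr}_{\mathfrak m}(R)$. A graded $T$-module has a linear resolution if the $i$-th free module in its minimal graded free $T$-resolution is a direct sum of copies of $T[-i]$ (generated in degree $i$), for every $i\geq 0$ (this does not depend on the choice of $T$). *)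

(* Defs.v *)
From HB Require Import structures.
From mathcomp Require Import all_boot all_order all_algebra.
From mathcomp Require Import generic_quotient ring_quotient.
From mathcomp Require Import boolp classical_sets functions cardinality reals.
From mathcomp Require Import mpoly.

Set Implicit Arguments.
Unset Strict Implicit.
Unset Printing Implicit Defensive.

Import Order.TTheory GRing.Theory Num.Theory.
Local Open Scope ring_scope.
Local Open Scope classical_set_scope.
Local Open Scope quotient_scope.

(* Maximum of a set of naturals; 0 if the set is empty or unbounded. *)
Definition nmax (P : set nat) : nat :=
  xget 0%N [set n | P n /\ forall i, P i -> (i <= n)%N].

(* Submodules of M are terms of type submodClosed M; ideals of R are
   submodules of the regular module R^o. *)

Definition psub (T : Type) (A B : {pred T}) : Prop :=
  {subset A <= B} /\ exists2 x, x \in B & x \notin A.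

Section Submodules.
Variables (R : comNzRingType) (M : lmodType R).

Definition fullp of M : bool := true.
Lemma fullp_closed : GRing.subsemimod_closed fullp.
Proof. by split=> //; split. Qed.
HB.instance Definition _ := GRing.isSubmodClosed.Build R M fullp fullp_closed.
Definition full : submodClosed M := GRing.SubmodClosed.clone R M fullp _.

Definition spanp (S : set M) (x : M) : bool :=
  `[< forall N : submodClosed M, (forall s, S s -> s \in N) -> x \in N >].
Lemma spanp_closed S : GRing.subsemimod_closed (spanp S).
Proof.
split; first split.
- by apply/asboolP => N _; exact: rpred0.
- move=> x y /asboolP hx /asboolP hy; apply/asboolP => N hN.
  by apply: rpredD; [exact: hx | exact: hy].
- by move=> a x /asboolP hx; apply/asboolP => N hN; apply: rpredZ; exact: hx.
Qed.
HB.instance Definition _ S :=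
  GRing.isSubmodClosed.Build R M (spanp S) (spanp_closed S).
Definition mspan (S : set M) : submodClosed M := GRing.SubmodClosed.clone R M (spanp S) _.

Lemma mspan_ind (S : set M) (P : M -> Prop) :
  P 0 -> (forall x y, P x -> P y -> P (x + y)) ->
  (forall a x, P x -> P (a *: x)) -> (forall s, S s -> P s) ->
  forall x, x \in mspan S -> P x.
Proof.
move=> P0 PD PZ PS x /asboolP hx; pose Q x := `[< P x >].
have Qc : GRing.subsemimod_closed Q.
  split; first split; first exact/asboolP.
    by move=> u v /asboolP Pu /asboolP Pv; apply/asboolP/PD.
  by move=> a u /asboolP Pu; apply/asboolP/PZ.
pose B := GRing.isSubmodClosed.Build R M Q Qc.
pose N : submodClosed M := HB.pack Q B.
by apply/asboolP; apply: (hx N) => s /PS Ps; apply/asboolP.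
Qed.

Definition imul (I : submodClosed R^o) (N : submodClosed M) : submodClosed M :=
  mspan [set z | exists a x, [/\ a \in I, x \in N & z = (a : R) *: x]].

(* I^n M *)
Fixpoint ipow (I : submodClosed R^o) (n : nat) : submodClosed M :=
  if n is n'.+1 then imul I (ipow I n') else full.

(* x M *)
Definition xmulp (x : R) (z : M) : bool := `[< exists w, z = x *: w >].
Lemma xmulp_closed x : GRing.subsemimod_closed (xmulp x).
Proof.
split; first split.
- by apply/asboolP; exists 0; rewrite scaler0.
- move=> _ _ /asboolP[u ->] /asboolP[v ->]; apply/asboolP.
  by exists (u + v); rewrite scalerDr.
- move=> a _ /asboolP[u ->]; apply/asboolP; exists (a *: u).
  by rewrite !scalerA mulrC.
Qed.
HB.instance Definition _ x :=
  GRing.isSubmodClosed.Build R M (xmulp x) (xmulp_closed x).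
Definition xmul (x : R) : submodClosed M := GRing.SubmodClosed.clone R M (xmulp x) _.

End Submodules.

Lemma ipow_leq (R : comNzRingType) (M : lmodType R) (I : submodClosed R^o) s t :
  (s <= t)%N -> {subset ipow M I t <= ipow M I s}.
Proof.
move/subnK <-; elim: (t - s)%N => [|d IH] x //; rewrite addSn => /asboolP hx.
apply: IH; apply: hx => _ [a [y [_ yI ->]]]; exact: rpredZ.
Qed.

Section Quotient.
Variables (R : comNzRingType) (M : lmodType R) (N : submodClosed M).

(* Over a ring, the library does not derive zmodClosed from submodClosed. *)
Definition submodp (x : M) : bool := x \in N.
HB.instance Definition _ := GRing.isZmodClosed.Build M submodp
  (GRing.submod_closedB (GRing.submodClosedP N)).
Definition submodz : zmodClosed M := GRing.ZmodClosed.clone M submodp _.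

Definition quo_type := Quotient.quot submodz.
HB.instance Definition _ := GRing.Zmodule.on quo_type.
Definition cls (x : M) : quo_type := \pi_(Quotient.quot submodz) x.

Lemma cls_eq x y : (cls x = cls y) <-> (x - y \in N).
Proof. by rewrite -[_ \in N]/(_ \in submodz) Quotient.idealrBE; split=> /eqP. Qed.
Lemma cls_surj (q : quo_type) : exists x, q = cls x.
Proof. by exists (repr (q : Quotient.quot submodz)); rewrite /cls reprK. Qed.
Lemma clsB : zmod_morphism cls. Proof. by move=> x y; rewrite /cls !piE. Qed.
HB.instance Definition _ := GRing.isZmodMorphism.Build M quo_type cls clsB.

Definition qscale (a : R) (q : quo_type) : quo_type :=
  cls (a *: repr (q : Quotient.quot submodz)).
Lemma qscaleE a x : qscale a (cls x) = cls (a *: x).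
Proof.
apply/cls_eq; rewrite -scalerBr; apply: rpredZ.
by apply/cls_eq; rewrite {1}/cls reprK.
Qed.
Lemma qscaleA a b v : qscale a (qscale b v) = qscale (a * b) v.
Proof. by have [x ->] := cls_surj v; rewrite !qscaleE scalerA. Qed.
Lemma qscale1 : left_id 1 qscale.
Proof. by move=> v; have [x ->] := cls_surj v; rewrite qscaleE scale1r. Qed.
Lemma qscaleDr : right_distributive qscale +%R.
Proof.
move=> a u v; have [x ->] := cls_surj u; have [y ->] := cls_surj v.
by rewrite -raddfD !qscaleE scalerDr raddfD.
Qed.
Lemma qscaleDl v : {morph qscale^~ v : a b / a + b}.
Proof.
by move=> a b; have [x ->] := cls_surj v; rewrite !qscaleE scalerDl raddfD.
Qed.
HB.instance Definition _ :=
  GRing.Zmodule_isLmodule.Build R quo_type qscaleA qscale1 qscaleDr qscaleDl.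
Lemma clsZ : scalable cls. Proof. by move=> a x; rewrite -qscaleE. Qed.
HB.instance Definition _ := GRing.isScalable.Build R M quo_type *:%R cls clsZ.

(* M / N *)
Definition quo : lmodType R := GRing.Lmodule.clone R quo_type _.

Lemma clsZE a x : cls (a *: x) = a *: (cls x : quo).
Proof. exact: clsZ. Qed.
Lemma cls_sum I (s : seq I) (F : I -> M) :
  cls (\sum_(i <- s) F i) = \sum_(i <- s) (cls (F i) : quo).
Proof. exact: raddf_sum. Qed.

Definition subm_type := {x : M | x \in N}.
HB.instance Definition _ := SubType.on subm_type.
HB.instance Definition _ := Choice.on subm_type.
HB.instance Definition _ :=
  GRing.SubChoice_isSubLmodule.Build R M (fun x => x \in N) subm_type
    (GRing.subsemimodClosedP N).

Definition subm : lmodType R := GRing.Lmodule.clone R subm_type _.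

End Quotient.

Section Invariants.
Variable R : comNzRingType.
Implicit Types (M : lmodType R) (m : submodClosed R^o).

Definition fg M : Prop :=
  exists n (s : 'I_n -> M),
    forall x, exists a : 'I_n -> R, x = \sum_(i < n) a i *: s i.

Definition noetherian : Prop :=
  forall I : submodClosed R^o, exists n (s : 'I_n -> R),
    forall x : R, (x : R^o) \in I <->
      exists a : 'I_n -> R, x = \sum_(i < n) a i * s i.

Definition maximal_ideal (I : submodClosed R^o) : Prop :=
  (1 : R^o) \notin I /\
  forall J : submodClosed R^o,
    {subset I <= J} -> (1 : R^o) \notin J -> {subset J <= I}.

Definition local_ideal m : Prop :=
  maximal_ideal m /\ forall J, maximal_ideal J -> J =i m.

Definition isomorphic M M' : Prop :=
  exists f : {linear M -> M'}, bijective f.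

(* Length of M; 0 (junk) if M does not have finite length. *)
Definition mod_length M : nat :=
  nmax [set n | exists N : 'I_n.+1 -> submodClosed M,
                  forall i j : 'I_n.+1, (i < j)%N -> psub (N i) (N j)].

(* Krull dimension of R / Ann M; 0 if M = 0. *)
Definition krull_dim M : nat :=
  nmax [set n | exists P : 'I_n.+1 -> prime_idealr R,
    (forall i a, (forall z : M, a *: z = 0) -> a \in P i) /\
    (forall i j : 'I_n.+1, (i < j)%N -> psub (P i) (P j))].

Definition regular_on M (x : R) : Prop := forall z : M, x *: z = 0 -> z = 0.

Fixpoint regseq (s : seq R) M : Prop :=
  if s is x :: s' then regular_on M x /\ regseq s' (quo (xmul M x))
  else exists z : M, z <> 0.

(* Depth of M with respect to the ideal m; 0 if M = 0. *)
Definition depth m M : nat :=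
  nmax [set n | exists s : seq R,
    [/\ size s = n, (forall x : R, x \in s -> (x : R^o) \in m) & regseq s M]].

(* With the above conventions, the zero module is Cohen-Macaulay. *)
Definition cohen_macaulay m M : Prop := depth m M = krull_dim M.

Definition hilbert_samuel m M (P : {poly rat}) : Prop :=
  exists n0, forall n, (n0 <= n)%N ->
    (mod_length (quo (ipow M m n)))%:R = P.[n%:R].

(* The multiplicity e of M with respect to m: the Hilbert-Samuel polynomial of
   M is (e / d!) n^d + (terms of lower degree), where d = dim M. *)
Definition multiplicity m M : nat :=
  xget 0%N [set e | exists P : {poly rat},
    [/\ hilbert_samuel m M P, (size P <= (krull_dim M).+1)%N
      & P`_(krull_dim M) = e%:R / (krull_dim M)`!%:R]].

(* Gamma_m(M) *)
Definition gammap m M (z : M) : bool :=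
  `[< exists t, forall a : R, (a : R^o) \in ipow R^o m t -> a *: z = 0 >].
Lemma gammap_closed m M : GRing.subsemimod_closed (@gammap m M).
Proof.
split; first split.
- by apply/asboolP; exists 0%N => a _; rewrite scaler0.
- move=> x y /asboolP[s hs] /asboolP[t ht]; apply/asboolP.
  exists (maxn s t) => a ha; rewrite scalerDr hs ?ht ?addr0 //.
    exact: ipow_leq (leq_maxr s t) _ ha.
  exact: ipow_leq (leq_maxl s t) _ ha.
- move=> b x /asboolP[t ht]; apply/asboolP; exists t => a ha.
  by rewrite scalerA mulrC -scalerA ht // scaler0.
Qed.
HB.instance Definition _ m M :=
  GRing.isSubmodClosed.Build R M (@gammap m M) (gammap_closed m M).
Definition gamma m M : submodClosed M :=
  GRing.SubmodClosed.clone R M (@gammap m M) _.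

End Invariants.

(* e is a basis of the k-subspace S of V. *)
Definition kbasis (k : fieldType) (V : lmodType k) (S : set V) n
    (e : 'I_n -> V) : Prop :=
  (forall i, S (e i)) /\
  forall v, S v -> exists! c : 'I_n -> k, v = \sum_(i < n) c i *: e i.

Definition kdim (k : fieldType) (V : lmodType k) : nat :=
  xget 0%N [set n | exists e : 'I_n -> V, kbasis setT e].

(* O is a Zariski-open subset of the finite-dimensional k-subspace S of V: in
   the coordinates given by some basis of S, its complement in S is the set of
   common zeros of a family of polynomials. *)
Definition zariski_open (k : fieldType) (V : lmodType k) (S O : set V) : Prop :=
  exists n (e : 'I_n -> V) (F : set {mpoly k[n]}),
    kbasis S e /\
    O = [set v | exists2 c : 'I_n -> k, v = \sum_(i < n) c i *: e i &
                   exists2 p, F p & p.@[c] != 0].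

(* A surjection R -> k onto a field, i.e. a maximal ideal m of R (its kernel)
   together with an identification of the residue field R / m with k. *)
Record residue_map (R : comNzRingType) (k : fieldType) := ResidueMap {
  res_map :> {rmorphism R -> k};
  res_surj : forall c : k, exists r : R, res_map r = c }.

Section ResidueMap.
Variables (R : comNzRingType) (k : fieldType) (p : residue_map R k).

Definition kerp (x : R^o) : bool := p x == 0.
Lemma kerp_closed : GRing.subsemimod_closed kerp.
Proof.
rewrite /kerp; split; first split; rewrite ?unfold_in.
- by rewrite rmorph0.
- by move=> x y; rewrite !unfold_in rmorphD => /eqP-> /eqP->; rewrite addr0.
- by move=> a x; rewrite !unfold_in rmorphM => /eqP->; rewrite mulr0.
Qed.
HB.instance Definition _ := GRing.isSubmodClosed.Build R R^o kerp kerp_closed.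
Definition kerI : submodClosed R^o := GRing.SubmodClosed.clone R R^o kerp _.

Definition res_lift (c : k) : R := xget 0 [set r | p r = c].
Lemma res_liftK c : p (res_lift c) = c.
Proof. by rewrite /res_lift; case: xgetP => [//|]; have [r hr] := res_surj p c => /(_ r). Qed.

Section Fiber.
Variable W : lmodType R.
Definition fiber_type := quo_type (imul kerI (full W)).
HB.instance Definition _ := GRing.Zmodule.on fiber_type.
Definition fcls (x : W) : fiber_type := cls (imul kerI (full W)) x.
Lemma fcls_surj (q : fiber_type) : exists x, q = fcls x.
Proof. exact: cls_surj. Qed.
Lemma fclsB : zmod_morphism fcls. Proof. by move=> x y; rewrite /fcls raddfB. Qed.
HB.instance Definition _ := GRing.isZmodMorphism.Build W fiber_type fcls fclsB.
Lemma fclsD x y : fcls (x + y) = fcls x + fcls y.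
Proof. exact: raddfD. Qed.
Lemma fcls0 : fcls 0 = 0. Proof. exact: raddf0. Qed.
Lemma fcls_ker a x : p a = 0 -> fcls (a *: x) = 0.
Proof.
move=> pa; rewrite -(raddf0 fcls); apply/cls_eq; rewrite subr0.
apply/asboolP => N; apply; exists (a : R^o), x; split=> //.
exact/eqP.
Qed.
Definition fscale (c : k) (q : fiber_type) : fiber_type :=
  res_lift c *: (q : quo (imul kerI (full W))).
Lemma fscaleE a x : fscale (p a) (fcls x) = fcls (a *: x).
Proof.
apply/eqP; rewrite -subr_eq0; apply/eqP.
rewrite /fscale /fcls -linearZ /= -/(fcls _) -/(fcls _) -raddfB -scalerBl.
by apply: fcls_ker; rewrite rmorphB res_liftK subrr.
Qed.
Lemma fscaleA a b v : fscale a (fscale b v) = fscale (a * b) v.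
Proof.
have [x ->] := fcls_surj v; rewrite -[a]res_liftK -[b]res_liftK !fscaleE -rmorphM.
by rewrite fscaleE scalerA.
Qed.
Lemma fscale1 : left_id 1 fscale.
Proof.
by move=> v; have [x ->] := fcls_surj v; rewrite -(rmorph1 p) fscaleE scale1r.
Qed.
Lemma fscaleDr : right_distributive fscale +%R.
Proof. by move=> a u v; rewrite /fscale -scalerDr. Qed.
Lemma fscaleDl v : {morph fscale^~ v : a b / a + b}.
Proof.
move=> a b; have [x ->] := fcls_surj v; rewrite -[a]res_liftK -[b]res_liftK -rmorphD.
by rewrite !fscaleE scalerDl raddfD.
Qed.
HB.instance Definition _ :=
  GRing.Zmodule_isLmodule.Build k fiber_type fscaleA fscale1 fscaleDr fscaleDl.
Lemma fclsZ a x : fcls (a *: x) = p a *: fcls x.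
Proof. by rewrite -fscaleE. Qed.

(* The k-vector space W / mW, where m = kerI. *)
Definition fiber : lmodType k := GRing.Lmodule.clone k fiber_type _.

End Fiber.

(* dim_k M / mM *)
Definition nu (M : lmodType R) : nat := kdim (fiber M).

End ResidueMap.

Section DirectSum.
Variables (k : fieldType) (V : nat -> lmodType k).

Record dsum_type := DSum {
  dcomp :> forall i, V i;
  dcomp_fin : exists n, forall i, (n <= i)%N -> dcomp i = 0 }.

Lemma dsum_eq (f g : dsum_type) : (forall i, f i = g i) -> f = g.
Proof.
case: f => f hf; case: g => g hg /= fg.
have E : f = g by apply: functional_extensionality_dep.
by rewrite E in hf *; rewrite (Prop_irrelevance hf hg).
Qed.

HB.instance Definition _ := gen_eqMixin dsum_type.
HB.instance Definition _ := gen_choiceMixin dsum_type.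

Program Definition dzero : dsum_type := @DSum (fun=> 0) _.
Next Obligation. by exists 0%N. Qed.
Program Definition dopp (f : dsum_type) : dsum_type := @DSum (fun i => - f i) _.
Next Obligation.
by have [n hn] := dcomp_fin f; exists n => i /hn ->; rewrite oppr0.
Qed.
Program Definition dadd (f g : dsum_type) : dsum_type := @DSum (fun i => f i + g i) _.
Next Obligation.
have [n hn] := dcomp_fin f; have [n' hn'] := dcomp_fin g; exists (maxn n n') => i.
by rewrite geq_max => /andP[/hn -> /hn' ->]; rewrite addr0.
Qed.
Program Definition dscale (a : k) (f : dsum_type) : dsum_type := @DSum (fun i => a *: f i) _.
Next Obligation.
by have [n hn] := dcomp_fin f; exists n => i /hn ->; rewrite scaler0.
Qed.
Lemma daddA : associative dadd.
Proof. by move=> f g h; apply: dsum_eq => i /=; rewrite addrA. Qed.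
Lemma daddC : commutative dadd.
Proof. by move=> f g; apply: dsum_eq => i /=; rewrite addrC. Qed.
Lemma dadd0 : left_id dzero dadd.
Proof. by move=> f; apply: dsum_eq => i /=; rewrite add0r. Qed.
Lemma daddN : left_inverse dzero dopp dadd.
Proof. by move=> f; apply: dsum_eq => i /=; rewrite addNr. Qed.
HB.instance Definition _ := GRing.isZmodule.Build dsum_type daddA daddC dadd0 daddN.
Lemma dscaleA a b f : dscale a (dscale b f) = dscale (a * b) f.
Proof. by apply: dsum_eq => i /=; rewrite scalerA. Qed.
Lemma dscale1 : left_id 1 dscale.
Proof. by move=> f; apply: dsum_eq => i /=; rewrite scale1r. Qed.
Lemma dscaleDr : right_distributive dscale +%R.
Proof. by move=> a f g; apply: dsum_eq => i /=; rewrite scalerDr. Qed.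
Lemma dscaleDl f : {morph dscale^~ f : a b / a + b}.
Proof. by move=> a b; apply: dsum_eq => i /=; rewrite scalerDl. Qed.
HB.instance Definition _ :=
  GRing.Zmodule_isLmodule.Build k dsum_type dscaleA dscale1 dscaleDr dscaleDl.

(* The direct sum of the k-vector spaces V i. *)
Definition dsum : lmodType k := GRing.Lmodule.clone k dsum_type _.

Definition dsum_homog (d : nat) : set dsum :=
  [set f | forall i, i <> d -> f i = 0].

End DirectSum.

(* Commuting operators Y_1, ..., Y_N on a k-vector space V make V a module
   over k[X_1, ..., X_N]. *)
Section OperatorModule.
Variables (k : fieldType) (V : lmodType k) (N : nat).
Variable Y : 'I_N -> {linear V -> V}.
Hypothesis Ycomm : forall i j v, Y i (Y j v) = Y j (Y i v).

Definition monact (u : 'X_{1..N}) (v : V) : V :=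
  foldr (fun i => iter (u i) (Y i)) v (enum 'I_N).
Definition polyact (q : {mpoly k[N]}) (v : V) : V :=
  \sum_(u <- msupp q) q@_u *: monact u v.

Lemma monact_linear u : linear (monact u).
Proof.
rewrite /monact => a x y; elim: (enum _) => [//|i s IH] /=; rewrite {}IH.
by elim: (u i) => [//|n IH] /=; rewrite IH linearP.
Qed.
HB.instance Definition _ u :=
  GRing.isLinear.Build k V V *:%R (monact u) (monact_linear u).

Lemma monact0 v : monact 0%MM v = v.
Proof. by rewrite /monact; elim: (enum _) => [//|i s IH] /=; rewrite mnm0E. Qed.

Lemma iterC i j a b v :
  iter a (Y i) (iter b (Y j) v) = iter b (Y j) (iter a (Y i) v).
Proof.
elim: a => [//|a IH] /=; rewrite IH.
by elim: b {IH} => [//|b IH] /=; rewrite Ycomm IH.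
Qed.

Lemma monactD u w v : monact (u + w)%MM v = monact u (monact w v).
Proof.
rewrite /monact; elim: (enum _) => [//|i s IH] /=.
rewrite {}IH mnmDE iterD; congr iter.
move: (foldr (fun i => iter (w i) (Y i)) v s) => {}v.
by elim: s => [//|j s IH] /=; rewrite -IH iterC.
Qed.

Lemma polyactE (s : seq 'X_{1..N}) q v : uniq s -> {subset msupp q <= s} ->
  polyact q v = \sum_(u <- s) q@_u *: monact u v.
Proof.
move=> us hs; rewrite (bigID (fun u => u \in msupp q)) /=.
rewrite [X in _ + X]big1 ?addr0; last first.
  by move=> u /memN_msupp_eq0 ->; rewrite scale0r.
rewrite -big_filter /polyact; apply: perm_big; apply: uniq_perm => //.
  exact: filter_uniq.
by move=> u; rewrite mem_filter; case: (boolP (u \in msupp q)) => // /hs ->.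
Qed.

Lemma polyactDl v : {morph polyact^~ v : q r / q + r}.
Proof.
move=> q r; pose s := undup (msupp q ++ msupp r).
have us : uniq s by exact: undup_uniq.
rewrite !(@polyactE s) //.
- by rewrite -big_split /=; apply: eq_bigr => u _; rewrite mcoeffD scalerDl.
- by move=> u hu; rewrite mem_undup mem_cat hu orbT.
- by move=> u hu; rewrite mem_undup mem_cat hu.
- by move=> u /msuppD_le hu; rewrite mem_undup.
Qed.

Lemma polyact0 v : polyact 0 v = 0.
Proof. by rewrite /polyact msupp0 big_nil. Qed.

Lemma polyact_suml I (s : seq I) (F : I -> {mpoly k[N]}) v :
  polyact (\sum_(i <- s) F i) v = \sum_(i <- s) polyact (F i) v.
Proof. by apply: (big_morph (polyact^~ v)); [exact: polyactDl | exact: polyact0]. Qed.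

Lemma polyactX c u v : polyact (c *: 'X_[u]) v = c *: monact u v.
Proof.
rewrite (@polyactE [:: u]) //; first by rewrite big_seq1 mcoeffZ mcoeffX eqxx mulr1.
by move=> w /msuppZ_le; rewrite msuppX.
Qed.

Lemma polyactDr : right_distributive polyact +%R.
Proof.
move=> q v w; rewrite /polyact -big_split /=; apply: eq_bigr => u _.
by rewrite raddfD scalerDr.
Qed.

Lemma polyact_sumr I (s : seq I) q (F : I -> V) :
  polyact q (\sum_(i <- s) F i) = \sum_(i <- s) polyact q (F i).
Proof.
apply: (big_morph (polyact q)); first exact: polyactDr.
by rewrite /polyact big1 // => u _; rewrite raddf0 scaler0.
Qed.

Lemma polyactA q r v : polyact q (polyact r v) = polyact (q * r) v.
Proof.
rewrite [q]mpolyE [r]mpolyE mulr_suml !polyact_suml; apply: eq_bigr => u _.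
rewrite polyact_sumr mulr_sumr polyact_suml; apply: eq_bigr => w _.
rewrite -scalerAl -scalerAr -mpolyXD scalerA !polyactX.
by rewrite linearZ /= scalerA monactD.
Qed.

Lemma polyact1 : left_id 1 polyact.
Proof.
by move=> v; rewrite -mpolyX0 -[X in polyact X]scale1r polyactX monact0 scale1r.
Qed.

End OperatorModule.

Section AssociatedGraded.
Variables (R : comNzRingType) (k : fieldType) (p : residue_map R k).
Local Notation m := (kerI p).

(* m^i M / m^{i+1} M, as the quotient W / mW of W = m^i M *)
Definition grpiece (M : lmodType R) (i : nat) : lmodType k :=
  fiber p (subm (ipow M m i)).

(* gr_m(M) as a k-vector space *)
Definition grspace (M : lmodType R) : lmodType k := dsum (grpiece M).

Section Action.
Variables (M : lmodType R) (y : subm m).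

Lemma grmul_subproof i (x : subm (ipow M m i)) :
  (val y : R) *: val x \in ipow M m i.+1.
Proof.
by apply/asboolP => N; apply; exists (val y), (val x); split=> //; exact: valP.
Qed.
Definition grmulr i (x : subm (ipow M m i)) : subm (ipow M m i.+1) :=
  exist _ ((val y : R) *: val x) (grmul_subproof x).
Lemma grmulrD i (u v : subm (ipow M m i)) :
  grmulr (u + v) = grmulr u + grmulr v.
Proof. by apply: val_inj; rewrite /= scalerDr. Qed.
Lemma grmulrZ i a (u : subm (ipow M m i)) : grmulr (a *: u) = a *: grmulr u.
Proof. by apply: val_inj; rewrite /= !scalerA mulrC. Qed.
Lemma grmulr0 i : grmulr (0 : subm (ipow M m i)) = 0.
Proof. by apply: val_inj; rewrite /= scaler0. Qed.

(* multiplication m^i M / m^{i+1} M -> m^{i+1} M / m^{i+2} M by the class of y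
   in m / m^2 *)
Definition grmul i (q : grpiece M i) : grpiece M i.+1 :=
  fcls p (grmulr (repr (q : Quotient.quot (submodz (imul m (full _)))))).
Lemma grmulE i (x : subm (ipow M m i)) : grmul (fcls p x) = fcls p (grmulr x).
Proof.
apply/cls_eq; set r := repr _.
have -> : grmulr r - grmulr x = grmulr (r - x).
  by rewrite -scaleN1r -grmulrZ -grmulrD scaleN1r.
have : r - x \in imul m (full (subm (ipow M m i))).
  by apply/cls_eq; rewrite /cls reprK.
move: (r - x) => d; elim/mspan_ind: d / => [|a b ha hb|a b hb|_ [a [b [am _ ->]]]].
- by rewrite grmulr0 rpred0.
- by rewrite grmulrD rpredD.
- by rewrite grmulrZ rpredZ.
- rewrite grmulrZ; apply/asboolP => N; apply.
  by exists a, (grmulr b).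
Qed.
Lemma grmul0 i : @grmul i 0 = 0.
Proof. by rewrite -(fcls0 p) grmulE grmulr0 fcls0. Qed.
Lemma grmul_linear i : linear (@grmul i).
Proof.
move=> a u v; have [x ->] := fcls_surj u; have [x' ->] := fcls_surj v.
rewrite -[a](res_liftK p) -fclsZ -fclsD !grmulE grmulrD grmulrZ fclsD.
by rewrite fclsZ.
Qed.

(* multiplication by the class of y on gr_m(M) *)
Definition grop_comp (f : grspace M) (i : nat) : grpiece M i :=
  if i is i'.+1 then grmul (f i') else 0.
Lemma grop_fin f : exists n, forall i, (n <= i)%N -> grop_comp f i = 0.
Proof.
have [n hn] := dcomp_fin f; exists n.+1 => -[//|i] /hn /= ->.
exact: grmul0.
Qed.
Definition grop (f : grspace M) : grspace M := DSum (grop_fin f).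
Lemma grop_linear : linear grop.
Proof.
move=> a f g; apply: dsum_eq => -[|i] /=; first by rewrite scaler0 addr0.
exact: grmul_linear.
Qed.
HB.instance Definition _ :=
  GRing.isLinear.Build k (grspace M) (grspace M) *:%R grop grop_linear.

End Action.

Lemma grop_comm M (y z : subm m) (f : grspace M) :
  grop y (grop z f) = grop z (grop y f).
Proof.
apply: dsum_eq => -[//|[|i]] /=; first by rewrite !grmul0.
have [x ->] := fcls_surj (f i); rewrite !grmulE; congr fcls.
by apply: val_inj; rewrite /= !scalerA mulrC.
Qed.

Section PolyModule.
Variables (N : nat) (y : 'I_N -> subm m) (M : lmodType R).

Definition gr_type of 'I_N -> subm m : Type := dsum_type (grpiece M).
Local Notation grM := (gr_type y).
HB.instance Definition _ := GRing.Zmodule.on grM.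
Definition gract (q : {mpoly k[N]}) (f : grM) : grM :=
  polyact (fun i => @grop M (y i)) q f.
Lemma grop_commE i j f : @grop M (y i) (@grop M (y j) f) = grop (y j) (grop (y i) f).
Proof. exact: grop_comm. Qed.
HB.instance Definition _ := GRing.Zmodule_isLmodule.Build {mpoly k[N]} grM
  (polyactA grop_commE) (@polyact1 _ _ _ _) (@polyactDr _ _ _ _) (@polyactDl _ _ _ _).


(* gr_m(M) as a module over k[X_1, ..., X_N], where X_i acts as multiplication
   by the class of y_i in m / m^2; its component of degree d is
   dsum_homog d = m^d M / m^{d+1} M. *)
Definition gr : lmodType {mpoly k[N]} :=
  GRing.Lmodule.clone {mpoly k[N]} grM _.
Definition gr_homog (d : nat) : set gr := @dsum_homog k (grpiece M) d.

End PolyModule.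

(* The unit of gr_m(R). *)
Definition gr1_comp (i : nat) : grpiece R^o i :=
  if i is 0 then fcls p (exist _ (1 : R^o) isT : subm (ipow R^o m 0)) else 0.
Lemma gr1_fin : exists n, forall i, (n <= i)%N -> gr1_comp i = 0.
Proof. by exists 1%N => -[]. Qed.
Definition gr1 N (y : 'I_N -> subm m) : gr y R^o := DSum gr1_fin.

(* The homomorphism k[X_1, ..., X_N] -> gr_m(R) sending X_i to the class of y_i
   is onto. *)
Definition gr_presented N (y : 'I_N -> subm m) : Prop :=
  forall f : gr y R^o, exists q : {mpoly k[N]}, f = q *: gr1 y.

End AssociatedGraded.

Section LinearResolution.
Variables (k : fieldType) (N : nat).
Local Notation T := {mpoly k[N]}.

(* Graded free modules F_i = (+)_j T[- shift i j], homomorphisms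
   F_{i+1} -> F_i, v |-> v *m dmat i, and the images in G of the basis of F_0 *)
Record free_complex (G : lmodType T) := FreeComplex {
  rank : nat -> nat;
  shift : forall i, 'I_(rank i) -> nat;
  dmat : forall i, 'M[T]_(rank i.+1, rank i);
  aug : 'I_(rank 0) -> G }.

Definition aug_map G (F : free_complex G) (v : 'rV[T]_(rank F 0)) : G :=
  \sum_j v 0 j *: aug j.

Record minimal_graded_resolution (G : lmodType T) (Gd : nat -> set G)
    (F : free_complex G) : Prop := {
  aug_homog : forall j, Gd (shift j) (aug (f := F) j);
  diff_homog : forall i j l u, u \in msupp (dmat F i j l) ->
    (mdeg u + shift l = shift j)%N;
  aug_onto : forall g, exists v, g = aug_map (F := F) v;
  exact_aug : forall v, aug_map (F := F) v = 0 <-> exists w, v = w *m dmat F 0;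
  exact_diff : forall i (v : 'rV_(rank F i.+1)),
    v *m dmat F i = 0 <-> exists w, v = w *m dmat F i.+1;
  diff_minimal : forall i j l, (dmat F i j l)@_0 = 0 }.

Definition linear_resolution (G : lmodType T) (Gd : nat -> set G) : Prop :=
  exists F : free_complex G, minimal_graded_resolution Gd F /\
    forall i (j : 'I_(rank F i)), shift j = i.

End LinearResolution.

(* A polynomial ring over k mapping onto gr_m(R) is given by elements y_i of m
   whose classes in m / m^2 generate gr_m(R); all such choices are allowed. *)
Definition gr_linear_resolution (R : comNzRingType) (k : fieldType)
    (p : residue_map R k) (M : lmodType R) : Prop :=
  forall N (y : 'I_N -> subm (kerI p)), gr_presented y ->
    linear_resolution (@gr_homog R k p N y M).

Section FgQuotient.
Variables (R : comNzRingType) (M : lmodType R) (N : submodClosed M).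
Lemma quo_fg : fg M -> fg (quo N).
Proof.
move=> [n [s hs]]; exists n, (fun i => cls N (s i)) => q.
have [x ->] := cls_surj q; have [a ->] := hs x; exists a.
by rewrite cls_sum; apply: eq_bigr => i _; rewrite clsZE.
Qed.
End FgQuotient.

Section Local.
Variables (R : comNzRingType) (k : fieldType) (p : residue_map R k).
Local Notation m := (kerI p).

Record fgmod := FgMod { fgm :> lmodType R; fgmP : fg fgm }.

Definition fgquo (M : fgmod) (N : submodClosed M) : fgmod :=
  FgMod (quo_fg N (@fgmP M)).

Record genericity (U : fgmod -> set R) : Prop := {
  gen_iso : forall M M' : fgmod, isomorphic M M' -> U M = U M';
  gen_nonempty : forall M, U M !=set0;
  gen_sub : forall M f, U M f ->
    (f : R^o) \in m /\ (f : R^o) \notin ipow R^o m 2;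
  gen_mod2 : forall M f g, (f - g : R^o) \in ipow R^o m 2 -> (U M f <-> U M g);
  gen_open : forall M, exists O : set (fiber p (subm m)),
    [/\ zariski_open setT O, O !=set0
      & O `<=` [set q | exists2 f : subm m, U M (val f) & q = fcls p f]];
  gen_reg : forall M : fgmod, (0 < depth m M)%N ->
    forall f, U M f -> regular_on M f }.

Record cohomological_degree (K : realType) (U : fgmod -> set R)
    (Deg : fgmod -> K) : Prop := {
  cd_iso : forall M M' : fgmod, isomorphic M M' -> Deg M = Deg M';
  cd_gamma : forall M : fgmod,
    Deg M = Deg (fgquo (gamma m M)) + (mod_length (subm (gamma m M)))%:R;
  cd_generic : forall M : fgmod, (0 < depth m M)%N ->
    forall x, U M x -> Deg (fgquo (xmul M x)) <= Deg M;
  cd_cm : forall M : fgmod, cohen_macaulay m M ->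
    Deg M = (multiplicity m M)%:R }.

End Local.

Section Graded.

(* V is the internal direct sum of the subgroups G i. *)
Record grading (I : eqType) (V : zmodType) (G : I -> set V) : Prop := {
  grad0 : forall i, G i 0;
  gradB : forall i x y, G i x -> G i y -> G i (x - y);
  grad_sum : forall x, exists (s : seq I) (f : I -> V),
    [/\ uniq s, forall i, G i (f i) & x = \sum_(i <- s) f i];
  grad_direct : forall (s : seq I) (f : I -> V), uniq s ->
    (forall i, G i (f i)) -> \sum_(i <- s) f i = 0 ->
    forall i, i \in s -> f i = 0 }.

Variables (k : fieldType) (R : comAlgType k).

Record homogeneous_algebra (Rg : nat -> set R) : Prop := {
  ha_grading : grading Rg;
  ha_mul : forall i j a b, Rg i a -> Rg j b -> Rg (i + j)%N (a * b);
  ha_deg0 : Rg 0%N = [set a | exists c : k, a = c%:A];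
  ha_deg1 : exists n (e : 'I_n -> R), kbasis (Rg 1%N) e;
  ha_gen : forall A : subalgClosed R,
    (forall a, Rg 1%N a -> a \in A) -> forall a, a \in A }.

(* p is the projection of R onto R_0 = k, with kernel (+)_{i >= 1} R_i. *)
Record augmentation (Rg : nat -> set R) (p : residue_map R k) : Prop := {
  aug_scalar : forall c : k, p c%:A = c;
  aug_ker : forall a : R, (a : R^o) \in kerI p <->
    exists n (f : 'I_n -> R), (forall i : 'I_n, Rg i.+1 (f i)) /\ a = \sum_i f i }.

Variable Rg : nat -> set R.

Record gmod := GMod {
  gm :> lmodType R;
  gmG : int -> set gm;
  gm_grading : grading gmG;
  gm_mul : forall (i : nat) (j : int) a x,
    Rg i a -> gmG j x -> gmG (i%:Z + j) (a *: x);
  gm_fg : fg gm }.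

Definition gisomorphic (M M' : gmod) : Prop :=
  exists f : {linear M -> M'},
    bijective f /\ forall i x, @gmG M i x -> @gmG M' i (f x).

(* N is generated by homogeneous elements. *)
Definition homog_sub (M : gmod) (N : submodClosed M) : Prop :=
  forall x, x \in N -> exists s : seq M,
    (forall z, z \in s -> z \in N /\ exists d, gmG d z) /\ x = \sum_(z <- s) z.

Section GradedQuotient.
Variables (M : gmod) (N : submodClosed M) (hN : homog_sub N).

Definition gquoG (i : int) : set (quo N) := cls N @` @gmG M i.

Lemma grad_sumP (I : eqType) (V : zmodType) (G : I -> set V) (hG : grading G)
  (T : Type) (s : seq T) (P : pred T) (f : T -> V) i :
  (forall t, P t -> G i (f t)) -> G i (\sum_(t <- s | P t) f t).
Proof.
move=> h; elim/big_ind: _ => [|x y Gx Gy|t Pt]; [exact: (grad0 hG)| |exact: h].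
have := gradB hG Gx (gradB hG (grad0 hG i) Gy).
by rewrite sub0r opprK.
Qed.

Lemma homog_sub_comp (s : seq int) (f : int -> M) : uniq s ->
  (forall i, @gmG M i (f i)) -> \sum_(i <- s) f i \in N ->
  forall i, i \in s -> f i \in N.
Proof.
move=> us hf /hN [t [ht E]] i is_.
have hd0 z : exists d, z \in t -> @gmG M d z.
  case: (boolP (z \in t)) => [/ht [_ [d hd]]|_]; first by exists d.
  by exists 0.
have [d hd] := choice hd0.
pose g j := \sum_(z <- t | (z \in t) && (d z == j)) z.
have gG j : @gmG M j (g j).
  by apply: (grad_sumP (@gm_grading M)) => z /andP[zt /eqP <-]; exact: hd.
have gN j : g j \in N.
  by apply: rpred_sum => z /andP[/ht[]].
pose f' j := if j \in s then f j else 0.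
have f'G j : @gmG M j (f' j).
  by rewrite /f'; case: ifP => // _; exact: (grad0 (@gm_grading M)).
pose T := undup (s ++ map d t).
have uT : uniq T by exact: undup_uniq.
have E1 : \sum_(j <- T) f' j = \sum_(j <- s) f j.
  rewrite (bigID (fun j => j \in s)) /= [X in _ + X]big1 ?addr0; last first.
    by move=> j /negPf js; rewrite /f' js.
  rewrite -big_filter (perm_big s) /=; last first.
    apply: uniq_perm => //; first exact: filter_uniq.
    by move=> j; rewrite mem_filter mem_undup mem_cat; case: (j \in s).
  by rewrite big_seq [RHS]big_seq; apply: eq_bigr => j js; rewrite /f' js.
have E2 : \sum_(j <- T) g j = \sum_(z <- t) z.
  rewrite /g; under eq_bigr do rewrite big_mkcondr /=.
  rewrite exchange_big /= big_seq_cond [RHS]big_seq; apply: eq_big => [z|z].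
    by rewrite andbb.
  move=> /andP[zt _]; rewrite (bigD1_seq (d z)) //=; last first.
    by rewrite mem_undup mem_cat map_f ?orbT.
  by rewrite eqxx big1 ?addr0 // => j; rewrite eq_sym => /negPf ->.
have iT : i \in T by rewrite mem_undup mem_cat is_.
have := @grad_direct _ _ _ (@gm_grading M) T (fun j => f' j - g j) uT.
move=> /(_ (fun j => gradB (@gm_grading M) (f'G j) (gG j))).
rewrite sumrB E1 E2 E subrr => /(_ erefl i iT) /eqP.
by rewrite subr_eq0 /f' is_ => /eqP ->.
Qed.

Lemma gquo_grading : grading gquoG.
Proof.
have hG := @gm_grading M; split.
- by move=> i; exists 0; [exact: (grad0 hG) | exact: raddf0].
- move=> i _ _ [x hx <-] [y hy <-]; exists (x - y); first exact: (gradB hG).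
  by rewrite raddfB.
- move=> q; have [x ->] := cls_surj q; have [s [f [us hf ->]]] := grad_sum hG x.
  exists s, (fun i => cls N (f i)); split=> //; first by move=> i; exists (f i).
  by rewrite raddf_sum.
- move=> s F us hF E i is_.
  have hF1 j : exists x, @gmG M j x /\ cls N x = F j.
    by have [x] := hF j; exists x.
  have [f hf] := choice hF1.
  have hf1 j : @gmG M j (f j) by case: (hf j).
  have hf2 j : cls N (f j) = F j by case: (hf j).
  rewrite -hf2 -(raddf0 (cls N)); apply/cls_eq; rewrite subr0.
  apply: (homog_sub_comp us) => //; rewrite -[X in X \in N]subr0; apply/cls_eq.
  by rewrite cls_sum raddf0 -[RHS]E; apply: eq_bigr => j _; exact: hf2.
Qed.

Lemma gquo_mul (i : nat) (j : int) a q :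
  Rg i a -> gquoG j q -> gquoG (i%:Z + j) (a *: q).
Proof.
move=> ha [x hx <-]; exists (a *: x); last by rewrite linearZ.
exact: gm_mul.
Qed.

Definition gquo : gmod := GMod gquo_grading gquo_mul (quo_fg N (@gm_fg M)).

End GradedQuotient.

Lemma xmul_homog (M : gmod) x : Rg 1%N x -> homog_sub (xmul M x).
Proof.
move=> hx _ /asboolP[w ->]; have [s [f [us hf ->]]] := grad_sum (@gm_grading M) w.
exists [seq x *: f i | i <- s]; split; last first.
  by rewrite big_map scaler_sumr.
move=> _ /mapP[i _ ->]; split; first by apply/asboolP; exists (f i).
by exists (1%N%:Z + i); apply: gm_mul.
Qed.

Section Gamma.
Variable p : residue_map R k.
Hypotheses (hR : homogeneous_algebra Rg) (hp : augmentation Rg p).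
Local Notation m := (kerI p).

(* a is a sum of homogeneous elements of S *)
Let hsum (S : R -> Prop) (a : R) : Prop :=
  exists s : seq R, (forall z, z \in s -> S z /\ exists d, Rg d z) /\
                    a = \sum_(z <- s) z.

Let hsumD S a b : hsum S a -> hsum S b -> hsum S (a + b).
Proof.
move=> [s [hs ->]] [t [ht ->]]; exists (s ++ t); rewrite big_cat; split=> //.
by move=> z; rewrite mem_cat => /orP[/hs|/ht].
Qed.

Let hsumM S S' S'' a b : (forall x y, S x -> S' y -> S'' (x * y)) ->
  hsum S a -> hsum S' b -> hsum S'' (a * b).
Proof.
move=> h [s [hs ->]] [t [ht ->]]; exists [seq x * y | x <- s, y <- t]; split.
  move=> _ /allpairsP[[x y] /= [/hs [Sx [d hd]] /ht [Sy [e he]] ->]].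
  by split; [exact: h | exists (d + e)%N; exact: (ha_mul hR)].
rewrite big_allpairs_dep mulr_suml; apply: eq_bigr => x _.
by rewrite mulr_sumr.
Qed.

Let hsumT a : hsum (fun=> True) a.
Proof.
have [s [f [_ hf ->]]] := grad_sum (ha_grading hR) a.
exists [seq f i | i <- s]; split; last by rewrite big_map.
by move=> _ /mapP[i _ ->]; split=> //; exists i.
Qed.

Let hsum_ker a : (a : R^o) \in m -> hsum (fun x => (x : R^o) \in m) a.
Proof.
move=> /(aug_ker hp)[n [f [hf ->]]]; exists [seq f i | i : 'I_n]; split.
  move=> _ /mapP[i _ ->]; split; last by exists i.+1.
  apply/(aug_ker hp); exists i.+1.
  exists (fun j : 'I_i.+1 => if j == ord_max then f i else 0); split.
    move=> j; case: eqP => [->|_] //=; exact: (grad0 (ha_grading hR)).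
  by rewrite (bigD1 ord_max) //= eqxx big1 ?addr0 // => j /negPf ->.
by rewrite big_map big_enum.
Qed.

Let hsum_ipow t a : (a : R^o) \in ipow R^o m t ->
  hsum (fun x => (x : R^o) \in ipow R^o m t) a.
Proof.
elim: t a => [|t IH] a.
  by move=> _; have [s [hs ->]] := hsumT a; exists s; split=> // z /hs [].
move: a; apply: mspan_ind => [|x y|r x hx|_ [x [y [xm yt ->]]]].
- by exists [::]; rewrite big_nil.
- exact: hsumD.
- by apply: (hsumM _ (hsumT r) hx) => u v _; exact: rpredZ.
- apply: (hsumM _ (hsum_ker xm) (IH _ yt)) => u v um vt.
  by apply/asboolP => N; apply; exists u, v.
Qed.

Lemma gamma_homog (M : gmod) : homog_sub (gamma m M).
Proof.
have hG := @gm_grading M.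
move=> z /asboolP[t ht]; have [s [f [us hf E]]] := grad_sum hG z.
exists [seq f i | i <- s]; split; last by rewrite big_map.
move=> _ /mapP[j js ->]; split; last by exists j.
apply/asboolP; exists t => a /hsum_ipow [u [hu ->]].
rewrite scaler_suml big_seq big1 // => b /hu [bt [d hd]].
have := @grad_direct _ _ _ hG [seq d%:Z + i | i <- s] (fun l => b *: f (l - d%:Z)).
rewrite map_inj_uniq; last by move=> ? ? /addrI.
move=> /(_ us); have h1 l : @gmG M l (b *: f (l - d%:Z)).
  by rewrite -[l in @gmG M l](subrKC d%:Z); apply: gm_mul.
move=> /(_ h1); rewrite big_map.
under eq_bigr do rewrite addrC addKr.
rewrite -scaler_sumr -E ht // => /(_ erefl (d%:Z + j)).
rewrite addrC addrK; apply; rewrite addrC; exact: map_f.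
Qed.

Record graded_genericity (U : gmod -> set R) : Prop := {
  ggen_iso : forall M M' : gmod, gisomorphic M M' -> U M = U M';
  ggen_nonempty : forall M, U M !=set0;
  ggen_sub : forall M, U M `<=` Rg 1%N;
  ggen_open : forall M, exists O : set R,
    [/\ zariski_open (V := R) (Rg 1%N) O, O !=set0 & O `<=` U M];
  ggen_reg : forall M : gmod, (0 < depth m M)%N ->
    forall f, U M f -> regular_on M f }.

Record graded_cohomological_degree (K : realType) (U : gmod -> set R)
    (Deg : gmod -> K) : Prop := {
  gcd_iso : forall M M' : gmod, gisomorphic M M' -> Deg M = Deg M';
  gcd_gamma : forall M : gmod,
    Deg M = Deg (gquo (@gamma_homog M)) + (mod_length (subm (gamma m M)))%:R;
  gcd_generic : forall M : gmod, (0 < depth m M)%N ->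
    forall x (hx : Rg 1%N x), U M x -> Deg (gquo (@xmul_homog M x hx)) <= Deg M;
  gcd_cm : forall M : gmod, cohen_macaulay m M ->
    Deg M = (multiplicity m M)%:R }.

End Gamma.
End Graded.

(* Main.v *)
(* For a submodule L = Gamma_m(M) and a generic x, nu(M) <= nu(L) + nu(M/L) and
   nu(M/xM) = nu(M), so nu <= Deg by noetherian induction on the quotients of M.
   In the case of equality mL = 0 and L meets mM trivially at every step, and
   the elements x met on the way form a sequence x_1, ..., x_d with
     mM = (x_1, ..., x_d)M  and
     ((x_1, ..., x_{i-1})M : x_i) meets mM in (x_1, ..., x_{i-1})M.
   These conditions pass to the initial forms on gr_m(M), and, for a basis of
   linear forms of k[X_1, ..., X_N] starting with them, from a graded module
   generated in degree 0 to its first syzygy module, which is then generated in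
   degree 1. Iterating gives the linear resolution. *)
Require Import Defs.
From HB Require Import structures.
From mathcomp Require Import all_boot all_order all_algebra.
From mathcomp Require Import boolp classical_sets cardinality reals.
From mathcomp Require Import mpoly.
Set Implicit Arguments.
Unset Strict Implicit.
Unset Printing Implicit Defensive.
Import Order.TTheory GRing.Theory Num.Theory.
Local Open Scope ring_scope.
Local Open Scope classical_set_scope.

(** * Noetherian modules and the basis theorem *)

(** The invariants [depth] and [mod_length] are maxima that fall back to 0 on unbounded sets. Before
    a generic element can be used on M/L, the regular sequences of M/L must therefore be shown to
    have bounded length; an exchange argument between two regular sequences does this without
    dimension theory. Submodules are plain sets, and quotients along a sequence are replaced by
    submodules of one fixed M.

    The forms act like a regular sequence in positive degrees only, on gr_m(M) as on each syzygy
    module shifted to degree 0; this is regularity 0 in the sense of Castelnuovo and Mumford.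
    Syzygies inherit the property because independent linear forms are a regular sequence on a free
    module, and an element of order 2 in the ideal they generate can be written with coefficients of
    order 1. Independence has to be arranged: the presentation of gr_m(R) is arbitrary, so the
    initial forms of the x_i may be dependent in T. Dependent ones are dropped, and the variables
    that complete them to a basis add no condition, since the x_i already account for all of mM. *)

Definition submod (R : comNzRingType) (M : lmodType R) (N : set M) : Prop :=
  [/\ N 0, forall x y, N x -> N y -> N (x + y) & forall a x, N x -> N (a *: x)].

Definition acc (R : comNzRingType) (M : lmodType R) : Prop :=
  forall N : nat -> set M, (forall n, submod (N n)) ->
    (forall n, N n `<=` N n.+1) ->
    exists n, forall m, (n <= m)%N -> N m `<=` N n.

Lemma nmax_geq (P : set nat) B n : (forall i, P i -> (i <= B)%N) -> P n ->
  (n <= nmax P)%N.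
Proof.
move=> hB Pn; rewrite /nmax.
have [d Pd maxd] := @ex_maxnP (fun n => `[< P n >]) B
  (ex_intro _ n (introT (asboolP _) Pn)) (fun n h => hB n (elimT (asboolP _) h)).
case: xgetP => [e -> [_ he]|h]; first exact: he.
by case: (h d); split=> [|i Pi]; [exact/asboolP | apply: maxd; exact/asboolP].
Qed.

Lemma chain_le (T : Type) (N : nat -> set T) :
  (forall n, N n `<=` N n.+1) -> forall n m, (n <= m)%N -> N n `<=` N m.
Proof.
move=> h n m /subnK <-; elim: (m - n)%N => [//|d IH] x /IH; exact: h.
Qed.

Lemma eventually_all n (P : 'I_n -> nat -> Prop) :
  (forall i, exists a, forall b, (a <= b)%N -> P i b) ->
  exists a, forall i b, (a <= b)%N -> P i b.
Proof.
move=> /choice[f hf]; exists (\max_i f i) => i b hb; apply: hf.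
exact: leq_trans (leq_bigmax i) hb.
Qed.

Section Submod.
Variables (R : comNzRingType) (M : lmodType R).
Implicit Types N : set M.

Lemma submodClosed_submod (N : submodClosed M) : submod [set x | x \in N].
Proof.
split=> /= [|x y|a x]; [exact: rpred0 | exact: rpredD | exact: rpredZ].
Qed.

Lemma submodB N : submod N -> forall x y, N x -> N y -> N (x - y).
Proof.
by move=> [_ hD hZ] x y Nx Ny; apply: hD => //; rewrite -scaleN1r; exact: hZ.
Qed.

Lemma submod_sum N (I : Type) (s : seq I) (P : pred I) (F : I -> M) :
  submod N -> (forall i, P i -> N (F i)) -> N (\sum_(i <- s | P i) F i).
Proof. by move=> [h0 hD _] h; elim/big_ind: _. Qed.

Lemma mem_mspan N : submod N -> forall x, (x \in mspan N) <-> N x.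
Proof.
move=> [h0 hD hZ] x; split; last by move=> Nx; apply/asboolP => K; apply.
by apply: mspan_ind.
Qed.

(** N + xM, the preimage in M of x(M/N); iterating it replaces iterated quotient modules. *)
Definition addx N (x : R) : set M := [set z | exists2 n, N n & exists w, z = n + x *: w].

Lemma addx_submod N x : submod N -> submod (addx N x).
Proof.
move=> [h0 hD hZ]; split.
- by exists 0 => //; exists 0; rewrite scaler0 addr0.
- move=> _ _ [n Nn [w ->]] [n' Nn' [w' ->]]; exists (n + n'); first exact: hD.
  by exists (w + w'); rewrite scalerDr addrACA.
- move=> a _ [n Nn [w ->]]; exists (a *: n); first exact: hZ.
  by exists (a *: w); rewrite scalerDr !scalerA mulrC.
Qed.

Lemma sub_addx N x : N `<=` addx N x.
Proof. by move=> z Nz; exists z => //; exists 0; rewrite scaler0 addr0. Qed.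

Lemma addxC N x y : addx (addx N x) y = addx (addx N y) x.
Proof.
suff h u v : addx (addx N u) v `<=` addx (addx N v) u by apply/seteqP; split.
move=> _ [_ [n Nn [w ->]] [w' ->]]; exists (n + v *: w'); last first.
  by exists w; rewrite addrAC.
by exists n => //; exists w'.
Qed.

Definition addr_gen N (z : M) : set M := [set x | exists2 n, N n & exists a, x = n + a *: z].

Lemma addr_gen_submod N z : submod N -> submod (addr_gen N z).
Proof.
move=> [h0 hD hZ]; split.
- by exists 0 => //; exists 0; rewrite scale0r addr0.
- move=> _ _ [n Nn [w ->]] [n' Nn' [w' ->]]; exists (n + n'); first exact: hD.
  by exists (w + w'); rewrite scalerDl addrACA.
- move=> a _ [n Nn [w ->]]; exists (a *: n); first exact: hZ.
  by exists (a * w); rewrite scalerDr scalerA.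
Qed.

Lemma sub_addr_gen N z : N `<=` addr_gen N z.
Proof. by move=> x Nx; exists x => //; exists 0; rewrite scale0r addr0. Qed.

Lemma addr_gen_mem N z : submod N -> addr_gen N z z.
Proof. by case=> h0 _ _; exists 0 => //; exists 1; rewrite scale1r add0r. Qed.

Lemma acc_max (F : set (set M)) : acc M -> (forall N, F N -> submod N) ->
  F !=set0 -> exists2 N, F N & forall N', F N' -> N `<=` N' -> N' `<=` N.
Proof.
move=> hM hF [N0 FN0]; apply: contrapT => hno.
have h (N : {N | F N}) : exists N' : {N | F N},
    sval N `<=` sval N' /\ ~ (sval N' `<=` sval N).
  apply: contrapT => h; apply: hno; exists (sval N); first exact: (svalP N).
  by move=> N' FN' NN'; apply: contrapT => NN; apply: h; exists (exist _ N' FN').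
have [g hg] := choice h; pose c n := iter n g (exist _ N0 FN0).
have [n hn] := hM (fun n => sval (c n)) (fun n => hF _ (svalP (c n)))
  (fun n => (hg (c n)).1).
exact: (hg (c n)).2 (hn n.+1 (leqnSn n)).
Qed.

Lemma acc_max_image (I : Type) (D : set I) (f : I -> set M) : acc M ->
  (forall i, submod (f i)) -> D !=set0 ->
  exists2 i, D i & forall j, D j -> f i `<=` f j -> f j `<=` f i.
Proof.
move=> hM sf [i0 D0].
have [|||_ [i Di <-] hmax] := @acc_max (f @` D) => //; first by move=> _ [i _ <-].
  by exists (f i0); exists i0.
by exists i => // j Dj; apply: hmax; exists j.
Qed.

Lemma acc_ind (P : set M -> Prop) : acc M ->
  (forall N, submod N -> (forall N', submod N' -> N `<=` N' -> ~ N' `<=` N -> P N') -> P N) ->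
  forall N, submod N -> P N.
Proof.
move=> hM hP N sN; apply: contrapT => nP.
have [K [sK nK] maxK] := @acc_max [set K | submod K /\ ~ P K] hM
  (fun _ => @proj1 _ _) (ex_intro _ N (conj sN nP)).
apply: nK; apply: (hP K sK) => K' sK' KK' nKK'; apply: contrapT => nPK'.
exact: nKK' (maxK _ (conj sK' nPK') KK').
Qed.

End Submod.

Lemma noetherian_acc (R : comNzRingType) : noetherian R -> acc (R^o : lmodType R).
Proof.
move=> hR N sN leN; have mono := chain_le leN.
pose U : set R^o := [set a | exists n, N n a].
have sU : submod U.
  split; first by exists 0%N; case: (sN 0%N).
  - move=> x y [n hx] [n' hy]; exists (maxn n n'); case: (sN (maxn n n')) => _ hD _.
    by apply: hD; [apply: mono hx; exact: leq_maxl | apply: mono hy; exact: leq_maxr].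
  - by move=> a x [n hx]; exists n; case: (sN n) => _ _; apply.
have [d [s hs]] := hR (mspan U).
have hsU i : exists n, forall b, (n <= b)%N -> N b (s i).
  have /(mem_mspan sU) [n hn] : (s i : R^o) \in mspan U.
    apply/hs; exists (fun j => (j == i)%:R).
    rewrite (bigD1 i) //= eqxx mul1r big1 ?addr0 // => j /negPf ->.
    by rewrite mul0r.
  by exists n => b hb; apply: mono hb _ hn.
have [n hn] := eventually_all hsU; exists n => m nm x Nx.
have /hs [a ->] : (x : R^o) \in mspan U by apply/(mem_mspan sU); exists m.
apply: (@submod_sum R R^o (N n) _ _ predT (fun i => a i * s i)) => // i _.
by case: (sN n) => _ _; apply; exact: hn.
Qed.

(* The coefficient of the last generator s i involved is an ideal invariant
   that detects strict inclusions. *)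
Lemma acc_fg (R : comNzRingType) (M : lmodType R) :
  acc (R^o : lmodType R) -> fg M -> acc M.
Proof.
move=> hR [d [s hs]] N sN leN; have mono := chain_le leN.
pose tl (i : nat) (x : M) := exists b : 'I_d -> R, x = \sum_(j < d | (j < i)%N) b j *: s j.
have tl_sub i : submod (tl i).
  split; first by exists (fun=> 0); rewrite big1 // => j _; rewrite scale0r.
  - move=> _ _ [b ->] [c ->]; exists (fun j => b j + c j).
    by rewrite -big_split; apply: eq_bigr => j _; rewrite scalerDl.
  - move=> a _ [b ->]; exists (fun j => a * b j).
    by rewrite scaler_sumr; apply: eq_bigr => j _; rewrite scalerA.
pose I (i : 'I_d) n : set R^o := [set a | exists2 x, tl i x & N n ((a : R) *: s i + x)].
have sI i n : submod (I i n).
  case: (tl_sub i) (sN n) => t0 tD tZ [n0 nD nZ]; split.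
  - by exists 0 => //; rewrite scale0r addr0.
  - move=> a b [x tx Nx] [y ty Ny]; exists (x + y); first exact: tD.
    by rewrite scalerDl addrACA; exact: nD.
  - move=> a b [x tx Nx]; exists (a *: x); first exact: tZ.
    by rewrite -[a *: b]/(a * b) -scalerA -scalerDr; exact: nZ.
have hI i : exists n, forall m, (n <= m)%N -> I i m `<=` I i n.
  apply: (hR (I i) (sI i)) => n a [x tx Nx]; exists x => //; exact: leN.
have hI' i : exists n, forall m, (n <= m)%N -> forall m', (m <= m')%N -> I i m' `<=` I i m.
  have [n hn] := hI i; exists n => m nm m' mm' a /(hn _ (leq_trans nm mm')).
  by case=> x tx Nx; exists x => //; exact: mono nm _ Nx.
have [n hn] := eventually_all hI'; exists n => m nm.
suff h i : (i <= d)%N -> forall x, tl i x -> N m x -> N n x.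
  move=> x; apply: (h d) => //; have [a ->] := hs x; exists a.
  by apply: eq_bigl => j; rewrite ltn_ord.
elim: i => [_ x [b ->] _|i IH id x [b ->] Nx].
  by rewrite big_pred0 //; case: (sN n).
pose j : 'I_d := Ordinal id.
have E : \sum_(l < d | (l < i.+1)%N) b l *: s l =
    b j *: s j + \sum_(l < d | (l < i)%N) b l *: s l.
  rewrite (bigD1 j) //=; congr (_ + _); apply: eq_bigl => l.
  by rewrite -val_eqE /= ltnS ltn_neqAle andbC.
have [y ty Ny] : I j n (b j).
  by apply: (hn j n (leqnn n) m nm); exists (\sum_(l < d | (l < i)%N) b l *: s l);
    [exists b | rewrite -E].
rewrite E -[X in N n X](subrK (b j *: s j + y)); case: (sN n) => _ nD _; apply: nD => //.
rewrite opprD addrACA subrr add0r; apply: IH; first exact: ltnW.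
  by apply: submodB => //; exists b.
have := submodB (sN m) Nx (mono _ _ nm _ Ny).
by rewrite E opprD addrACA subrr add0r.
Qed.

(* Hilbert's basis theorem: compare leading coefficient ideals degreewise. *)
Lemma poly_acc (A : comNzRingType) :
  acc (A^o : lmodType A) -> acc ({poly A}^o : lmodType {poly A}).
Proof.
move=> hA N sN leN; have mono := chain_le leN.
pose L d n : set A^o := [set a | exists2 q : {poly A}, N n q & (size q <= d.+1)%N /\ q`_d = a].
have sL d n : submod (L d n).
  case: (sN n) => n0 nD nZ; split.
  - by exists 0 => //; rewrite size_poly0 coef0.
  - move=> _ _ [q Nq [sq <-]] [r Nr [sr <-]]; exists (q + r); first exact: nD.
    by rewrite coefD; split=> //; rewrite (leq_trans (size_polyD _ _)) // geq_max sq.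
  - move=> a _ [q Nq [sq <-]]; exists (a%:P * q); first exact: nZ.
    by rewrite coefCM mul_polyC (leq_trans (size_scale_leq _ _)).
have Ln d n m : (n <= m)%N -> L d n `<=` L d m.
  by move=> nm a [q Nq hq]; exists q => //; apply: mono nm _ Nq.
have Ld d e n : (d <= e)%N -> L d n `<=` L e n.
  move=> /subnK <- _ [q Nq [sq <-]]; exists ('X^(e - d) * q).
    by case: (sN n) => _ _; apply.
  rewrite mulrC; split; last by rewrite coefMXn ltnNge leq_addr /= addKn.
  by rewrite (leq_trans (size_polyMleq _ _)) // size_polyXn addnS /= addnC -addnS leq_add2l.
(* L increases in both indices, so from degree d0 and stage n0 on all these ideals equal L d0 n0.
   Only the finitely many degrees below d0 remain to be stabilised. *)
have [[d0 n0] _ max0] := acc_max_image (f := fun x => L x.1 x.2) hA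
  (fun x => sL x.1 x.2) (ex_intro setT (0, 0)%N I).
have st d : exists n, forall m, (n <= m)%N -> L d m `<=` L d n.
  by apply: hA => [n|n]; [exact: sL | exact: Ln].
have st' (d : 'I_d0) : exists n, forall m, (n <= m)%N ->
    forall m', (m <= m')%N -> L d m' `<=` L d m.
  have [n hn] := st d; exists n => m nm m' mm' a /(hn _ (leq_trans nm mm')).
  exact: Ln.
have [n1 hn1] := eventually_all st'.
exists (maxn n0 n1) => m nm q Nq.
have key d : L d m `<=` L d (maxn n0 n1).
  have [dd|dd] := ltnP d d0.
    by apply: (hn1 (Ordinal dd)) => //; exact: leq_maxr.
  have h1 : L d m `<=` L d0 n0.
    apply: (max0 (d, m)) => //=.
    apply: (subset_trans (Ld _ _ n0 dd)); apply: Ln.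
    exact: leq_trans (leq_maxl _ _) nm.
  apply: (subset_trans h1); apply: (subset_trans (Ld _ _ n0 dd)).
  by apply: Ln; exact: leq_maxl.
(* Subtracting an element of the stable stage with the same coefficient in degree d lowers the size
   bound. *)
move: {2}(size q) (leqnn (size q)) => d; elim: d q Nq => [|d IH] q Nq sq.
  by move: sq; rewrite leqn0 size_poly_eq0 => /eqP ->; case: (sN (maxn n0 n1)).
have [r Nr [sr rd]] : L d (maxn n0 n1) q`_d by apply: key; exists q.
rewrite -(subrK r q); case: (sN (maxn n0 n1)) => _ nD _; apply: nD => //.
apply: IH; first by apply: (submodB (sN m)) => //; apply: mono nm _ Nr.
apply/leq_sizeP => j dj; rewrite coefB.
case: (ltngtP d j) dj => // [dj|<-] _; last by rewrite rd subrr.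
by rewrite !nth_default ?subrr // (leq_trans _ dj).
Qed.

Lemma acc_surj (A B : comNzRingType) (f : {rmorphism A -> B}) :
  (forall b, exists a, f a = b) ->
  acc (A^o : lmodType A) -> acc (B^o : lmodType B).
Proof.
move=> fs hA N sN leN.
have [|n x|n hn] := hA (fun n => [set a : A^o | N n (f a)]).
- move=> n; case: (sN n) => n0 nD nZ; split=> /=; first by rewrite rmorph0.
    by move=> x y hx hy; rewrite rmorphD; exact: nD.
  by move=> a x hx; rewrite rmorphM; exact: nZ.
- exact: leN.
- by exists n => m nm b; have [a <-] := fs b; exact: hn.
Qed.

Lemma field_acc (k : fieldType) : acc (k^o : lmodType k).
Proof.
apply: noetherian_acc => I; have [[a aI a0]|h] := pselect (exists2 a, a \in I & a != 0).
  exists 1%N, (fun=> 1) => x; split=> [_|_].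
    by exists (fun=> x); rewrite big_ord1 mulr1.
  by rewrite -[x](divfK a0); exact: rpredZ.
exists 0%N, (fun=> 0) => x; split=> [xI|[a]]; last by rewrite big_ord0 => ->; exact: rpred0.
exists (fun=> 0); rewrite big_ord0; apply/eqP; apply: contrapT => /negP x0.
by apply: h; exists x.
Qed.

(** A is an iterated polynomial ring over k, so [poly_acc] is applied one variable at a time; the
    image of f is a subring containing the scalars and all e i. *)
Lemma fgalg_acc (k : fieldType) (R : comAlgType k) n (e : 'I_n -> R) :
  exists (A : comNzRingType) (f : {rmorphism A -> R}),
    [/\ acc (A^o : lmodType A), forall c : k, exists a, f a = c%:A
      & forall i, exists a, f a = e i].
Proof.
elim: n e => [|n IH] e.
  exists k, (GRing.in_alg R); split=> [|c|[]//]; first exact: field_acc.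
  by exists c.
have [A [f [hA fk fe]]] := IH (fun i => e (lift ord0 i)).
have cf : commr_rmorph f (e ord0) by move=> x; exact: mulrC.
exists {poly A}, (horner_morph cf); split.
- exact: poly_acc.
- by move=> c; have [a <-] := fk c; exists a%:P; rewrite /= horner_morphC.
- move=> i; case: (unliftP ord0 i) => [j ->|->].
    by have [a <-] := fe j; exists a%:P; rewrite /= horner_morphC.
  by exists 'X; rewrite /= horner_morphX.
Qed.

(** A homogeneous algebra is generated by a finite basis of its degree 1 part, so the basis theorem
    applies: the image of f is a subalgebra containing R_1. *)
Lemma homogeneous_acc (k : fieldType) (R : comAlgType k) (Rg : nat -> set R) :
  homogeneous_algebra Rg -> acc (R^o : lmodType R).
Proof.
move=> hR; have [n [e [_ he]]] := ha_deg1 hR.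
have [A [f [hA fk fe]]] := fgalg_acc e.
apply: (acc_surj (f := f)) => //.
pose Q (b : R) : bool := `[< exists a, f a = b >].
have Qc : GRing.subsemialg_closed Q.
  split; first by apply/asboolP; exists 1; rewrite rmorph1.
  - split; first by apply/asboolP; exists 0; rewrite rmorph0.
    move=> _ _ /asboolP[a <-] /asboolP[b <-]; apply/asboolP; exists (a + b).
    by rewrite rmorphD.
  - move=> c _ /asboolP[a <-]; apply/asboolP; have [b hb] := fk c.
    by exists (b * a); rewrite rmorphM /= hb -scalerAl mul1r.
  move=> _ _ /asboolP[a <-] /asboolP[b <-]; apply/asboolP; exists (a * b).
  by rewrite rmorphM.
pose B := GRing.isSubalgClosed.Build k R Q Qc.
pose S : subalgClosed R := HB.pack Q B.
move=> b; suff /asboolP : b \in S by [].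
apply: (ha_gen hR) => a /he [c [-> _]]; apply: rpred_sum => i _; apply: rpredZ.
by have [x hx] := fe i; apply/asboolP; exists x.
Qed.

(** * Regular sequences and positive depth *)

Definition primeset (R : comNzRingType) (P : set R) : Prop :=
  submod (P : set R^o) /\ forall a b, P (a * b) -> P a \/ P b.

Lemma prime_avoidance (R : comNzRingType) (m : submodClosed R^o) (l : seq (set R)) :
  (forall P, P \in l -> primeset P /\ exists2 a, (a : R^o) \in m & ~ P a) ->
  exists2 x, (x : R^o) \in m & forall P, P \in l -> ~ P x.
Proof.
elim: l => [|P l IH] h; first by exists 0 => //; exact: rpred0.
have hP := h P (mem_head _ _); have hl Q : Q \in l -> primeset Q.
  by move=> Ql; case: (h Q (mem_behead (s := P :: l) Ql)).
have [|x xm hx] := IH; first by move=> Q Ql; apply: h; rewrite inE Ql orbT.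
have [Px|nPx] := pselect (P x); last first.
  by exists x => // Q; rewrite inE => /orP[/eqP ->|/hx].
(* As x is in P and y is not, x + y leaves P. It also avoids each other Q: if Q is contained in P
   this is clear, and otherwise y lies in Q while x does not. *)
have [y [ym nPy hy]] : exists y, [/\ (y : R^o) \in m, ~ P y &
    forall Q, Q \in l -> ~ (Q `<=` P) -> Q y].
  case: hP => [[[_ _ _] pP] [a am nPa]].
  elim: l {IH h hx} hl => [|Q l IH] hl; first by exists a; split.
  have [|y [ym nPy hy]] := IH; first by move=> Q' Ql; apply: hl; rewrite inE Ql orbT.
  have [QP|/existsNP[b /not_implyP[Qb nPb]]] := pselect (Q `<=` P).
    by exists y; split=> // Q'; rewrite inE => /orP[/eqP ->|/hy //] /(_ QP).
  exists (b * y); split; first exact: (rpredZ (V := R^o)).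
    by case/pP.
  move=> Q'; rewrite inE => /orP[/eqP ->|Ql] nQ.
    by case: (hl Q (mem_head _ _)) => [[_ _ QZ] _]; rewrite mulrC; exact: QZ.
  case: (hl Q' (mem_behead (s := Q :: l) Ql)) => [[_ _ QZ] _].
  by apply: (QZ b y); exact: hy.
have sP := hP.1.1; exists (x + y); first exact: rpredD.
move=> Q; rewrite inE => /orP[/eqP ->|Ql] Qxy.
  by apply: nPy; have := submodB sP Qxy Px; rewrite addrC addKr.
have [QP|nQP] := pselect (Q `<=` P).
  by apply: nPy; have := submodB sP (QP _ Qxy) Px; rewrite addrC addKr.
apply: (hx _ Ql); have := submodB (hl _ Ql).1 Qxy (hy _ Ql nQP).
by rewrite addrK.
Qed.

Section Regular.
Variables (R : comNzRingType) (m : submodClosed R^o) (M : lmodType R).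
Hypothesis accR : acc (R^o : lmodType R).
Hypothesis accM : acc M.
Implicit Types K L : set M.

(** Here and below, properties of the quotient M/K are stated in M, modulo K. *)
Definition reg_mod K (x : R) : Prop := forall z, K (x *: z) -> K z.

(** Says that Hom(R/m, M/K) is nonzero. *)
Definition soc_mod K : Prop :=
  exists2 z, ~ K z & forall a : R, (a : R^o) \in m -> K (a *: z).

Definition ann_mod K (z : M) : set R := [set a | K (a *: z)].

Definition max_ann K z : Prop :=
  ~ K z /\ forall z', ~ K z' -> ann_mod K z `<=` ann_mod K z' ->
                      ann_mod K z' `<=` ann_mod K z.

Lemma ann_submod K z : submod K -> submod (ann_mod K z : set R^o).
Proof.
move=> [h0 hD hZ]; split; rewrite /ann_mod /=.
- by rewrite scale0r.
- by move=> a b; rewrite scalerDl; exact: hD.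
- by move=> a b; rewrite -scalerA; exact: hZ.
Qed.

(** If ab kills z modulo K and bz is nonzero there, the annihilator of bz contains that of z, hence
    equals it, and a belongs to it. These are associated primes of M/K. *)
Lemma max_ann_prime K z : submod K -> max_ann K z -> primeset (ann_mod K z).
Proof.
move=> sK [_ hz]; split; first exact: ann_submod.
move=> a b; rewrite /ann_mod /= => Kab.
have [|nb] := pselect (K (b *: z)); [by right | left].
apply: (hz _ nb); last by rewrite /ann_mod /= scalerA.
by move=> c /= Kc; rewrite /ann_mod /= scalerA mulrC -scalerA; case: sK => _ _; apply.
Qed.

Lemma max_ann_above K z : submod K -> ~ K z ->
  exists2 z', max_ann K z' & ann_mod K z `<=` ann_mod K z'.
Proof.
move=> sK nz.
have [z' [nz' zz'] hmax] := @acc_max_image R R^o M _ (ann_mod K) accR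
  (fun z => ann_submod z sK)
  (ex_intro [set z' | ~ K z' /\ ann_mod K z `<=` ann_mod K z'] z (conj nz (fun=> id))).
exists z' => //; split=> // z'' nz'' le; apply: hmax => //.
by split=> //; apply: subset_trans le.
Qed.

(* The elements with maximal annihilator span a finitely generated submodule;
   the annihilator of any of them contains, hence equals, that of one of
   finitely many generators. *)
Lemma max_ann_finite K : submod K -> exists s : seq M,
  (forall z, z \in s -> max_ann K z) /\
  forall z, max_ann K z -> exists2 z', z' \in s & ann_mod K z = ann_mod K z'.
Proof.
move=> sK; pose sp (s : seq M) := foldr (fun z N => addr_gen N z) K s.
have ssp s : submod (sp s) by elim: s => [//|z s IH]; exact: addr_gen_submod.
have [|s hs hmax] := acc_max_image (D := [set s : seq M | forall z, z \in s -> max_ann K z]) accM ssp.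
  by exists [::].
exists s; split=> // z hz.
have spz : sp s z.
  apply: (hmax (z :: s)); [|exact: sub_addr_gen|exact: addr_gen_mem].
  by move=> z' /=; rewrite inE => /orP[/eqP ->|/hs].
apply: contrapT => hno; have [_ pz] := max_ann_prime sK hz.
(* b is a product of elements killing the generators in s one by one, each outside the annihilator
   of z. That annihilator is prime, so b does not kill z modulo K; but b kills all of [sp s], which
   contains z. *)
have [b nb hb] : exists2 b, ~ K (b *: z) & forall z', z' \in s -> K (b *: z').
  have {spz hmax} : forall z', z' \in s -> ~ (ann_mod K z' `<=` ann_mod K z).
    move=> z' z's le; apply: hno; exists z' => //; apply/seteqP; split=> //.
    by apply: (hs z' z's).2 => //; case: hz.
  elim: s {hs hno} => [|z' s IH] h.
    by exists 1 => //; rewrite scale1r; case: hz.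
  have [|b nb hb] := IH; first by move=> w ws; apply: h; rewrite inE ws orbT.
  have /existsNP[c /not_implyP[c1 c2]] := h _ (mem_head _ _).
  exists (b * c); first by case/pz.
  move=> w; rewrite inE => /orP[/eqP ->|ws].
    by rewrite -scalerA; case: sK => _ _; apply.
  by rewrite mulrC -scalerA; case: sK => _ _; apply; exact: hb.
apply: nb; clear hs hno hmax hz pz; elim: s hb z spz => [|w s IH] hb z.
  by move=> Kz; case: sK => _ _; apply.
move=> [n hn [a ->]]; rewrite scalerDr scalerA mulrC -scalerA; case: sK => _ sD sZ.
apply: sD; last by apply: sZ; apply: hb; exact: mem_head.
by apply: IH hn => v vs; apply: hb; rewrite inE vs orbT.
Qed.

(** Without socle, m lies in none of the finitely many maximal annihilators of each M/K. Prime
    avoidance yields an element of m outside all of them, and every zero divisor lies in one. *)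
Lemma common_regular (Ks : seq (set M)) :
  (forall K, K \in Ks -> submod K /\ ~ soc_mod K) ->
  exists2 u, (u : R^o) \in m & forall K, K \in Ks -> reg_mod K u.
Proof.
move=> hK; suff [l [hl lreg]] : exists l : seq (set R),
    (forall P, P \in l -> primeset P /\ exists2 a, (a : R^o) \in m & ~ P a) /\
    forall x, (forall P, P \in l -> ~ P x) -> forall K, K \in Ks -> reg_mod K x.
  by have [u um hu] := prime_avoidance hl; exists u => //; exact: lreg.
elim: Ks hK => [|K Ks IH] hK; first by exists [::].
have [|l [hl lreg]] := IH; first by move=> L LK; apply: hK; rewrite inE LK orbT.
have [sK nsoc] := hK _ (mem_head _ _); have [s [hs hs']] := max_ann_finite sK.
exists (map (ann_mod K) s ++ l); split.
  move=> P; rewrite mem_cat => /orP[/mapP[z /hs hz ->]|/hl //].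
  split; first exact: max_ann_prime.
  apply: contrapT => h; apply: nsoc; exists z; first by case: hz.
  by move=> a am; apply: contrapT => na; apply: h; exists a.
move=> x hx L; rewrite inE => /orP[/eqP ->|]; last first.
  by apply: lreg => P Pl; apply: hx; rewrite mem_cat Pl orbT.
move=> z Kxz; apply: contrapT => nz.
have [z' /hs' [z'' zs E] /(_ x Kxz)] := max_ann_above sK nz.
rewrite E; apply: hx; rewrite mem_cat; apply/orP; left; exact: map_f.
Qed.

Lemma reg_no_soc K x : (x : R^o) \in m -> reg_mod K x -> ~ soc_mod K.
Proof. by move=> xm rx [z nz hz]; apply: nz; apply: rx; exact: hz. Qed.

(** Weakly regular sequences on M/K: the last quotient is allowed to vanish. *)
Fixpoint wreg K (xs : seq R) : Prop :=
  if xs is x :: s then reg_mod K x /\ wreg (addx K x) s else True.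

Definition addxs K (xs : seq R) : set M := foldl (@addx R M) K xs.

Fixpoint partials K (xs : seq R) : seq (set M) :=
  K :: if xs is x :: s then partials (addx K x) s else [::].

Lemma wreg_cat K s1 s2 : wreg K (s1 ++ s2) <-> wreg K s1 /\ wreg (addxs K s1) s2.
Proof.
elim: s1 K => [|x s IH] K /=; first by split=> [|[]].
by rewrite IH; split=> [[? [? ?]]|[[? ?] ?]].
Qed.

Lemma addxs_submod K xs : submod K -> submod (addxs K xs).
Proof. by elim: xs K => [//|x s IH] K sK; apply: IH; exact: addx_submod. Qed.

Lemma addxsC K xs u : addxs (addx K u) xs = addx (addxs K xs) u.
Proof. by elim: xs K => [//|x s IH] K /=; rewrite addxC IH. Qed.

Lemma partials_submod K xs L : submod K -> L \in partials K xs -> submod L.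
Proof.
elim: xs K => [|x s IH] K sK /=; rewrite in_cons => /orP[/eqP -> //|//].
by apply: IH; exact: addx_submod.
Qed.

Lemma partials_no_soc K xs x : wreg K (rcons xs x) ->
  (forall a : R, a \in rcons xs x -> (a : R^o) \in m) ->
  forall L, L \in partials K xs -> ~ soc_mod L.
Proof.
elim: xs K => [|y s IH] K /= [ry ws] hm L; rewrite in_cons => /orP[/eqP ->|//].
- by apply: reg_no_soc ry; apply: hm; exact: mem_head.
- by apply: reg_no_soc ry; apply: hm; exact: mem_head.
- by apply: IH => // a a_s; apply: hm; rewrite inE a_s orbT.
Qed.

Lemma last_partial K xs : addxs K xs \in partials K xs.
Proof. by elim: xs K => [|x s IH] K /=; rewrite in_cons ?eqxx // IH orbT. Qed.

(** One step exchanges u and x: if xz = k + uw, regularity of u modulo K + xM gives w = k' + xw',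
    and then x(z - uw') lies in K, so z - uw' does. *)
Lemma wreg_swap K xs u : submod K -> wreg K xs ->
  (forall L, L \in partials K xs -> reg_mod L u) -> wreg (addx K u) xs.
Proof.
elim: xs K => [//|x s IH] K sK [rx ws] hu /=; split; last first.
  rewrite addxC; apply: IH => //; first exact: addx_submod.
  by move=> L Ls; apply: hu; rewrite inE Ls orbT.
have Kx : addx K x \in partials K (x :: s).
  by rewrite /= inE; apply/orP; right; case: (s) => [|? ?]; exact: mem_head.
move=> z [k Kk [w E]].
have [k' Kk' [w' Ew]] : addx K x w.
  apply: (hu _ Kx); exists (- k).
    by have := submodB sK (let: And3 h _ _ := sK in h) Kk; rewrite sub0r.
  by exists z; rewrite E addrA addNr add0r.
exists (z - u *: w'); last by exists w'; rewrite subrK.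
apply: rx; rewrite scalerBr E Ew scalerDr !scalerA addrA [x * u]mulrC addrK.
by case: sK => _ sD sZ; apply: sD => //; exact: sZ.
Qed.

(** Writing yz = l + xw sends the class of z modulo L + xM to the class of w modulo L + yM.
    Classically both socles are Hom(R/m, -) of a quotient by a regular element of m, hence
    isomorphic to Ext^1(R/m, M/L). *)
Lemma soc_exchange1 L x y : submod L -> (y : R^o) \in m ->
  reg_mod L x -> reg_mod L y -> soc_mod (addx L x) -> soc_mod (addx L y).
Proof.
move=> sL ym rx ry [z nz hz]; have [l Ll [w E]] := hz _ ym.
have [s0 sD sZ] := sL; exists w.
  move=> [l' Ll' [w' Ew]]; apply: nz; exists (z - x *: w'); last first.
    by exists w'; rewrite subrK.
  apply: ry; rewrite scalerBr E Ew scalerDr !scalerA addrA [y * x]mulrC addrK.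
  by apply: sD => //; exact: sZ.
move=> a /hz [l1 Ll1 [t Et]]; exists (a *: w - y *: t); last first.
  by exists t; rewrite subrK.
apply: rx; have -> : x *: (a *: w - y *: t) = y *: l1 - a *: l.
  have Ew : x *: w = y *: z - l by rewrite E addrC addKr.
  have Ext : x *: t = a *: z - l1 by rewrite Et addrC addKr.
  rewrite scalerBr [x *: (a *: w)]scalerA mulrC -scalerA Ew.
  rewrite [x *: (y *: t)]scalerA mulrC -scalerA Ext !scalerBr !scalerA [y * a]mulrC.
  by rewrite opprB addrC addrA subrK.
by apply: submodB => //; exact: sZ.
Qed.

(* Classically both sides express the vanishing of the same Ext module. *)
Lemma soc_exchange K xs ys : submod K -> size xs = size ys ->
  (forall a : R, a \in xs ++ ys -> (a : R^o) \in m) ->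
  wreg K xs -> wreg K ys -> soc_mod (addxs K xs) -> soc_mod (addxs K ys).
Proof.
move: {2}(size xs) (erefl (size xs)) => n.
elim: n K xs ys => [|n IH] K xs ys Ex sK Exy hm wx wy.
  by move: Exy; rewrite (size0nil Ex) => /esym /size0nil ->.
case/lastP: xs Ex Exy hm wx => [//|xs x]; rewrite size_rcons => -[Ex].
case/lastP: ys wy => [|ys y] wy; rewrite ?size_rcons // => -[Exy] hm wx.
have hx a : a \in rcons xs x -> (a : R^o) \in m by move=> h; apply: hm; rewrite mem_cat h.
have hy a : a \in rcons ys y -> (a : R^o) \in m by move=> h; apply: hm; rewrite mem_cat h orbT.
(* A single u is regular on all partial quotients of both sequences. It replaces the last element of
   each and is moved to the front, after which induction applies to the shorter sequences over K +
   uM. *)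
have [|u um hu] := common_regular (Ks := partials K xs ++ partials K ys).
  move=> L; rewrite mem_cat => /orP[] hL.
    by split; [exact: partials_submod hL | exact: partials_no_soc wx hx _ hL].
  by split; [exact: partials_submod hL | exact: partials_no_soc wy hy _ hL].
have hux L : L \in partials K xs -> reg_mod L u by move=> h; apply: hu; rewrite mem_cat h.
have huy L : L \in partials K ys -> reg_mod L u by move=> h; apply: hu; rewrite mem_cat h orbT.
move: wx wy; rewrite -!cats1 !wreg_cat /= => -[wx [rx _]] [wy [ry _]].
rewrite /addxs !foldl_cat /= -/(addxs K xs) -/(addxs K ys) => h.
have {}h : soc_mod (addx (addxs K xs) u).
  by apply: soc_exchange1 h => //; [exact: addxs_submod | apply: hux; exact: last_partial].
rewrite -addxsC in h.
have {}h : soc_mod (addxs (addx K u) ys).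
  apply: IH h => //; first exact: addx_submod.
  - by move=> a; rewrite mem_cat => /orP[] h; [apply: hx | apply: hy]; rewrite mem_rcons inE h orbT.
  - exact: wreg_swap.
  - exact: wreg_swap.
rewrite addxsC in h; apply: soc_exchange1 h => //; first exact: addxs_submod.
  by apply: hy; rewrite mem_rcons mem_head.
by apply: huy; exact: last_partial.
Qed.

Lemma mem_imul (a : R) z : (a : R^o) \in m -> a *: z \in imul m (full M).
Proof. by move=> am; apply/asboolP => N; apply; exists a, z. Qed.

(** Without socle a u in m is regular modulo K. Then K + uM is strictly larger: otherwise uz would
    lie in K, hence z would, although z is outside mM. Noetherian induction ends the process. *)
Lemma maximal_wreg K : submod K -> K `<=` [set z | z \in imul m (full M)] ->
  (exists z, z \notin imul m (full M)) ->
  exists xs, [/\ forall a : R, a \in xs -> (a : R^o) \in m, wreg K xs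
               & soc_mod (addxs K xs)].
Proof.
move=> sK hK [z hz]; move: K sK hK.
apply: (acc_ind (P := fun K => K `<=` [set z | z \in imul m (full M)] ->
  exists xs, [/\ forall a : R, a \in xs -> (a : R^o) \in m, wreg K xs
               & soc_mod (addxs K xs)]) accM) => K sK IH hK.
have [hs|ns] := pselect (soc_mod K); first by exists [::].
have [|u um hu] := common_regular (Ks := [:: K]).
  by move=> L; rewrite inE => /eqP ->.
have rK := hu K (mem_head _ _).
have [|||xs [hxs wxs sxs]] := IH _ (addx_submod u sK).
- exact: sub_addx.
- move=> le; have : K z.
    apply: rK; apply: le; exists 0; first by case: sK.
    by exists z; rewrite add0r.
  by move=> /hK /= h; rewrite h in hz.
- move=> _ [k /hK kP [w ->]] /=; apply: rpredD => //; exact: mem_imul.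
by exists (u :: xs); split=> // a; rewrite inE => /orP[/eqP ->|/hxs].
Qed.

(** If ys were longer, its initial segment of the length of xs would leave a socle by exchange, but
    the next element of ys is regular on that quotient. *)
Lemma wreg_bound K xs ys : submod K ->
  (forall a : R, a \in xs ++ ys -> (a : R^o) \in m) -> wreg K xs -> wreg K ys ->
  soc_mod (addxs K xs) -> (size ys <= size xs)%N.
Proof.
move=> sK hm wx wy h; rewrite leqNgt; apply/negP => lt.
move: wy; rewrite -(cat_take_drop (size xs) ys) wreg_cat => -[wt].
case E: (drop (size xs) ys) => [|y s].
  by move/(congr1 size): E; rewrite size_drop /= => /eqP; rewrite subn_eq0 leqNgt lt.
move=> [ry _]; apply: (reg_no_soc _ ry).
  apply: hm; rewrite mem_cat -(cat_take_drop (size xs) ys) E !mem_cat mem_head.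
  by rewrite !orbT.
apply: soc_exchange h => //; first by rewrite size_takel // ltnW.
by move=> a; rewrite mem_cat => /orP[] h; apply: hm; rewrite mem_cat ?h // (mem_take h) orbT.
Qed.

(** Pulls a regular sequence, which is defined by iterated quotients, back to submodules of M: the
    kernel of M -> M'/xM' is ker f + xM. *)
Lemma regseq_wreg (M' : lmodType R) (f : {linear M -> M'}) s :
  (forall w, exists z, f z = w) -> regseq s M' -> wreg [set z | f z = 0] s.
Proof.
elim: s M' f => [//|x s IH] M' f fs [rx hs] /=; split.
  by move=> z /=; rewrite linearZ; exact: rx.
pose g : {linear M -> quo (xmul M' x)} := (cls (xmul M' x) : {linear M' -> quo (xmul M' x)}) \o f.
have -> : addx [set z | f z = 0] x = [set z | g z = 0].
  apply/seteqP; split=> z.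
    move=> [k /= fk [w ->]]; rewrite /= -[RHS](raddf0 (cls (xmul M' x))).
    apply/cls_eq; rewrite subr0 linearD fk add0r linearZ.
    by apply/asboolP; exists (f w).
  rewrite /= -(raddf0 (cls (xmul M' x))) => /cls_eq; rewrite subr0.
  move=> /asboolP[w]; have [v <-] := fs w => E; exists (z - x *: v).
    by rewrite /= linearB linearZ E subrr.
  by exists v; rewrite subrK.
apply: IH hs => q; have [w ->] := cls_surj q; have [z <-] := fs w; by exists z.
Qed.

(** A regular element alone would not do, as [depth] is 0 for unbounded lengths; a weakly regular
    sequence ending in a socle bounds all others. *)
Lemma depth_gt0 : ~ soc_mod [set 0] -> (exists z, z \notin imul m (full M)) ->
  (0 < depth m M)%N.
Proof.
move=> ns [z0 hz0]; pose K0 : set M := [set 0].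
have sK0 : submod K0.
  by split=> [//|x y -> ->|a x ->]; rewrite /K0 /= ?addr0 ?scaler0.
have [xs [hxs wxs sxs]] : exists xs, [/\ forall a : R, a \in xs -> (a : R^o) \in m,
    wreg K0 xs & soc_mod (addxs K0 xs)].
  by apply: maximal_wreg; [|move=> _ -> /=; exact: rpred0|exists z0].
rewrite /depth; set P := (X in nmax X).
have bP n : P n -> (n <= size xs)%N.
  case=> s [<- hs rs]; apply: (@wreg_bound K0) => //.
    by move=> a; rewrite mem_cat => /orP[/hxs|/hs].
  exact: (@regseq_wreg M idfun s (fun w => ex_intro _ w erefl) rs).
have P1 : P 1%N.
  have [|u um hu] := common_regular (Ks := [:: K0]).
    by move=> L; rewrite inE => /eqP ->.
  exists [:: u]; split=> //; first by move=> x; rewrite inE => /eqP ->.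
  split; first by move=> z uz; exact: (hu K0 (mem_head _ _)).
  exists (cls (xmul M u) z0); rewrite -(raddf0 (cls (xmul M u))) => /cls_eq.
  rewrite subr0 => /asboolP[w E]; move: hz0; rewrite E mem_imul //.
exact: nmax_geq bP P1.
Qed.

End Regular.

(** * Numbers of generators and lengths *)

Section LinearAlgebra.
Variables (k : fieldType) (V : lmodType k).
Implicit Types S : set V.

Definition kfree n (e : 'I_n -> V) : Prop :=
  forall c : 'I_n -> k, \sum_i c i *: e i = 0 -> forall i, c i = 0.

Definition in_kspan n (e : 'I_n -> V) (v : V) : Prop :=
  exists c : 'I_n -> k, v = \sum_i c i *: e i.

Lemma kbasisP S n (e : 'I_n -> V) :
  (forall c : 'I_n -> k, S (\sum_i c i *: e i)) ->
  kbasis S e <-> [/\ forall i, S (e i), kfree e & forall v, S v -> in_kspan e v].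
Proof.
move=> hS; split=> [[he hb]|[he hf hs]].
  split=> // [c Ec i|v /hb [c [E _]]]; last by exists c.
  have [c0 [E0 U]] := hb _ (hS c).
  have := U (fun=> 0); rewrite (U c erefl) => ->; rewrite ?Ec //.
  by rewrite big1 // => j _; rewrite scale0r.
split=> // v /hs [c E]; exists c; split=> // c' E'; apply/funext => i.
apply/eqP; rewrite -subr_eq0; apply/eqP; apply: (hf (fun i => c i - c' i)).
by under eq_bigr do rewrite scalerBl; rewrite sumrB -E -E' subrr.
Qed.

Lemma kbasisTP n (e : 'I_n -> V) :
  kbasis setT e <-> kfree e /\ forall v, in_kspan e v.
Proof.
rewrite kbasisP //; split=> [[_ h1 h2]|[h1 h2]]; first by split=> // v; exact: h2.
by split.
Qed.

(** With too many vectors u, the matrix of their coordinates has a nonzero vector in its left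
    kernel, which is a linear relation. *)
Lemma kfree_leq a b (v : 'I_a -> V) (u : 'I_b -> V) :
  (forall j, in_kspan v (u j)) -> kfree u -> (b <= a)%N.
Proof.
move=> /choice[f hf] fu; pose A := \matrix_(j < b, i < a) f j i.
rewrite leqNgt; apply/negP => ab.
have : kermx A != 0 by rewrite kermx_eq0 /row_free ltn_eqF // (leq_ltn_trans (rank_leq_col _)).
case/rowV0Pn => c /sub_kermxP cA /eqP; apply; apply/rowP => j; rewrite mxE.
move: j; apply: (fu (fun j => c 0 j)); under eq_bigr do rewrite hf scaler_sumr.
rewrite exchange_big big1 //= => i _; under eq_bigr do rewrite scalerA.
rewrite -scaler_suml; have /rowP/(_ i) := cA; rewrite !mxE.
under eq_bigr do rewrite mxE; by move=> ->; rewrite scale0r.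
Qed.

Lemma kdimE n (e : 'I_n -> V) : kbasis setT e -> kdim V = n.
Proof.
move=> he; rewrite /kdim; case: xgetP => [d -> [e' he']|/(_ n) []]; last by exists e.
move/kbasisTP: he => [f s]; move/kbasisTP: he' => [f' s'].
by apply/eqP; rewrite eqn_leq (kfree_leq (fun j => s (e' j)) f') (kfree_leq (fun j => s' (e j)) f).
Qed.

(** The coordinate matrices satisfy AB = 1; being square, they also satisfy BA = 1, so a relation c
    with cB = 0 vanishes. *)
Lemma kspan_kfree n (v u : 'I_n -> V) :
  kfree u -> (forall w, in_kspan v w) -> (forall w, in_kspan u w) -> kfree v.
Proof.
move=> fu sv su; have /choice[f hf] : forall j, in_kspan v (u j) by move=> j; exact: sv.
have /choice[g hg] : forall j, in_kspan u (v j) by move=> j; exact: su.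
pose A := \matrix_(j < n, i < n) f j i; pose B := \matrix_(j < n, i < n) g j i.
have AB : A *m B = 1%:M.
  apply/matrixP => i j; apply/eqP; rewrite -subr_eq0; apply/eqP.
  apply: (fu (fun j => (A *m B) i j - (1%:M : 'M_n) i j)).
  under eq_bigr do rewrite scalerBl; rewrite sumrB; apply/eqP; rewrite subr_eq0.
  rewrite [X in _ == X](bigD1 i) //= [X in _ == _ + X]big1 ?addr0 => [|l /negPf li].
    rewrite mxE eqxx scale1r [X in _ == X]hf; apply/eqP.
    under eq_bigr do rewrite mxE scaler_suml.
    rewrite exchange_big; apply: eq_bigr => l _; rewrite hg scaler_sumr.
    by apply: eq_bigr => i' _; rewrite scalerA !mxE.
  by rewrite mxE eq_sym li scale0r.
move=> c Ec; pose C := \row_i c i.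
suff C0 : C = 0 by move=> i; have /rowP/(_ i) := C0; rewrite !mxE.
rewrite -[C]mulmx1 -(mulmx1C AB) mulmxA; suff -> : C *m B = 0 by rewrite mul0mx.
apply/rowP => j; rewrite [RHS]mxE; move: j; apply: fu.
rewrite -[RHS]Ec; under eq_bigr do rewrite mxE scaler_suml.
rewrite exchange_big; apply: eq_bigr => l _; rewrite hg scaler_sumr.
by apply: eq_bigr => i' _; rewrite scalerA !mxE.
Qed.

Lemma exists_kbasis S B : S 0 -> (forall u v, S u -> S v -> S (u + v)) ->
  (forall a v, S v -> S (a *: v)) ->
  (forall n (e : 'I_n -> V), (forall i, S (e i)) -> kfree e -> (n <= B)%N) ->
  exists n (e : 'I_n -> V), kbasis S e.
Proof.
move=> S0 SD SZ hB.
have Ssum n (e : 'I_n -> V) (c : 'I_n -> k) : (forall i, S (e i)) -> S (\sum_i c i *: e i).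
  by move=> he; elim/big_ind: _ => // i _; exact: SZ.
pose P n := exists2 e : 'I_n -> V, forall i, S (e i) & kfree e.
have P0 : P 0%N by exists (fun=> 0) => [[]|c _ []].
have [n /asboolP[e he fe] hn] := @ex_maxnP (fun n => `[< P n >]) B
  (ex_intro _ 0%N (introT (asboolP _) P0))
  (fun n h => let: ex_intro2 e h1 h2 := elimT (asboolP _) h in hB n e h1 h2).
exists n, e; apply/kbasisP => [c|]; first exact: Ssum.
split=> // v Sv; apply: contrapT => nv.
suff /hn : `[< P n.+1 >] by rewrite ltnn.
apply/asboolP; exists (fun i => if unlift ord0 i is Some j then e j else v).
  by move=> i; case: unlift.
move=> c; rewrite big_ord_recl unlift_none.
under eq_bigr do rewrite liftK.
move=> E.
have c0 : c ord0 = 0.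
  apply: contrapT => /eqP c0; apply: nv; exists (fun i => - (c ord0)^-1 * c (lift ord0 i)).
  apply: (scalerI c0); apply/eqP; rewrite -subr_eq0 -[X in _ == X]E; apply/eqP.
  congr (_ + _); rewrite scaler_sumr -sumrN; apply: eq_bigr => i _.
  by rewrite scalerA mulNr mulrN mulrA divff // mul1r scaleNr opprK.
by move: E; rewrite c0 scale0r add0r => /fe h i; case: (unliftP ord0 i) => [j|] ->.
Qed.

End LinearAlgebra.

Lemma imul_map (R : comNzRingType) (m : submodClosed R^o) (M M' : lmodType R)
  (f : {linear M -> M'}) z : z \in imul m (full M) -> f z \in imul m (full M').
Proof.
move: z; apply: mspan_ind => [|x y hx hy|a x hx|_ [a [x [am _ ->]]]].
- by rewrite linear0 rpred0.
- by rewrite linearD rpredD.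
- by rewrite linearZ rpredZ.
- by rewrite linearZ; exact: mem_imul.
Qed.

Lemma imul_lift (R : comNzRingType) (m : submodClosed R^o) (M M' : lmodType R)
  (f : {linear M -> M'}) w : (forall w, exists z, f z = w) ->
  w \in imul m (full M') -> exists2 z, z \in imul m (full M) & f z = w.
Proof.
move=> fs; move: w; apply: mspan_ind => [|x y [u hu <-] [v hv <-]|a x [u hu <-]|_ [a [x [am _ ->]]]].
- by exists 0; rewrite ?rpred0 ?linear0.
- by exists (u + v); rewrite ?linearD ?rpredD.
- by exists (a *: u); rewrite ?linearZ ?rpredZ.
- by have [z <-] := fs x; exists (a *: z); rewrite ?linearZ ?mem_imul.
Qed.

Section Nu.
Variables (R : comNzRingType) (k : fieldType) (p : residue_map R k).
Local Notation m := (kerI p).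
Implicit Types M : lmodType R.

Lemma mem_kerI (a : R) : ((a : R^o) \in m) = (p a == 0).
Proof. by []. Qed.

Lemma fcls_eq0 M (z : M) : fcls p z = 0 <-> z \in imul m (full M).
Proof.
by split=> [|h]; rewrite -(fcls0 p M) => *; [rewrite -[z]subr0|]; apply/cls_eq; rewrite ?subr0.
Qed.

Lemma fcls_sum M (I : Type) (s : seq I) (P : pred I) (F : I -> M) :
  fcls p (\sum_(i <- s | P i) F i) = \sum_(i <- s | P i) fcls p (F i).
Proof. exact: raddf_sum. Qed.

Lemma kspan_lift M n (z : 'I_n -> M) v :
  in_kspan (fun i => fcls p (z i)) (fcls p v) <->
  exists c : 'I_n -> R, v - \sum_i c i *: z i \in imul m (full M).
Proof.
split=> [[c E]|[c h]].
  exists (fun i => res_lift p (c i)); apply/fcls_eq0; rewrite fclsB fcls_sum E.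
  by apply/eqP; rewrite subr_eq0; apply/eqP/eq_bigr => i _; rewrite fclsZ res_liftK.
exists (fun i => p (c i)); move/fcls_eq0: h; rewrite fclsB fcls_sum => /eqP.
by rewrite subr_eq0 => /eqP ->; apply: eq_bigr => i _; rewrite fclsZ.
Qed.

Lemma nu_basis M : fg M -> exists z : 'I_(nu p M) -> M,
  kbasis setT (fun i => fcls p (z i)).
Proof.
move=> [n [s hs]].
have [d [e he]] : exists d (e : 'I_d -> fiber p M), kbasis setT e.
  apply: (@exists_kbasis _ _ _ n) => // d e _ fe.
  apply: (@kfree_leq _ (fiber p M) _ _ (fun i => fcls p (s i)) e) => // j.
  have [x ->] := fcls_surj (e j); have [a ->] := hs x.
  by exists (fun i => p (a i)); rewrite fcls_sum; apply: eq_bigr => i _; rewrite fclsZ.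
have -> : nu p M = d := kdimE he.
have /choice[z hz] : forall i, exists z : M, e i = fcls p z by move=> i; exact: fcls_surj.
by exists z; move: he; congr (kbasis _ _); apply/funext.
Qed.

Lemma nu_eq M M' (f : {linear M -> M'}) : fg M ->
  (forall w, exists z, f z = w) ->
  (forall z, f z = 0 -> z \in imul m (full M)) -> nu p M' = nu p M.
Proof.
move=> fgM fs fk; have [z /kbasisTP[fz sz]] := nu_basis fgM.
apply: (@kdimE _ (fiber p M') _ (fun i => fcls p (f (z i)))).
apply/kbasisTP; split=> [c Ec|q].
  apply: fz; pose w := \sum_i res_lift p (c i) *: z i.
  have Ew : fcls p w = \sum_i c i *: fcls p (z i).
    by rewrite fcls_sum; apply: eq_bigr => i _; rewrite fclsZ res_liftK.
  rewrite -Ew; apply/fcls_eq0.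
  have /(imul_lift fs) [v hv fv] : f w \in imul m (full M').
    apply/fcls_eq0; rewrite -Ec linear_sum fcls_sum; apply: eq_bigr => i _.
    by rewrite linearZ fclsZ res_liftK.
  rewrite -(subrK v w); apply: rpredD => //; apply: fk.
  by rewrite linearB fv subrr.
have [w ->] := fcls_surj q; have [v <-] := fs w.
have /kspan_lift[c hc] := sz (fcls p v).
apply/(@kspan_lift _ _ (fun i => f (z i))); exists c.
have <- : f (\sum_i c i *: z i) = \sum_i c i *: f (z i).
  by rewrite linear_sum; apply: eq_bigr => i _; rewrite linearZ.
by rewrite -linearB; exact: imul_map.
Qed.

(** Generators of L and lifts of generators of M' together span M/mM. If their number is the
    dimension, they form a basis, so L/mL embeds in M/mM. *)
Lemma nu_exact M M' (L : submodClosed M) (f : {linear M -> M'}) :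
  fg M -> fg (subm L) -> (forall w, exists z, f z = w) ->
  (forall z, f z = 0 <-> z \in L) ->
  (nu p M <= nu p (subm L) + nu p M')%N /\
  (nu p M = nu p (subm L) + nu p M' ->
   forall z : subm L, val z \in imul m (full M) -> z \in imul m (full (subm L)))%N.
Proof.
move=> fgM fgL fs fk; have fgM' : fg M'.
  have [n [s hs]] := fgM; exists n, (fun i => f (s i)) => w; have [z <-] := fs w.
  have [a ->] := hs z; exists a; rewrite linear_sum; apply: eq_bigr => i _.
  by rewrite linearZ.
have [u /kbasisTP[fu su]] := nu_basis fgL.
have [w /kbasisTP[fw sw]] := nu_basis fgM'.
have [e /kbasisTP[fe se]] := nu_basis fgM.
have /choice[v hv] : forall i, exists z, f z = w i by move=> i; exact: fs.
pose g (i : 'I_(nu p (subm L) + nu p M')) : fiber p M :=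
  match split i with inl i => fcls p (val (u i)) | inr i => fcls p (v i) end.
have sg q : in_kspan g q.
  have [x ->] := fcls_surj q; have /kspan_lift[b hb] := sw (fcls p (f x)).
  (* Subtracting y, an element of mM, makes the error of the lift vanish in M', so that the rest
     lies in L. *)
  have [y ym fy] := imul_lift fs hb; pose l := x - \sum_i b i *: v i - y.
  have lL : l \in L.
    apply/fk; rewrite /l !linearB fy linear_sum; apply/eqP; rewrite subr_eq0; apply/eqP.
    by congr (_ - _); apply: eq_bigr => i _; rewrite linearZ /= hv.
  have /kspan_lift[a ha] := su (fcls p (exist _ l lL : subm L)).
  exists (fun i => match split i with inl i => p (a i) | inr i => p (b i) end).
  rewrite big_split_ord /g /=.
  under eq_bigr do rewrite (unsplitK (inl _)) -fclsZ.
  under [X in _ + X]eq_bigr do rewrite (unsplitK (inr _)) -fclsZ.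
  rewrite -!fcls_sum; apply/eqP; rewrite -subr_eq0 -fclsD -fclsB; apply/eqP/fcls_eq0.
  have := imul_map (val : {linear subm L -> M}) ha; rewrite linearB linear_sum /= => h.
  have := rpredD h ym; rewrite /l.
  have -> : \sum_i val (a i *: u i) = \sum_i a i *: val (u i) by [].
  by rewrite addrAC subrK addrAC -addrA -opprD [X in _ - X]addrC.
split.
  apply: (@kfree_leq _ (fiber p M) _ _ g (fun i => fcls p (e i))) => // j; exact: sg.
move=> E; have gf : kfree g.
  move: e fe se; rewrite E => e fe se; exact: kspan_kfree fe sg se.
move=> z zm; apply/fcls_eq0; have [c Ec] := su (fcls p z).
have /kspan_lift[a ha] : in_kspan (fun i => fcls p (u i)) (fcls p z) by exists c.
suff a0 i : p (a i) = 0.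
  have -> : fcls p z = fcls p (\sum_i a i *: u i).
    by apply/eqP; rewrite -subr_eq0 -fclsB; apply/eqP/fcls_eq0.
  by rewrite fcls_sum big1 // => i _; rewrite fclsZ a0 scale0r.
pose d (i : 'I_(nu p (subm L) + nu p M')) : k :=
  match split i with inl i => p (a i) | inr _ => 0 end.
have -> : p (a i) = d (lshift _ i) by rewrite /d (unsplitK (inl _)).
apply: gf; rewrite big_split_ord /g /d /=.
under eq_bigr do rewrite (unsplitK (inl _)) -fclsZ.
rewrite -fcls_sum [X in _ + X]big1 ?addr0 => [|j _]; last first.
  by rewrite (unsplitK (inr _)) scale0r.
apply/fcls_eq0; have := imul_map (val : {linear subm L -> M}) ha.
by rewrite linearB linear_sum /= => h; have := rpredB zm h; rewrite opprB addrC subrK.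
Qed.

End Nu.

(** * Length of finitely generated torsion modules *)

Section Length.
Variables (R : comNzRingType) (k : fieldType) (p : residue_map R k).
Local Notation m := (kerI p).
Variable M : lmodType R.
Hypothesis accM : acc M.
Hypothesis fgM : fg M.
Hypothesis torsM : forall z : M, exists t, forall a : R, (a : R^o) \in ipow R^o m t -> a *: z = 0.

Definition strict_chain n (D : nat -> set M) : Prop :=
  (forall i, submod (D i)) /\
  forall i, (i < n)%N -> D i `<=` D i.+1 /\ ~ D i.+1 `<=` D i.

Definition length_leq (C : set M) (B : nat) : Prop :=
  forall n D, strict_chain n D -> D n `<=` C -> (n <= B)%N.

Lemma chain_sub n D : strict_chain n D -> forall i j, (i <= j)%N -> (j <= n)%N -> D i `<=` D j.
Proof.
move=> [_ h] i j; elim: j => [|j IH]; first by rewrite leqn0 => /eqP -> _ x.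
rewrite leq_eqVlt => /orP[/eqP -> _ x //|ij] jn.
exact: subset_trans (IH ij (ltnW jn)) (h j jn).1.
Qed.

(** The quotient (C + Rz)/C is killed by m and cyclic, so it adds at most one to the length. *)
Lemma length_leq_addr C B z : submod C -> length_leq C B ->
  (forall a : R, p a = 0 -> C (a *: z)) -> length_leq (addr_gen C z) B.+1.
Proof.
move=> sC hC hz n D hD hn; have [sD hs] := hD; have mono := chain_sub hD.
have [nC|nC] := pselect (D n `<=` C); first exact: leqW (hC _ _ hD nC).
have [j /asboolP jC jmin] := @ex_minnP (fun j => `[< ~ D j `<=` C >])
  (ex_intro _ n (introT (asboolP _) nC)).
have jn : (j <= n)%N by apply: jmin; exact/asboolP.
case: n hD hn hs mono nC jn => [//|n] hD hn hs mono nC jn; rewrite ltnS.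
(* The first index j with D j outside C is skipped. From j on, D i contains some w with C + Rw = C +
   Rz, so an element of D i.+1 can be corrected into C by a multiple of w; hence strict inclusions
   stay strict after intersection with C. *)
apply: (hC _ (fun i => D (if (i < j)%N then i else i.+1) `&` C)); last by move=> x [].
have sI i : submod (D i `&` C).
  case: (sD i) sC => D0 DD DZ [C0 CD CZ]; split=> [//|x y [? ?] [? ?]|a x [? ?]].
    by split; [exact: DD | exact: CD].
  by split; [exact: DZ | exact: CZ].
have step i : (j <= i)%N -> (i < n.+1)%N -> ~ D i.+1 `&` C `<=` D i `&` C.
  move=> ji ilt le; have [_] := hs _ ilt; apply => x Dx.
  have /existsNP[w /not_implyP[Dw nw]] := jC.
  have [c Cc [a Ew]] := hn _ (mono _ _ jn (leqnn _) _ Dw).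
  have [c' Cc' [a' Ex]] := hn _ (mono _ _ ilt (leqnn _) _ Dx).
  have pa : p a != 0.
    apply/eqP => pa; apply: nw; rewrite Ew; case: sC => _ CD _; apply: CD => //.
    exact: hz.
  pose r := res_lift p (p a' / p a).
  have Cxr : C (x - r *: w).
    rewrite Ex Ew scalerDr scalerA opprD addrACA -scalerBl.
    have [C0 CD CZ] := sC; apply: CD; first by apply: submodB => //; exact: CZ.
    by apply: hz; rewrite rmorphB rmorphM res_liftK divfK // subrr.
  have Diw : D i (r *: w).
    by case: (sD i) => _ _; apply; apply: (mono _ _ ji _ _ Dw); exact: ltnW.
  have [|Dxr _] := le (x - r *: w).
    split=> //; apply: submodB => //; apply: (mono i i.+1) => //.
  by rewrite -(subrK (r *: w) x); case: (sD i) => _ iD _; exact: iD.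
split=> [i|i ilt]; first exact: sI.
split.
  move=> x [Dx Cx]; split=> //; move: Dx; apply: mono.
    by do 2 case: ifP => _; rewrite ?leqnn ?leqnSn ?leqW.
  by case: ifP => _ //; exact: leqW.
have [h1|h1] := ltnP i j; last by rewrite ltnNge (leqW h1) /=; exact: (step i.+1 (leqW h1) ilt).
have [h2|h2] := ltnP i.+1 j.
  move=> le; have [_] := hs i (ltnW ilt); apply=> x Dx.
  apply: (le x _).1; split=> //; move: x Dx; apply: contrapT => nx.
  by have := jmin i.+1 (introT (asboolP _) nx); rewrite leqNgt h2.
move=> le; have /(step _ h2)  : (i.+1 < n.+1)%N by [].
apply; apply: (subset_trans le) => x [Dx Cx]; split=> //.
by case: (hs i (ltnW ilt)) => + _; apply.
Qed.

(** A submodule C maximal among those of bounded length is everything: for z outside C, take the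
    least power of m sending z into C; some multiple of z by an element of the preceding power is
    outside C but sent into C by m, so C could be enlarged. *)
Lemma length_bounded : exists B, length_leq setT B.
Proof.
pose F : set (set M) := [set C | submod C /\ exists B, length_leq C B].
have F0 : F [set 0].
  split; first by split=> [//|x y -> ->|a x ->] /=; rewrite ?addr0 ?scaler0.
  exists 0%N => -[//|n] D [sD hD] hn; case: (hD n (ltnSn n)) => _ [].
  by move=> x /hn ->; case: (sD n).
have [C [sC [B hB]] hmax] := acc_max accM (F := F) (fun _ => @proj1 _ _) (ex_intro _ _ F0).
exists B => n D hD hn; apply: (hB _ _ hD) => z _; apply: contrapT => nz.
have [t ht] := torsM z.
have ht0 : forall a : R, (a : R^o) \in ipow R^o m t -> C (a *: z).
  by move=> a /ht ->; case: sC.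
have [t' /asboolP ht' tmin] := @ex_minnP
  (fun t => `[< forall a : R, (a : R^o) \in ipow R^o m t -> C (a *: z) >])
  (ex_intro _ t (introT (asboolP _) ht0)).
case: t' ht' tmin => [|t'] ht' tmin.
  by apply: nz; rewrite -[z]scale1r; exact: ht'.
have : ~ forall a : R, (a : R^o) \in ipow R^o m t' -> C (a *: z).
  by move=> h; have := tmin t' (introT (asboolP _) h); rewrite ltnn.
move=> /existsNP[a /not_implyP[ha nCa]]; apply: nCa.
apply: (hmax (addr_gen C (a *: z))).
- split; first exact: addr_gen_submod.
  exists B.+1; apply: length_leq_addr => // b pb; rewrite scalerA; apply: ht'.
  by apply/asboolP => N; apply; exists b, a; split=> //; rewrite mem_kerI pb.
- exact: sub_addr_gen.
- exact: addr_gen_mem.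
Qed.

Lemma length_geq n D : strict_chain n D -> (n <= mod_length M)%N.
Proof.
move=> [sD hD]; have [B hB] := length_bounded; apply: (@nmax_geq _ B).
  move=> i [N hN]; apply: (hB i (fun j => [set x | x \in N (inord j)])) => //.
  split=> [j|j ji]; first exact: (submodClosed_submod (N (inord j))).
  have [|le [x xin xout]] := hN (inord j) (inord j.+1).
    by rewrite !inordK // ltnS // ltnW.
  split; first exact: le.
  by move=> le'; move: xout; rewrite (le' _ xin).
exists (fun i : 'I_n.+1 => mspan (D i)) => i j ij.
have mono := chain_sub (conj sD hD).
split.
  move=> x /(mem_mspan (sD i)) Dx; apply/(mem_mspan (sD j)).
  by apply: mono Dx; [exact: ltnW | rewrite -ltnS].
have jn : (j <= n)%N by rewrite -ltnS.
have [_ /existsNP[x /not_implyP[Dx nDx]]] := hD i (leq_trans ij jn).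
exists x; first by apply/(mem_mspan (sD j)); apply: mono Dx.
by apply/negP => /(mem_mspan (sD i)).
Qed.

(** Adding minimal generators to mM one at a time gives a strict chain of length nu from mM to M. If
    mM is nonzero, the chain extends below by 0. *)
Lemma nu_leq_length :
  (nu p M <= mod_length M)%N /\
  (nu p M = mod_length M -> forall z, z \in imul m (full M) -> z = 0).
Proof.
have [z /kbasisTP[fz sz]] := nu_basis p fgM; set n := nu p M in z fz sz *.
pose D (j : nat) : set M := [set x | exists c : 'I_n -> R,
  x - \sum_(i < n | (i < j)%N) c i *: z i \in imul m (full M)].
have sD j : submod (D j).
  split.
  - by exists (fun=> 0); rewrite big1 ?subr0 ?rpred0 // => i _; rewrite scale0r.
  - move=> x y [c hc] [d hd]; exists (fun i => c i + d i).
    under eq_bigr do rewrite scalerDl.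
    by rewrite big_split opprD addrACA; exact: rpredD.
  - move=> a x [c hc]; exists (fun i => a * c i).
    under eq_bigr do rewrite -scalerA.
    by rewrite -scaler_sumr -scalerBr; exact: rpredZ.
have hD : strict_chain n D.
  split=> // i lt_in; split.
    move=> x [c hc]; exists (fun j : 'I_n => if (j < i)%N then c j else 0).
    suff -> : \sum_(j < n | (j < i.+1)%N) (if (j < i)%N then c j else 0) *: z j =
              \sum_(j < n | (j < i)%N) c j *: z j by [].
    rewrite big_mkcond [RHS]big_mkcond; apply: eq_bigr => j _.
    case: (ltnP j i) => ji; first by rewrite ltnS ltnW.
    by rewrite scale0r; case: ifP.
  move=> le; pose j := Ordinal lt_in; have /le [c] : D i.+1 (z j).
    exists (fun l => (l == j)%:R); rewrite (bigD1 j) //= eqxx scale1r big1 ?addr0 ?subrr ?rpred0 //.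
    by move=> l /andP[_ /negPf ->]; rewrite scale0r.
  move=> /fcls_eq0 E.
  have := fz (fun l : 'I_n => if l == j then 1 else if (l < i)%N then - p (c l) else 0).
  have h : \sum_(l < n) (if l == j then 1 else if (l < i)%N then - p (c l) else 0) *: fcls p (z l) = 0.
    rewrite -[RHS]E fclsB fcls_sum (bigD1 j) //= eqxx scale1r; congr (_ + _).
    rewrite (bigID (fun l : 'I_n => (l < i)%N)) /= [X in _ + X]big1 ?addr0; last first.
      by move=> l /andP[/negPf -> /negPf ->]; rewrite scale0r.
    rewrite -sumrN; apply: eq_big => [l|l /andP[/negPf -> ->]].
      by case: ltnP => [li|_]; rewrite ?andbT ?andbF // -val_eqE /= ltn_eqF.
    by rewrite scaleNr fclsZ.
  by move=> /(_ h j); rewrite eqxx => /eqP; rewrite oner_eq0.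
split; first exact: length_geq hD.
move=> E x xm; apply: contrapT => x0; have := ltnn n; rewrite {2}E.
rewrite (@length_geq n.+1 (fun j => if j is j'.+1 then D j' else [set 0])) //.
split=> [[|j]|[|j] jn]; last exact: hD.2.
- by split=> [//|u v -> ->|a u ->] /=; rewrite ?addr0 ?scaler0.
- exact: sD.
- split; first by move=> _ ->; case: (sD 0%N).
  move/(_ x) => /= h; apply: x0; apply: h; exists (fun=> 0).
  by rewrite big1 ?subr0.
Qed.

End Length.

(** * Sequences that are regular on mM *)

Section IdealMul.
Variables (R : comNzRingType) (M : lmodType R).
Implicit Types (xs : seq R) (A B : set M).

(** One coefficient from A for each entry of xs: for a submodule A, the product of A with the ideal
    generated by xs. *)
Fixpoint isum xs A : set M :=
  if xs is x :: s then
    [set z | exists2 a, A a & exists2 b, isum s A b & z = x *: a + b]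
  else [set 0].

Lemma isum_submod xs A : submod A -> submod (isum xs A).
Proof.
move=> [A0 AD AZ]; elim: xs => [|x s [I0 ID IZ]] /=.
  by split=> [//|x y -> ->|a x ->] /=; rewrite ?addr0 ?scaler0.
split.
- by exists 0 => //; exists 0; [|rewrite scaler0 addr0].
- move=> _ _ [a Aa [b hb ->]] [a' Aa' [b' hb' ->]]; exists (a + a'); first exact: AD.
  by exists (b + b'); [exact: ID | rewrite scalerDr addrACA].
- move=> c _ [a Aa [b hb ->]]; exists (c *: a); first exact: AZ.
  by exists (c *: b); [exact: IZ | rewrite scalerDr !scalerA [c * x]mulrC].
Qed.

Lemma isum_mono xs A B : A `<=` B -> isum xs A `<=` isum xs B.
Proof.
move=> AB; elim: xs => [//|x s IH] z [a Aa [b hb ->]].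
by exists a; [exact: AB | exists b => //; exact: IH].
Qed.

Lemma isum_cons x s A : A 0 -> isum s A `<=` isum (x :: s) A.
Proof. by move=> A0 z hz; exists 0 => //; exists z; rewrite // scaler0 add0r. Qed.

Lemma isum_sub xs A B : submod B -> (forall x a, x \in xs -> A a -> B (x *: a)) ->
  isum xs A `<=` B.
Proof.
move=> [B0 BD BZ]; elim: xs => [|x s IH] h z /=; first by move=> ->.
move=> [a Aa [b hb ->]]; apply: BD; first by apply: h => //; exact: mem_head.
by apply: IH hb => y c ys; apply: h; rewrite inE ys orbT.
Qed.

Lemma isum_scale xs A B v y : (forall a, A a -> B (v *: a)) ->
  isum xs A y -> isum xs B (v *: y).
Proof.
move=> h; elim: xs y => [|x s IH] y /=; first by move=> ->; rewrite scaler0.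
move=> [a Aa [b hb ->]]; exists (v *: a); first exact: h.
by exists (v *: b); [exact: IH | rewrite scalerDr !scalerA mulrC].
Qed.

Lemma isum_catr W xs A : A 0 -> isum W A `<=` isum (xs ++ W) A.
Proof.
by move=> A0; elim: xs => [//|x s IH] z /IH h; exact: isum_cons.
Qed.

End IdealMul.

Section IdealMulMap.
Variables (R : comNzRingType) (M M' : lmodType R) (f : {linear M -> M'}).
Hypothesis fs : forall w, exists z, f z = w.

Lemma isum_map xs A z : isum xs A z -> isum xs (f @` A) (f z).
Proof.
elim: xs z => [|x s IH] z /=; first by move=> ->; rewrite linear0.
move=> [a Aa [b hb ->]]; exists (f a); first by exists a.
by exists (f b); [exact: IH | rewrite linearD linearZ].
Qed.

Lemma isum_lift xs A w : isum xs (f @` A) w -> exists2 z, isum xs A z & f z = w.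
Proof.
elim: xs w => [|x s IH] w /=; first by move=> ->; exists 0; rewrite // linear0.
move=> [_ [a Aa <-] [b /IH[c hc <-] ->]]; exists (x *: a + c).
  by exists a => //; exists c.
by rewrite linearD linearZ.
Qed.

Lemma surj_image : f @` setT = setT.
Proof. by apply/seteqP; split=> // w _; have [z <-] := fs w; exists z. Qed.

End IdealMulMap.

Section Good.
Variables (R : comNzRingType) (k : fieldType) (p : residue_map R k).
Local Notation m := (kerI p).
Implicit Types M N : lmodType R.

(* The sequence is listed with its last element first; over mM it behaves like
   a regular sequence. *)
Fixpoint good M (xs : seq R) : Prop :=
  if xs is x :: s then
    [/\ good M s, p x = 0 & forall z : M, z \in imul m (full M) ->
        isum s setT (x *: z) -> isum s setT z]
  else True.

Definition complete M (xs : seq R) : Prop :=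
  forall z : M, z \in imul m (full M) -> isum xs setT z.

Lemma good_ker M xs : good M xs -> forall x, x \in xs -> p x = 0.
Proof.
elim: xs => [//|x s IH] [gs px _] y; rewrite inE => /orP[/eqP -> //|]; exact: IH.
Qed.

Lemma setT_submod M : submod [set: M]. Proof. by split. Qed.

Lemma isum_imul M xs : (forall x, x \in xs -> p x = 0) ->
  isum xs setT `<=` [set z : M | z \in imul m (full M)].
Proof.
move=> h; apply: isum_sub; first exact: submodClosed_submod.
by move=> x a /h px _; apply: mem_imul; rewrite mem_kerI px.
Qed.

(** f is injective on mM, and the conditions only compare elements of mM, which contains (s)M for
    every s consisting of elements of m. *)
Lemma good_lift_socle M N (f : {linear M -> N}) xs : (forall w, exists z, f z = w) ->
  (forall z, f z = 0 -> z \in imul m (full M) -> z = 0) ->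
  good N xs -> complete N xs -> good M xs /\ complete M xs.
Proof.
move=> fs fk.
have key s z : (forall x, x \in s -> p x = 0) -> z \in imul m (full M) ->
    isum s setT (f z) -> isum s setT z.
  move=> hs zm; rewrite -(surj_image fs) => /isum_lift[y hy E].
  suff -> : z = y by [].
  apply/eqP; rewrite -subr_eq0; apply/eqP; apply: fk; first by rewrite linearB E subrr.
  by apply: rpredB => //; exact: (isum_imul hs hy).
move=> gN cN; have hker := good_ker gN; split; last first.
  by move=> z zm; apply: key => //; apply: cN; exact: imul_map.
elim: xs gN {cN} hker => [//|x s IH] /= [gs px hx] hker.
have hs y : y \in s -> p y = 0 by move=> ys; apply: hker; rewrite inE ys orbT.
split=> //; first exact: IH.
move=> z zm /(isum_map f); rewrite surj_image // linearZ => h.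
by apply: key => //; apply: hx => //; exact: imul_map.
Qed.

(** The preimage of (s)N is (s, x)M. The new element comes first in the sequence, hence last in the
    list, and its own condition is regularity on M. *)
Lemma good_lift_regular M N (f : {linear M -> N}) x xs :
  (forall w, exists z, f z = w) -> (forall z, f z = 0 <-> exists w, z = x *: w) ->
  p x = 0 -> regular_on M x ->
  good N xs -> complete N xs -> good M (rcons xs x) /\ complete M (rcons xs x).
Proof.
move=> fs fk px rx.
have key s z : isum s setT (f z) <-> isum (rcons s x) setT z.
  elim: s z => [|y s IH] z /=.
    rewrite fk; split=> [[w ->]|[w _ [_ -> ->]]].
      by exists w => //; exists 0; rewrite // addr0.
    by exists w; rewrite addr0.
  split=> [[a _ [b hb E]]|[a _ [b /IH hb ->]]].
    have [a' Ea] := fs a; have [b' Eb] := fs b.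
    exists a' => //; exists (z - y *: a'); last by rewrite addrC subrK.
    by apply/IH; rewrite linearB linearZ Ea E addrC addKr.
  by exists (f a) => //; exists (f b); rewrite // linearD linearZ.
move=> gN cN; split; last first.
  by move=> z zm; apply/key; apply: cN; exact: imul_map.
elim: xs gN {cN} => [_|y s IH] /=.
  by split=> // z _ h; apply: rx.
move=> [gs py hy]; split=> //; first exact: IH.
move=> z zm /key; rewrite linearZ => h; apply/key; apply: hy => //; exact: imul_map.
Qed.

Section Powers.
Variable M : lmodType R.
Local Notation "''m^' n" := [set z : M | z \in ipow M m n] (at level 8, n at level 2).

Lemma mem_ipowS n (a : R) (z : M) : p a = 0 -> z \in ipow M m n -> a *: z \in ipow M m n.+1.
Proof.
by move=> pa zn; apply/asboolP => N; apply; exists a, z; split=> //; rewrite mem_kerI pa.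
Qed.

Lemma ipow_complete xs n : complete M xs -> 'm^(n.+1) `<=` isum xs 'm^n.
Proof.
move=> cx; have sI j := isum_submod xs (submodClosed_submod (ipow M m j)).
elim: n => [|n IH] z /=.
  by move=> zm; apply: (isum_mono (A := setT)); [|exact: cx].
move: z; apply: mspan_ind; first by case: (sI n.+1).
- by move=> x y; case: (sI n.+1) => _ ID _; exact: ID.
- by move=> a x; case: (sI n.+1) => _ _; apply.
move=> _ [a [x [am /IH hx ->]]].
by apply: isum_scale hx => b; apply: mem_ipowS; exact/eqP.
Qed.

(** A condition of Valabrega-Valla type: (W)M meets m^{n+1}M in (W)m^nM. It descends from the whole
    list, where it is [ipow_complete], to its suffixes. When v is dropped, its coefficient lies in
    (W)M by regularity on mM; induction on n puts it in (W) times a power of m, and multiplying by v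
    raises that power by one. *)
Lemma isum_ipow pre W n : good M (pre ++ W) -> complete M (pre ++ W) ->
  isum W setT `&` 'm^(n.+1) `<=` isum W 'm^n.
Proof.
elim: n pre W => [|n IHn] pre W.
  by move=> _ _ z [hz _]; apply: isum_mono hz.
elim/last_ind: pre W => [|pre v IH] W.
  by move=> _ c z [_ hz]; exact: (ipow_complete c).
rewrite cat_rcons => g c z [hz zm].
have [a am [b hb Ez]] : isum (v :: W) 'm^n.+1 z.
  apply: (IH (v :: W) g c); split=> //; exact: isum_cons.
rewrite Ez; have sW := isum_submod W (submodClosed_submod (ipow M m n.+1)).
case: (sW) => _ WD WZ; apply: WD => //.
have [gW pv hv] : good M (v :: W).
  by move: g; clear; elim: pre => [//|x s IH] /= [/IH].
have aW : isum W setT a.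
  apply: hv; first exact: (ipow_leq (s := 1)) am.
  have sT := isum_submod W (setT_submod M).
  have := submodB sT hz (isum_mono (B := setT) _ hb).
  by rewrite Ez addrK; exact.
have {aW} : isum W 'm^n a.
  by apply: (IHn (rcons pre v) W); rewrite ?cat_rcons.
by apply: isum_scale => u; exact: mem_ipowS.
Qed.

End Powers.

End Good.

(** * Equality of nu and Deg *)

Section GoodGr.
Variables (R : comNzRingType) (k : fieldType) (p : residue_map R k) (M : lmodType R).
Local Notation m := (kerI p).
Local Notation "''m^' n" := [set z : M | z \in ipow M m n] (at level 8, n at level 2).

Lemma good_suffix pre W : good p M (pre ++ W) -> good p M W.
Proof. by elim: pre => [//|x s IH] /= [/IH]. Qed.

(** Regularity of v for initial forms in positive degree. The error w lies in (v, W)M and in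
    m^{n+3}M, so [isum_ipow] writes it with coefficients in m^{n+2}M; removing the coefficient b of
    v from z makes the relation v(z - b) in (W)M exact. *)
Lemma good_gr pre v W n z u w : good p M (pre ++ v :: W) -> complete p M (pre ++ v :: W) ->
  z \in ipow M m n.+1 -> isum W setT u -> w \in ipow M m n.+3 -> v *: z = u + w ->
  exists2 s, isum W 'm^n s & z - s \in ipow M m n.+2.
Proof.
move=> g c zm hu hw E; have sT := isum_submod W (setT_submod M); have [_ TD TZ] := sT.
have [b bm [w' hw' Ew]] : isum (v :: W) 'm^n.+2 w.
  apply: (isum_ipow g c); split=> //.
  have /= [_ VD VZ] := isum_submod (v :: W) (setT_submod M).
  have -> : w = v *: z + -1 *: u by rewrite E scaleN1r addrC addKr.
  apply: VD; last by apply: VZ; exact: isum_cons.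
  by exists z => //; exists 0; [case: sT | rewrite addr0].
have [gW pv hv] := good_suffix g.
have bm1 : b \in ipow M m n.+1 by apply: ipow_leq bm.
exists (z - b); last by rewrite opprB addrC subrK.
apply: (@isum_ipow _ _ _ _ (rcons pre v) W); rewrite ?cat_rcons //; split; last exact: rpredB.
have zbn : z - b \in ipow M m n.+1 := rpredB zm bm1.
have zb : z - b \in ipow M m 1 by apply: ipow_leq zbn.
apply: hv; first exact: zb.
rewrite scalerBr E Ew [v *: b + w']addrC addrA addrK.
by apply: TD => //; apply: isum_mono hw'.
Qed.

End GoodGr.

Lemma ker_submod (R : comNzRingType) (M N : lmodType R) (f : {linear M -> N}) :
  submod [set z | f z = 0].
Proof.
split=> /= [|x y fx fy|a x fx]; first exact: linear0.
- by rewrite linearD fx fy addr0.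
- by rewrite linearZ /= fx scaler0.
Qed.

(** * Induction along quotients by Gamma_m and by generic elements *)

Section Induction.
Variables (R : comNzRingType) (k : fieldType) (p : residue_map R k).
Local Notation m := (kerI p).
Hypothesis accR : acc (R^o : lmodType R).

Lemma val_lincomb (M : lmodType R) (L : submodClosed M) n (b : 'I_n -> R) (s : 'I_n -> subm L) :
  val (\sum_i b i *: s i) = \sum_i b i *: val (s i).
Proof. exact: (linear_sum (val : {linear subm L -> M})). Qed.

Lemma fg_acc (M : lmodType R) (L : submodClosed M) : acc M -> fg (subm L).
Proof.
move=> hM; pose sp (s : seq M) := foldr (fun z N => addr_gen N z) [set 0] s.
have ssp s : submod (sp s).
  elim: s => [|z s IH]; last exact: addr_gen_submod.
  by split=> [//|x y -> ->|a x ->] /=; rewrite ?addr0 ?scaler0.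
have [|s hs hmax] := acc_max_image (D := [set s : seq M | forall z, z \in s -> z \in L]) hM ssp.
  by exists [::].
have spL z : z \in L -> sp s z.
  move=> zL; apply: (hmax (z :: s)); [|exact: sub_addr_gen|exact: addr_gen_mem].
  by move=> z' /=; rewrite inE => /orP[/eqP ->|/hs].
have /choice[f hf] : forall i : 'I_(size s), exists l : subm L, val l = s`_i.
  move=> i; have hi : s`_i \in L by apply: hs; exact: mem_nth.
  by exists (exist (fun x => x \in L) _ hi).
exists (size s), f => l.
have [a Ea] : exists a : 'I_(size s) -> R, val l = \sum_(i < size s) a i *: s`_i.
  have := spL _ (valP l); move: (val l) => x; clear f hf spL hmax hs.
  elim: s x => [|z s IH] x /=.
    by move=> ->; exists (fun=> 0); rewrite big_ord0.
  move=> [y /IH[a ->] [b ->]].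
  exists (fun i => if unlift ord0 i is Some j then a j else b).
  rewrite big_ord_recl unlift_none /= addrC; congr (_ + _).
  by apply: eq_bigr => i _; rewrite liftK.
exists a; apply: val_inj; rewrite Ea val_lincomb.
by apply: eq_bigr => i _; rewrite hf.
Qed.

(** Gamma_m(M) is finitely generated, so one exponent serves all its elements. *)
Lemma gamma_killed (M : lmodType R) : acc M ->
  exists t, forall z, z \in gamma m M -> forall a : R, (a : R^o) \in ipow R^o m t -> a *: z = 0.
Proof.
move=> hM; have [n [s hs]] := fg_acc (gamma m M) hM.
have h i : exists t, forall t', (t <= t')%N ->
    forall a : R, (a : R^o) \in ipow R^o m t' -> a *: val (s i) = 0.
  have /asboolP[t ht] := valP (s i); exists t => t' tt' a /(ipow_leq tt'); exact: ht.
have [t ht] := eventually_all h; exists t => z zL a am.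
have [b /(congr1 val) E] := hs (exist _ z zL).
have -> : z = \sum_i b i *: val (s i) by rewrite -val_lincomb -E.
rewrite scaler_sumr big1 // => i _.
by rewrite scalerA mulrC -scalerA (ht i t) // scaler0.
Qed.

(** [Obj] stands for the local or the graded modules; the hypotheses collect what Nakayama's lemma
    and the axioms of a cohomological degree yield in both settings. *)
Variables (K : realFieldType) (Obj : Type) (car : Obj -> lmodType R) (Deg : Obj -> K).
Hypothesis obj_fg : forall M, fg (car M).
Hypothesis obj_nak : forall M, (exists z : car M, z <> 0) ->
  exists z, z \notin imul m (full (car M)).
Hypothesis Deg_zero : forall M, (forall z : car M, z = 0) -> Deg M = 0.
Hypothesis Deg_gamma : forall M, exists M1 (f : {linear car M -> car M1}),
  [/\ forall w, exists z, f z = w, forall z, f z = 0 <-> z \in gamma m (car M)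
    & Deg M = Deg M1 + (mod_length (subm (gamma m (car M))))%:R].
Hypothesis Deg_generic : forall M, (0 < depth m (car M))%N ->
  exists x M1 (f : {linear car M -> car M1}),
  [/\ p x = 0, regular_on (car M) x, forall w, exists z, f z = w,
      forall z, f z = 0 <-> exists w, z = x *: w & Deg M1 <= Deg M].

(** If m sends z into Gamma_m(M), which is killed by m^t, then m^{t+1} kills z. *)
Lemma quo_gamma_soc (M N : lmodType R) (f : {linear M -> N}) : acc M ->
  (forall w, exists z, f z = w) -> (forall z, f z = 0 <-> z \in gamma m M) ->
  ~ soc_mod m [set 0 : N].
Proof.
move=> hM fs fk [w w0 hw]; have [z Ez] := fs w; apply: w0; rewrite -Ez; apply/fk.
have [t ht] := gamma_killed hM; apply/asboolP; exists t.+1.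
apply: (@mspan_ind R R^o _ (fun a => (a : R) *: z = 0)) =>
  [|x y hx hy|a x hx|_ [a [x [am xm ->]]]].
- by rewrite scale0r.
- by rewrite scalerDl hx hy addr0.
- by rewrite -[a *: x]/(a * x) -scalerA hx scaler0.
rewrite -[a *: x]/(a * x) mulrC -scalerA; apply: ht => //.
by apply/fk; rewrite linearZ Ez; exact: hw.
Qed.

Let claim (M : Obj) : Prop :=
  (nu p (car M))%:R <= Deg M /\
  ((nu p (car M))%:R = Deg M -> exists xs, good p (car M) xs /\ complete p (car M) xs).

Lemma claim_gamma M M1 (f : {linear car M -> car M1}) :
  (forall w, exists z, f z = w) -> (forall z, f z = 0 <-> z \in gamma m (car M)) ->
  Deg M = Deg M1 + (mod_length (subm (gamma m (car M))))%:R -> claim M1 -> claim M.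
Proof.
move=> fs fk E [le1 eq1]; set L := gamma m (car M) in E fk *.
have accM := acc_fg accR (obj_fg M); have fgL := fg_acc L accM.
have torsL (z : subm L) : exists t, forall a : R, (a : R^o) \in ipow R^o m t -> a *: z = 0.
  have /asboolP[t ht] := valP z; exists t => a /ht h; exact: val_inj.
have [le2 eq2] := nu_leq_length (acc_fg accR fgL) fgL torsL.
have [le3 eq3] := nu_exact p (obj_fg M) fgL fs fk.
have le2' : (nu p (subm L))%:R <= (mod_length (subm L))%:R :> K by rewrite ler_nat.
have le3' : (nu p (car M))%:R <= (nu p (subm L))%:R + (nu p (car M1))%:R :> K.
  by rewrite -natrD ler_nat.
split.
  by rewrite E; apply: le_trans le3' _; rewrite addrC; exact: lerD.
move=> EM; have e1 : (nu p (car M1))%:R = Deg M1.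
  apply: le_anti; rewrite le1 /= -(lerD2r (mod_length (subm L))%:R) -E -EM.
  by apply: le_trans le3' _; rewrite addrC lerD2l.
have e2 : nu p (subm L) = mod_length (subm L).
  apply/eqP; rewrite -(eqr_nat K) eq_le le2' /= -(lerD2l (Deg M1)) -E -EM -e1.
  by rewrite addrC.
have e3 : nu p (car M) = (nu p (subm L) + nu p (car M1))%N.
  by apply/eqP; rewrite -(eqr_nat K) natrD EM E e1 e2 addrC.
have [xs [gxs cxs]] := eq1 e1; exists xs; apply: good_lift_socle fs _ gxs cxs.
(* Equality in [nu_exact] puts z into mL, and equality in [nu_leq_length] makes mL zero. *)
move=> z /fk zL zm; have := eq3 e3 (exist _ z zL) zm.
by move=> /(eq2 e2) /(congr1 val).
Qed.

Lemma claim_all M : claim M.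
Proof.
have accM := acc_fg accR (obj_fg M).
(* All objects met are quotients of M, so the induction runs over the kernels N of surjections from
   M, inside one noetherian module. *)
suff h (N : set (car M)) : submod N -> forall M' (f : {linear car M -> car M'}),
    (forall w, exists z, f z = w) -> [set z | f z = 0] = N -> claim M'.
  apply: (h [set 0] _ M idfun) => //; last by move=> w; exists w.
  by split=> [//|x y -> ->|a x ->] /=; rewrite ?addr0 ?scaler0.
move: N; apply: (acc_ind accM) => N sN IH M' f fs fk.
have accM' := acc_fg accR (obj_fg M').
have [M1 [g [gs gk E]]] := Deg_gamma M'; apply: (claim_gamma gs gk E).
have [h0|/existsNP[z z0]] := pselect (forall z : car M1, z = 0).
  have nu0 : nu p (car M1) = 0%N.
    by apply: (@kdimE _ _ 0%N (fun=> 0)); apply/kbasisTP; split=> [c _ []//|v];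
      exists (fun=> 0); rewrite big_ord0; have [w ->] := fcls_surj v; rewrite (h0 w) fcls0.
  by split; rewrite nu0 Deg_zero // => _; exists [::]; split=> // w _; exact: h0.
have dgt : (0 < depth m (car M1))%N.
  apply: depth_gt0 => //; first exact: (acc_fg accR (obj_fg M1)).
    exact: quo_gamma_soc gs gk.
  by apply: obj_nak; exists z.
have [x [M2 [h [px rx hs hk le]]]] := Deg_generic dgt.
have [le2 eq2] : claim M2.
  pose F : {linear car M -> car M2} := h \o (g \o f).
  have FE u : F u = h (g (f u)) by [].
  apply: (IH [set z | F z = 0] _ _ _ M2 F) => //.
  - exact: ker_submod.
  - by move=> u; rewrite -fk /= => fu; rewrite fu !linear0.
  (* If the kernel did not grow, x would kill the nonzero element z, against its regularity on
     M1. *)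
  - move=> le'; have [y Ey] := gs z; have [v Ev] := fs y.
    apply: z0; apply: rx; rewrite -Ey -Ev -!linearZ.
    have : N (x *: v); last by rewrite -fk /= => ->; rewrite linear0.
    have E' : g (f (x *: v)) = x *: g (f v) by rewrite !linearZ.
    by apply: le'; rewrite /= E'; apply/hk; exists (g (f v)).
  - move=> w; have [u Eu] := hs w; have [v Ev] := gs u; have [t Et] := fs v.
    by exists t; rewrite FE Et Ev.
have nuE : nu p (car M2) = nu p (car M1).
  apply: (nu_eq (obj_fg M1) hs) => w /hk[u ->]; apply: mem_imul.
  by rewrite mem_kerI px.
split; first by rewrite -nuE; exact: le_trans le2 le.
move=> E1; have [|xs [gxs cxs]] := eq2.
  by apply: le_anti; rewrite le2 nuE E1 le.
by exists (rcons xs x); exact: good_lift_regular gxs cxs.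
Qed.

Lemma exists_good M : (nu p (car M))%:R = Deg M ->
  exists xs, good p (car M) xs /\ complete p (car M) xs.
Proof. exact: (claim_all M).2. Qed.

End Induction.

(** * Linear forms *)

Section Forms.
Variables (k : fieldType) (N : nat).
Local Notation T := {mpoly k[N]}.
Implicit Types (q : T) (v : 'rV[k]_N) (W : seq 'rV[k]_N).

Definition lin v : T := \sum_j v 0 j *: 'X_j.

Lemma lin_is_linear : linear lin.
Proof.
move=> a u v; rewrite /lin scaler_sumr -big_split; apply: eq_bigr => j _.
by rewrite !mxE scalerDl scalerA.
Qed.
HB.instance Definition _ := GRing.isLinear.Build k 'rV[k]_N T *:%R lin lin_is_linear.

Lemma lin_delta j : lin (delta_mx 0 j) = 'X_j.
Proof.
rewrite /lin (bigD1 j) //= big1 => [|l /negPf lj]; last by rewrite mxE lj andbF scale0r.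
by rewrite mxE !eqxx scale1r addr0.
Qed.

Lemma mcoeff_lin v u : mdeg u != 1%N -> (lin v)@_u = 0.
Proof.
move=> hu; rewrite /lin raddf_sum big1 // => j _.
rewrite /= mcoeffZ mcoeffX; case: eqP => [E|_]; last by rewrite mulr0.
by move: hu; rewrite -E mdeg1.
Qed.

Lemma mcoeff_linU v j : (lin v)@_U_(j) = v 0 j.
Proof.
rewrite /lin raddf_sum (bigD1 j) //= big1 => [|l /negPf lj].
  by rewrite /= mcoeffZ mcoeffXU eqxx mulr1 addr0.
by rewrite /= mcoeffZ mcoeffXU lj mulr0.
Qed.

Lemma lin_eq0 v : lin v = 0 -> v = 0.
Proof. by move=> h; apply/rowP => j; rewrite -mcoeff_linU h mcoeff0 mxE. Qed.

Local Notation hom := (pihomog (@mdeg N)).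

Lemma mcoeff_hom d q u : (hom d q)@_u = if mdeg u == d then q@_u else 0.
Proof.
rewrite pihomogE raddf_sum /=.
under eq_bigr do rewrite mcoeffZ mcoeffX.
have [us|us] := boolP (u \in msupp q); last first.
  rewrite (memN_msupp_eq0 us) if_same big_seq_cond big1 // => w /andP[ws _].
  by case: eqP => [E|_]; rewrite ?mulr0 //; rewrite -E ws in us.
rewrite big_mkcond (bigD1_seq u) ?msupp_uniq //= eqxx mulr1 big1 ?addr0 // => w /negPf wu.
by rewrite wu mulr0 if_same.
Qed.

Lemma hom_lin_mul d v q : hom d.+1 (lin v * q) = lin v * hom d q.
Proof.
rewrite /lin !mulr_suml linear_sum; apply: eq_bigr => j _.
rewrite -!scalerAl linearZ /=; congr (_ *: _).
rewrite [q]mpolyE linear_sum !mulr_sumr !linear_sum; apply: eq_bigr => u _.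
rewrite -scalerAr !linearZ /= -scalerAr; congr (_ *: _).
rewrite -mpolyXD !pihomogX /= mdegD mdeg1 add1n eqSS.
by case: ifP => _; rewrite ?mpolyXD ?mulr0.
Qed.

Lemma mcoeffM0 a b u :
  (forall w w', u = (w + w')%MM -> (a : T)@_w * (b : T)@_w' = 0) -> (a * b)@_u = 0.
Proof. by move=> h; rewrite mcoeffM big1 // => w /eqP E; exact: h. Qed.

Definition ord_ge n : set T := [set q | forall u, (mdeg u < n)%N -> q@_u = 0].

Lemma ord_submod n : submod (ord_ge n : set T^o).
Proof.
split=> [u _|x y hx hy u un|a x hx u un]; first exact: mcoeff0.
  by rewrite mcoeffD hx // hy // addr0.
apply: mcoeffM0 => w w' E; rewrite hx ?mulr0 //.
by apply: leq_ltn_trans un; rewrite E mdegD leq_addl.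
Qed.

Lemma lin_ord n v q : ord_ge n q -> ord_ge n.+1 (lin v * q).
Proof.
move=> hq u un; apply: mcoeffM0 => w w' E.
have [h1|h1] := eqVneq (mdeg w) 1%N; last by rewrite mcoeff_lin ?mul0r.
by rewrite hq ?mulr0 //; move: un; rewrite E mdegD h1 add1n.
Qed.

(* Modulo the forms of W, every variable is congruent to its image under a
   linear projection killing W; the resulting substitution has the ideal
   generated by W as its kernel. *)
Definition subst W : {rmorphism T -> T} :=
  mmap (@mpolyC N k) (fun j => lin (delta_mx 0 j - projv <<W>>%VS (delta_mx 0 j))).

Lemma subst_lin W v : subst W (lin v) = lin (v - projv <<W>>%VS v).
Proof.
have -> : v - projv <<W>>%VS v =
    \sum_j v 0 j *: (delta_mx 0 j - projv <<W>>%VS (delta_mx 0 j)).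
  rewrite {1 2}(row_sum_delta v) linear_sum -sumrB; apply: eq_bigr => j _.
  by rewrite linearZ -scalerBr.
rewrite linear_sum [lin v]/lin raddf_sum; apply: eq_bigr => j _.
by rewrite linearZ /= -mul_mpolyC rmorphM /= mmapC mmapX mmap1U mul_mpolyC.
Qed.

Lemma lin_span (M : lmodType T) W v (A : set M) a : submod A -> v \in <<W>>%VS -> A a ->
  isum (map lin W) A (lin v *: a).
Proof.
move=> sA; elim: W v => [|w W IH] v.
  by rewrite span_nil memv0 => /eqP -> _; rewrite linear0 scale0r.
rewrite span_cons => /memv_addP[_ /vlineP[c ->] [z zW ->]] Aa.
exists (c%:MP *: a); first by case: sA => _ _; apply.
exists (lin z *: a); first exact: IH.
by rewrite linearD linearZ /= scalerDl scalerA -mul_mpolyC mulrC.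
Qed.

Lemma isum_span (M : lmodType T) W W' (A : set M) : submod A -> {subset W <= <<W'>>%VS} ->
  isum (map lin W) A `<=` isum (map lin W') A.
Proof.
move=> sA WW'; apply: isum_sub; first exact: isum_submod.
by move=> _ a /mapP[w /WW' wW' ->]; exact: lin_span.
Qed.

(** The congruence is stable under sums and products, so it is enough to check constants and
    variables. *)
Lemma subst_congr W q : isum (map lin W) (setT : set T^o) (q - subst W q).
Proof.
have sI : submod (isum (map lin W) (setT : set T^o)) by apply: isum_submod; split.
have [I0 ID IZ] := sI.
have hM a b : isum (map lin W) (setT : set T^o) (a - subst W a) ->
    isum (map lin W) (setT : set T^o) (b - subst W b) ->
    isum (map lin W) (setT : set T^o) (a * b - subst W (a * b)).
  move=> ha hb; have -> : a * b - subst W (a * b) =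
      b *: (a - subst W a : T^o) + subst W a *: (b - subst W b : T^o).
    rewrite rmorphM /= -![_ *: _]/(_ * _) !mulrBr [b * a]mulrC [b * subst W a]mulrC.
    by rewrite addrA subrK.
  by apply: ID; apply: IZ.
elim/mpolyind: q => [|c u q _ _ IH]; first by rewrite rmorph0 subrr.
rewrite rmorphD opprD addrACA; apply: ID => //; rewrite -mul_mpolyC; apply: (hM _ _).
  by rewrite /subst /= mmapC subrr.
rewrite mpolyXE_id; elim/big_ind: _ => [|x y hx hy|j _]; last 1 first.
- elim: (u j) => [|n IHn]; first by rewrite expr0 rmorph1 subrr.
  rewrite exprS; apply: (hM _ _) => //; rewrite -lin_delta subst_lin -linearB opprB addrC subrK.
  rewrite -[X in isum _ _ X]mulr1; apply: (@lin_span T^o) => //; exact: memv_proj.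
- by rewrite rmorph1 subrr.
- exact: hM.
Qed.

Lemma subst_ker W q : isum (map lin W) (setT : set T^o) q -> subst W q = 0.
Proof.
have hW w : w \in W -> subst W (lin w) = 0.
  by move=> wW; rewrite subst_lin projv_id ?memv_span // subrr linear0.
suff h s : (forall w, w \in s -> subst W (lin w) = 0) ->
    forall q, isum (map lin s) (setT : set T^o) q -> subst W q = 0 by exact: h.
elim: s {q hW} => [|w s IH] hW q /=; first by move=> ->; rewrite rmorph0.
move=> [a _ [b hb ->]]; rewrite rmorphD rmorphM /= hW ?mem_head // mul0r add0r.
by apply: IH hb => u us; apply: hW; rewrite inE us orbT.
Qed.

(** The ideal generated by the forms of W is the kernel of [subst W] into a domain, hence prime. It
    does not contain the form of v, which is sent to the nonzero form of v minus its projection. *)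
Lemma lin_regular W v q : v \notin <<W>>%VS ->
  isum (map lin W) (setT : set T^o) (lin v * q) -> isum (map lin W) (setT : set T^o) q.
Proof.
move=> vW /subst_ker; rewrite rmorphM /= subst_lin => /eqP; rewrite mulf_eq0.
move=> /orP[/eqP /lin_eq0 /eqP|/eqP E].
  by rewrite subr_eq0 => /eqP E; move: vW; rewrite E memv_proj.
by rewrite -[q]subr0 -E; exact: subst_congr.
Qed.

(** The constant terms of the coefficients contribute a linear form z, which is the degree 1 part of
    q and therefore zero. *)
Lemma isum_ord1 W q : isum (map lin W) (setT : set T^o) q -> ord_ge 2 q ->
  isum (map lin W) (ord_ge 1 : set T^o) q.
Proof.
move=> hq q2; suff [z [b hb E]] : exists z, exists2 b : T,
    isum (map lin W) (ord_ge 1 : set T^o) b & q = lin z + b.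
  have b2 : ord_ge 2 b.
    clear E q2 hq; elim: W b hb => [|w W IH] b /=; first by move=> ->; case: (ord_submod 2).
    move=> [a ha [c hc ->]]; case: (ord_submod 2) => _ oD _; apply: oD; last exact: IH.
    exact: lin_ord.
  suff z0 : z = 0 by rewrite E z0 linear0 add0r.
  apply/rowP => j; rewrite mxE -mcoeff_linU.
  have := q2 U_(j)%MM; rewrite mdeg1 E mcoeffD => /(_ isT).
  by rewrite b2 ?mdeg1 // addr0.
elim: W q hq {q2} => [|w W IH] q /=.
  by move=> ->; exists 0; exists 0; rewrite // linear0 addr0.
move=> [a _ [b /IH[z [c hc ->]] ->]].
exists (a@_0%MM *: w + z); exists (lin w * (a - (a@_0)%:MP) + c).
  exists (a - (a@_0)%:MP); last by exists c.
  move=> u; rewrite ltnS leqn0 mdeg_eq0 => /eqP ->.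
  by rewrite mcoeffB mcoeffC eqxx mulr1 subrr.
rewrite linearD linearZ /= mulrBr -[_ *: a]/(_ * _) -mul_mpolyC [_%:MP * _]mulrC.
by rewrite [RHS]addrACA [X in _ = X + _]addrC subrK.
Qed.

Lemma ord_span W n : <<W>>%VS = fullv ->
  ord_ge n.+1 `<=` isum (map lin W) (ord_ge n : set T^o).
Proof.
move=> hW q hq; have sO := ord_submod n.
have sI := isum_submod (map lin W) sO; rewrite [q]mpolyE big_seq.
apply: (@submod_sum _ T^o) => // u us; rewrite -mul_mpolyC.
have [_ _ IZ] := sI; apply: IZ.
have nu : (n < mdeg u)%N.
  by rewrite ltnNge; apply/negP => h; move: us; rewrite mcoeff_msupp hq ?eqxx.
have [j uj] : exists j, (0 < u j)%N.
  apply: contrapT => h; move: nu; suff -> : u = 0%MM by rewrite mdeg0.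
  apply/mnmP => j; rewrite mnm0E; case E: (u j) => [//|i].
  by case: h; exists j; rewrite E.
have Eu : u = (U_(j) + (u - U_(j)))%MM.
  apply/mnmP => i; rewrite mnmDE mnmBE mnm1E; case: (eqVneq j i) => [<-|_].
    by rewrite subnKC.
  by rewrite subn0.
rewrite Eu mpolyXD -lin_delta; apply: (@lin_span T^o) => //; first by rewrite hW memvf.
move=> w wn; rewrite mcoeffX; case: eqP => // Ew.
by move: nu; rewrite Eu mdegD mdeg1 Ew add1n ltnS leqNgt wn.
Qed.

Lemma isum_row r (xs : seq T) (A : set T) (f : 'rV[T]_r) :
  isum xs [set g : 'rV[T]_r | forall j, A (g 0 j)] f <->
  forall j, isum xs (A : set T^o) (f 0 j).
Proof.
elim: xs f => [|x xs IH] f /=.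
  split=> [-> j|h]; first by rewrite mxE.
  by apply/rowP => j; rewrite h mxE.
split=> [[a ha [b /IH hb ->]] j|h].
  by exists (a 0 j) => //; exists (b 0 j); rewrite // !mxE.
have /choice[a ha] : forall j, exists a : T, A a /\ isum xs (A : set T^o) (f 0 j - x * a).
  move=> j; have [a Aa [b hb E]] := h j; exists a; split=> //.
  by rewrite E [_ + b]addrC -[x *: a]/(x * a) addrK.
exists (\row_j a j) => [j|]; first by rewrite mxE; exact: (ha j).1.
exists (f - x *: \row_j a j); last by rewrite addrC subrK.
by apply/IH => j; rewrite !mxE; exact: (ha j).2.
Qed.

Lemma isum_rowT r (xs : seq T) (f : 'rV[T]_r) :
  isum xs setT f <-> forall j, isum xs (setT : set T^o) (f 0 j).
Proof.
rewrite -isum_row; suff -> : [set g : 'rV[T]_r | forall j, [set: T] (g 0 j)] = setT by [].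
by apply/seteqP; split.
Qed.

End Forms.

(** * Linear syzygies *)

Section Syzygies.
Variables (k : fieldType) (N : nat).
Local Notation T := {mpoly k[N]}.
Local Notation hom := (pihomog (@mdeg N)).
Variable t : seq 'rV[k]_N.
Hypothesis free_t : free t.
Hypothesis span_t : <<t>>%VS = fullv.

Definition ord_row r n : set 'rV[T]_r := [set f | forall j, ord_ge n (f 0 j)].

Lemma ord_row_submod r n : submod (@ord_row r n).
Proof.
have [o0 oD oZ] := ord_submod k N n; split=> [j|f g hf hg j|a f hf j]; rewrite mxE //.
  exact: oD.
exact: oZ.
Qed.

(* S is the module of relations of a graded module F / S generated in degree 0,
   where F = T^r: the forms of the list, last form first, act on F / S like a
   regular sequence in positive degrees. *)
Fixpoint relations_good r (S : set 'rV[T]_r) (W : seq 'rV[k]_N) : Prop :=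
  if W is v :: W' then relations_good S W' /\
    forall f : 'rV[T]_r, ord_row 1 f ->
      (exists2 a, isum (map (@lin k N) W') setT a & S (lin v *: f - a)) ->
      (exists2 a, isum (map (@lin k N) W') setT a & S (f - a))
  else True.

(** The invariant of the iteration. Positive order means that the generators of F are minimal for F
    / S; goodness is required for a whole basis t of linear forms. *)
Record linear_relations r (S : set 'rV[T]_r) : Prop := {
  lr_submod : submod S;
  lr_homog : forall f d, S f -> S (map_mx (hom d) f);
  lr_ord : S `<=` @ord_row r 1;
  lr_good : relations_good S t }.

(** The relation is corrected one form at a time: goodness replaces the coefficient a of v by a - a'
    in S, and va', with a' in (W)F, is absorbed by the remaining forms with coefficients of positive
    order. *)
Lemma relations_isum r (S : set 'rV[T]_r) W : submod S -> relations_good S W ->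
  S `&` isum (map (@lin k N) W) (@ord_row r 1) `<=` isum (map (@lin k N) W) S.
Proof.
move=> sS; elim: W => [_ f [_ ->] //|v W IH] /= [gW hv] f [Sf [a ha [b hb Ef]]].
have sT := isum_submod (map (@lin k N) W) (setT_submod 'rV[T]_r); have [_ TD TZ] := sT.
have [a' ha' Sa] : exists2 a', isum (map (@lin k N) W) setT a' & S (a - a').
  apply: (hv a ha); exists (- b).
    by rewrite -scaleN1r; apply: TZ; apply: isum_mono hb.
  by rewrite opprK -Ef.
exists (a - a') => //; exists (f - lin v *: (a - a')); last by rewrite addrC subrK.
have sI := isum_submod (map (@lin k N) W) (ord_row_submod r 1).
apply: (IH gW); split.
  by apply: submodB => //; case: sS => _ _; apply.
rewrite Ef scalerBr opprB addrC addrA subrK.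
have [_ ID _] := sI; apply: ID => //.
by apply: isum_scale ha' => g _ j; rewrite mxE; apply: lin_ord => u.
Qed.

(** Rows of linear forms are encoded by coefficient matrices, which makes the degree 1 part of T^r a
    finite-dimensional k-space. *)
Definition linrow r (A : 'M[k]_(r, N)) : 'rV[T]_r := \row_j lin (row j A).

Lemma linrow_is_linear r (a : k) (A B : 'M[k]_(r, N)) :
  linrow (a *: A + B) = a%:MP *: linrow A + linrow B.
Proof.
by apply/rowP => j; rewrite !mxE linearP /= linearP /= mul_mpolyC.
Qed.

Lemma linrow0 r : linrow (0 : 'M[k]_(r, N)) = 0.
Proof.
by apply/rowP => j; rewrite !mxE (_ : row j 0 = 0) ?linear0.
Qed.

Lemma linrow_sum r n (c : 'I_n -> k) (A : 'I_n -> 'M[k]_(r, N)) :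
  linrow (\sum_i c i *: A i) = \sum_i (c i)%:MP *: linrow (A i).
Proof.
apply: (big_rec2 (fun x y => linrow x = y)) => [|i y x _ <-]; first exact: linrow0.
by rewrite linrow_is_linear.
Qed.

Lemma linrow_eq0 r (A : 'M[k]_(r, N)) : linrow A = 0 -> A = 0.
Proof.
move=> /rowP h; apply/row_matrixP => j; have := h j; rewrite !mxE => /lin_eq0 ->.
by apply/rowP => l; rewrite !mxE.
Qed.

Lemma hom1_linrow r (f : 'rV[T]_r) : map_mx (hom 1%N) f = f ->
  f = linrow (\matrix_(i, j) (f 0 i)@_U_(j)).
Proof.
move=> /rowP hf; apply/rowP => j; apply/mpolyP => u; rewrite mxE.
have := hf j; rewrite mxE => <-; rewrite mcoeff_hom.
case: eqP => [/eqP/mdeg1P[i /eqP ->]|/eqP h1]; last by rewrite mcoeff_lin.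
by rewrite mcoeff_linU !mxE.
Qed.

Lemma hom_mulmx r n d (w : 'rV[T]_n) (e : 'I_n -> 'M[k]_(r, N)) :
  map_mx (hom d.+1) (w *m \matrix_i linrow (e i)) =
  map_mx (hom d) w *m \matrix_i linrow (e i).
Proof.
apply/rowP => j; rewrite !mxE linear_sum; apply: eq_bigr => i _.
by rewrite !mxE /= mulrC hom_lin_mul mulrC.
Qed.

Lemma hom0E (q : T) : hom 0%N q = (q@_0%MM)%:MP.
Proof.
apply/mpolyP => u; rewrite mcoeff_hom mcoeffC mdeg_eq0.
by case: (eqVneq u 0%MM) => [->|u0]; rewrite ?eqxx ?mulr1 // mulr0.
Qed.

Lemma matrix_kfree r n (e : 'I_n -> 'M[k]_(r, N)) : kfree e -> (n <= r * N)%N.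
Proof.
apply: (@kfree_leq _ _ _ _ (fun i : 'I_(r * N) => vec_mx (delta_mx 0 i))) => j.
exists (fun i => mxvec (e j) 0 i); rewrite -[LHS]mxvecK {1}(row_sum_delta (mxvec (e j))).
by rewrite linear_sum; apply: eq_bigr => i _; rewrite linearZ.
Qed.

Lemma isum_hom r (S : set 'rV[T]_r) W d f : (forall f d, S f -> S (map_mx (hom d) f)) ->
  isum (map (@lin k N) W) S f ->
  isum (map (@lin k N) W) [set g | S g /\ map_mx (hom d) g = g] (map_mx (hom d.+1) f).
Proof.
move=> hS; elim: W f => [|v W IH] f /=.
  by move=> ->; apply/rowP => j; rewrite !mxE linear0.
move=> [a Sa [b hb ->]]; exists (map_mx (hom d) a).
  by split; [exact: hS | apply/rowP => j; rewrite !mxE pihomog_id].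
exists (map_mx (hom d.+1) b); first exact: IH.
by apply/rowP => j; rewrite !mxE linearD /= hom_lin_mul.
Qed.

(** A relation of degree at least 2 lies in (t)F_{>=1}, as t spans all linear forms, hence in (t)S
    by [relations_isum]. Its coefficients can be taken homogeneous of one degree less, and induction
    reaches degree 1. *)
Lemma relations_generated r (S : set 'rV[T]_r) n (e : 'I_n -> 'M[k]_(r, N)) :
  linear_relations S -> kbasis [set A | S (linrow A)] e ->
  forall f, S f <-> exists w, f = w *m \matrix_i linrow (e i).
Proof.
move=> hS [Se he]; have sS := lr_submod hS; have [S0 SD SZ] := sS.
have mulE (w : 'rV[T]_n) : w *m \matrix_i linrow (e i) = \sum_i w 0 i *: linrow (e i).
  by rewrite mulmx_sum_row; apply: eq_bigr => i _; rewrite rowK.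
pose Im : set 'rV[T]_r := [set f | exists w, f = w *m \matrix_i linrow (e i)].
have sIm : submod Im.
  split; first by exists 0; rewrite mul0mx.
    by move=> _ _ [v ->] [w ->]; exists (v + w); rewrite mulmxDl.
  by move=> a _ [v ->]; exists (a *: v); rewrite scalemxAl.
move=> f; split; last first.
  move=> [w ->]; rewrite mulE; apply: (@submod_sum _ _ S _ _ predT (fun i => w 0 i *: linrow (e i)) sS) => i _.
  by apply: SZ; exact: Se.
have key d g : S g -> map_mx (hom d) g = g -> Im g.
  elim: d g => [|d IH] g Sg Eg.
    suff -> : g = 0 by case: sIm.
    apply/rowP => j; rewrite -Eg !mxE hom0E (lr_ord hS Sg) ?mdeg0 //.
  case: d IH Eg => [|d] IH Eg.
    have Eg' := hom1_linrow Eg; have [c [Ec _]] := he _ (eq_ind _ S Sg _ Eg').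
    exists (\row_i (c i)%:MP); rewrite Eg' Ec linrow_sum mulE.
    by apply: eq_bigr => i _; rewrite mxE.
  have g2 : @ord_row r 2 g.
    move=> j u u2; have /rowP/(_ j) := Eg; rewrite mxE => <-; rewrite mcoeff_hom.
    by case: eqP => // Eu; rewrite Eu in u2.
  have : isum (map (@lin k N) t) S g.
    apply: (relations_isum sS (lr_good hS)); split=> //.
    by apply/isum_row => j; apply: ord_span => //; exact: g2.
  move=> /(isum_hom d.+1 (lr_homog hS)); rewrite Eg; apply: (isum_sub sIm).
  by move=> x a _ [Sa Ea]; case: sIm => _ _ ImZ; apply: ImZ; exact: (IH a).
move=> Sf; pose B := \max_(j < r) msize (f 0%R j).
have -> : f = \sum_(d < B) map_mx (hom d) f.
  apply/rowP => j; rewrite summxE {1}(pihomog_partitionE (mf := @mdeg N) (p := f 0 j) (k := B)).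
    by apply: eq_bigr => d _; rewrite mxE.
  exact: leq_bigmax.
apply: (@submod_sum _ _ Im _ _ predT (fun d : 'I_B => map_mx (hom d) f) sIm) => d _.
apply: (key d); first exact: (lr_homog hS).
by apply/rowP => j; rewrite !mxE pihomog_id.
Qed.

Lemma syzygy_step r (S : set 'rV[T]_r) : linear_relations S ->
  exists n (D : 'M[T]_(n, r)),
  [/\ forall i j u, u \in msupp (D i j) -> mdeg u = 1%N,
      forall f, S f <-> exists w, f = w *m D
    & linear_relations [set w | w *m D = 0]].
Proof.
move=> hS; have sS := lr_submod hS; have [S0 SD SZ] := sS.
have [||||n [e he]] := @exists_kbasis _ _ [set A : 'M[k]_(r, N) | S (linrow A)] (r * N).
- by rewrite /= linrow0.
- by move=> A B /= SA SB; rewrite -[A]scale1r linrow_is_linear; apply: SD => //; exact: SZ.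
- move=> a A /= SA; rewrite -[a *: A]addr0 linrow_is_linear; apply: SD; first exact: SZ.
  by rewrite linrow0.
- by move=> n e _; exact: matrix_kfree.
have gen := relations_generated hS he.
pose D := \matrix_i linrow (e i); exists n, D; split=> //.
  move=> i j u; rewrite !mxE mcoeff_msupp; apply: contraNeq => h.
  by rewrite mcoeff_lin.
have DS w : S (w *m D) by apply/gen; exists w.
have Dord m (w : 'rV[T]_n) : ord_row m w -> ord_row m.+1 (w *m D).
  have [_ oD _] := ord_submod k N m.+1.
  move=> hw j; rewrite mxE; apply: (@submod_sum _ T^o _ _ _ predT _ (ord_submod k N m.+1)) => i _.
  by rewrite !mxE mulrC; apply: lin_ord.
have hsum (c : 'I_n -> k) : S (linrow (\sum_i c i *: e i)).
  rewrite linrow_sum; apply: (@submod_sum _ _ S _ _ predT (fun i => (c i)%:MP *: linrow (e i)) sS) => i _.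
  by apply: SZ; exact: he.1.
have [_ efree _] := (kbasisP (S := [set A | S (linrow A)]) hsum).1 he.
split.
- split=> /= [|v w hv hw|a w hw]; first by rewrite mul0mx.
    by rewrite mulmxDl hv hw addr0.
  by rewrite -scalemxAl hw scaler0.
- move=> w d /= hw; rewrite -hom_mulmx hw; apply/rowP => j.
  by rewrite !mxE linear0.
- move=> w /= hw j u; rewrite ltnS leqn0 mdeg_eq0 => /eqP ->.
  (* The degree 1 part of wD = 0 is a k-linear relation between the basis elements e j whose
     coefficients are the constant terms of w. *)
  move: j; apply: (efree (fun j => (w 0 j)@_0%MM)); apply: linrow_eq0; rewrite linrow_sum.
  have := hom_mulmx 0%N w e; rewrite hw mulmx_sum_row => /esym.
  rewrite (_ : map_mx (hom 1%N) 0 = 0); last by apply/rowP => j; rewrite !mxE linear0.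
  by move=> E; rewrite -[RHS]E; apply: eq_bigr => i _; rewrite rowK mxE hom0E.
have := lr_good hS; have := free_t; elim: t => [//|v W IH] /=.
rewrite free_cons => /andP[vW fW] [gW hv]; split; first exact: IH.
move=> f f1 [a ha /=]; rewrite mulmxBl => /eqP; rewrite subr_eq0 => /eqP E.
have hD (b : 'rV[T]_n) : isum (map (@lin k N) W) setT b -> isum (map (@lin k N) W) S (b *m D).
  elim: W {IH vW fW gW hv ha} b => [|w W IH] b /=; first by move=> ->; rewrite mul0mx.
  move=> [c _ [d hd ->]]; exists (c *m D) => //; exists (d *m D); first exact: IH.
  by rewrite mulmxDl scalemxAl.
(* The claim is moved from f to fD in the old free module F. As v is independent of W, fD lies in
   (W)F; having order at least 2, it lies in (W)F_{>=1}, so in (W)S by goodness of S. Generators of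
   S being the rows of D, this lifts back. *)
have h1 : isum (map (@lin k N) W) setT (f *m D).
  apply/isum_rowT => j; apply: (lin_regular vW).
  have : isum (map (@lin k N) W) setT (lin v *: (f *m D)).
    by rewrite scalemxAl E; apply: isum_mono (hD _ ha).
  by move=> /isum_rowT/(_ j); rewrite mxE.
have h2 : isum (map (@lin k N) W) (@ord_row r 1) (f *m D).
  apply/isum_row => j; apply: isum_ord1; last exact: (Dord 1%N).
  by move: j; apply/isum_rowT.
have : isum (map (@lin k N) W) S (f *m D) by apply: (relations_isum sS gW).
have lift g : isum (map (@lin k N) W) S g ->
    exists2 b : 'rV[T]_n, isum (map (@lin k N) W) setT b & g = b *m D.
  elim: W {IH vW fW gW hv ha E hD h1 h2} g => [|w W IH] g /=.
    by move=> ->; exists 0; rewrite // mul0mx.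
  move=> [c /gen[c' ->] [d /IH[d' hd' ->] ->]]; exists (lin w *: c' + d').
    by exists c' => //; exists d'.
  by rewrite mulmxDl scalemxAl.
by move=> /lift[b hb Eb]; exists b => //=; rewrite mulmxBl Eb subrr.
Qed.

End Syzygies.

Section Resolution.
Variables (k : fieldType) (N : nat).
Local Notation T := {mpoly k[N]}.
Variable t : seq 'rV[k]_N.
Hypothesis free_t : free t.
Hypothesis span_t : <<t>>%VS = fullv.

(** Iterates [syzygy_step]; a stage packs the rank with its relations, since the ambient free module
    changes at each step. *)
Lemma linear_resolution_of_relations (G : lmodType T) (Gd : nat -> set G) r (a : 'I_r -> G) :
  (forall j, Gd 0%N (a j)) -> (forall g, exists v : 'rV[T]_r, g = \sum_j v 0 j *: a j) ->
  linear_relations t [set v : 'rV[T]_r | \sum_j v 0 j *: a j = 0] ->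
  linear_resolution Gd.
Proof.
move=> Ga onto hS.
pose stage := {r : nat & {S : set 'rV[T]_r | linear_relations t S}}.
pose rk (s : stage) := projT1 s; pose rel (s : stage) : set 'rV[T]_(rk s) := sval (projT2 s).
have step (s : stage) : exists s' : stage, exists D : 'M[T]_(rk s', rk s),
    [/\ forall i j u, u \in msupp (D i j) -> mdeg u = 1%N,
        forall f, rel s f <-> exists w, f = w *m D
      & forall w, rel s' w <-> w *m D = 0].
  have [n [D [h1 h2 h3]]] := syzygy_step free_t span_t (svalP (projT2 s)).
  by exists (existT _ n (exist _ _ h3)), D; split.
pose nxt s := sval (cid (step s)).
pose D s : 'M[T]_(rk (nxt s), rk s) := sval (cid (svalP (cid (step s)))).
have hD s := svalP (cid (svalP (cid (step s)))).
pose st := fix st n := if n is n'.+1 then nxt (st n') else existT _ r (exist _ _ hS) : stage.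
pose F : free_complex G := @FreeComplex k N G (fun n => rk (st n)) (fun n _ => n)
  (fun n => D (st n)) a.
exists F; split=> //; split=> //=.
- by move=> i j l u hu; case: (hD (st i)) => h _ _; rewrite (h _ _ _ hu).
- by move=> v; case: (hD (st 0%N)) => _ h _; exact: (h v).
- move=> i v; case: (hD (st i)) => _ _ h; case: (hD (st i.+1)) => _ h' _.
  by rewrite -(h v) -(h' v).
- move=> i j l; apply/eqP; rewrite mcoeff_eq0; apply/negP => hu.
  by case: (hD (st i)) => /(_ _ _ _ hu); rewrite mdeg0.
Qed.

End Resolution.

(** * The associated graded module *)

Section GradedModule.
Variables (R : comNzRingType) (k : fieldType) (p : residue_map R k).
Variables (N : nat) (y : 'I_N -> subm (kerI p)) (M : lmodType R).
Local Notation m := (kerI p).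
Local Notation T := {mpoly k[N]}.
Local Notation hom := (pihomog (@mdeg N)).
Local Notation G := (gr y M).
Local Notation grM := (grspace p M).

Lemma dsum_compD (f g : G) n : dcomp (f + g) n = dcomp f n + dcomp g n.
Proof. by []. Qed.

Lemma dsum_comp_sum (I : Type) (s : seq I) (P : pred I) (F : I -> G) n :
  dcomp (\sum_(i <- s | P i) F i) n = \sum_(i <- s | P i) dcomp (F i) n.
Proof. by apply: (big_morph (fun f : G => dcomp f n)). Qed.

Lemma monactU j (f : grM) : monact (fun i => @grop R k p M (y i)) U_(j)%MM f = grop (y j) f.
Proof.
rewrite /monact; have : j \in enum 'I_N by rewrite mem_enum.
have := enum_uniq 'I_N; elim: (enum 'I_N) => [//|i s IH] /= /andP[is_ us].
have nj (s' : seq 'I_N) : j \notin s' ->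
    foldr (fun i => iter (U_(j)%MM i) (@grop R k p M (y i))) f s' = f.
  elim: s' => [//|l s' IHs] /=; rewrite inE negb_or mnm1E => /andP[/negPf -> /IHs ->] //.
rewrite inE mnm1E; case: (eqVneq j i) => [ji _|_ /= js]; last exact: IH.
by rewrite /= -ji nj // ji.
Qed.

Lemma lin_act v (f : G) : lin v *: f = \sum_j v 0 j *: (grop (y j) f : grM) :> grM.
Proof.
rewrite /lin -[LHS]/(polyact (fun i => @grop R k p M (y i)) (\sum_j v 0 j *: 'X_j) f).
rewrite polyact_suml; apply: eq_bigr => j _.
by rewrite polyactX monactU.
Qed.

Lemma constant_act c (f : G) : c%:MP *: f = c *: (f : grM) :> grM.
Proof.
rewrite -[LHS]/(polyact (fun i => @grop R k p M (y i)) c%:MP f).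
by rewrite -[c%:MP]mulr1 mul_mpolyC -mpolyX0 polyactX monact0.
Qed.

Lemma monact_homog u e (f : grM) : dsum_homog (V := grpiece p M) e f ->
  dsum_homog (V := grpiece p M) (e + mdeg u)%N (monact (fun i => @grop R k p M (y i)) u f).
Proof.
move=> hf; rewrite /monact mdegE -big_enum /=; elim: (enum _) => [|i s IH] /=.
  by rewrite big_nil addn0.
rewrite big_cons addnCA addnC; elim: (u i) => [|n IHn]; first by rewrite addn0.
rewrite addnS => -[//|l] hl /=; rewrite IHn ?grmul0 //.
by move=> E; apply: hl; rewrite E.
Qed.

Lemma hom_act d q (f : G) i : gr_homog 0 f ->
  dcomp (hom d q *: f) i = if i == d then dcomp (q *: f) i else 0.
Proof.
move=> hf; pose Y i := @grop R k p M (y i).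
have h q' : {subset msupp q' <= msupp q} ->
    dcomp (q' *: f) i = \sum_(u <- msupp q | mdeg u == i) q'@_u *: dcomp (monact Y u f) i.
  move=> hs; rewrite -[q' *: f]/(polyact Y q' f) (polyactE _ _ (msupp_uniq q) hs).
  rewrite (dsum_comp_sum _ predT) [RHS]big_mkcond; apply: eq_bigr => u _ /=.
  case: eqP => // ui; rewrite (monact_homog hf) ?scaler0 //.
  by rewrite add0n => E; apply: ui.
rewrite !h //; last first.
  move=> u; rewrite !mcoeff_msupp mcoeff_hom; case: ifP => // _; by rewrite eqxx.
case: ifP => id.
  by apply: eq_bigr => u /eqP ui; rewrite mcoeff_hom ui id.
by apply: big1 => u /eqP ui; rewrite mcoeff_hom ui id scale0r.
Qed.

End GradedModule.

Section Classes.
Variables (R : comNzRingType) (k : fieldType) (p : residue_map R k).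
Local Notation m := (kerI p).
Implicit Types M : lmodType R.

Lemma imul_subm M (L : submodClosed M) (x : subm L) :
  x \in imul m (full (subm L)) <-> val x \in imul m L.
Proof.
split.
  move: x; apply: mspan_ind => [|x z hx hz|a x hx|_ [a [x [am _ ->]]]].
  - exact: rpred0.
  - exact: rpredD.
  - exact: rpredZ.
  - by apply/asboolP => K; apply; exists a, (val x); split=> //; exact: valP.
move=> hx; have [x' xx' hx'] : exists2 x' : subm L, val x' = val x & x' \in imul m (full (subm L)).
  move: (val x) hx; apply: mspan_ind => [|u v [u' <- hu] [v' <- hv]|a u [u' <- hu]|_ [a [u [am uL ->]]]].
  - by exists 0; rewrite ?rpred0.
  - by exists (u' + v'); rewrite ?rpredD.
  - by exists (a *: u'); rewrite ?rpredZ.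
  - by exists ((a : R) *: (exist _ u uL : subm L)); rewrite ?mem_imul.
by rewrite -(val_inj xx').
Qed.

Lemma grcls_eq0 M n (x : subm (ipow M m n)) : fcls p x = 0 <-> val x \in ipow M m n.+1.
Proof. by rewrite fcls_eq0 imul_subm. Qed.

Lemma grcls_eq M n (x z : subm (ipow M m n)) :
  fcls p x = fcls p z <-> val x - val z \in ipow M m n.+1.
Proof.
rewrite -(grcls_eq0 (x - z)) fclsB; split=> [->|/eqP]; first by rewrite subrr.
by rewrite subr_eq0 => /eqP.
Qed.

Lemma ipow_sq_mul M n (a : R) (z : M) : (a : R^o) \in ipow R^o m 2 -> z \in ipow M m n ->
  a *: z \in ipow M m n.+2.
Proof.
move=> am zn; move: a am.
apply: (@mspan_ind R R^o _ (fun a => (a : R) *: z \in ipow M m n.+2)) =>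
  [|a b ha hb|a b hb|_ [a [b [am bm ->]]]].
- by rewrite scale0r rpred0.
- by rewrite scalerDl rpredD.
- by rewrite -[a *: b]/(a * b) -scalerA rpredZ.
rewrite -[_ *: b]/(_ * b) -scalerA; apply: mem_ipowS; first exact/eqP.
move: b bm; apply: (@mspan_ind R R^o _ (fun b => (b : R) *: z \in ipow M m n.+1)) =>
  [|b c hb hc|b c hc|_ [b [c [bm _ ->]]]].
- by rewrite scale0r rpred0.
- by rewrite scalerDl rpredD.
- by rewrite -[b *: c]/(b * c) -scalerA rpredZ.
rewrite -[_ *: c]/(_ * c) mulrC -scalerA rpredZ //.
by apply: mem_ipowS zn; exact/eqP.
Qed.

Variables (N : nat) (y : 'I_N -> subm m).
Local Notation T := {mpoly k[N]}.
Local Notation hom := (pihomog (@mdeg N)).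

Lemma hom1E (q : T) : hom 1%N q = lin (\row_j q@_U_(j)).
Proof.
apply/mpolyP => u; rewrite mcoeff_hom.
case: eqP => [/eqP/mdeg1P[i /eqP ->]|/eqP h1]; last by rewrite mcoeff_lin.
by rewrite mcoeff_linU mxE.
Qed.

(** The class of a, placed in degree 1 of gr_m(R), is q times the unit; the linear part of q gives
    v. *)
Lemma presented_mod_sq : gr_presented y -> forall a : R, p a = 0 ->
  exists v : 'rV[k]_N, (a - \sum_j res_lift p (v 0 j) * val (y j) : R^o) \in ipow R^o m 2.
Proof.
move=> hy a pa.
have a1 : (a : R^o) \in ipow R^o m 1.
  apply/asboolP => K; apply; exists a, 1.
  by split; rewrite ?mem_kerI ?pa // -[_ *: _]/(_ * _) mulr1.
pose a' : subm (ipow R^o m 1) := exist (fun x => x \in ipow R^o m 1) (a : R^o) a1.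
pose fa i : grpiece p R^o i := if i is 1%N then fcls p a' else 0.
have fin : exists n, forall i, (n <= i)%N -> fa i = 0 by exists 2%N => -[|[]].
have [q Eq] := hy (DSum fin); pose g := gr1 y.
have hg : gr_homog 0 g by case.
have := hom_act 1 q 1 hg; rewrite eqxx -Eq hom1E lin_act.
rewrite (dsum_comp_sum (y := y) _ predT) /= => E.
exists (\row_j q@_U_(j)).
pose s : subm (ipow R^o m 1) := \sum_j res_lift p ((\row_j q@_U_(j)) 0 j) *:
  grmulr (y j) (exist _ (1 : R^o) isT : subm (ipow R^o m 0)).
have Es : val s = \sum_j res_lift p ((\row_j q@_U_(j)) 0 j) * val (y j).
  rewrite val_lincomb; apply: eq_bigr => j _.
  by rewrite -[LHS]/(_ * (_ * 1)) mulr1.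
have := (grcls_eq a' s).1; rewrite Es.
apply; rewrite -E fcls_sum; apply: eq_bigr => j _.
by rewrite fclsZ res_liftK grmulE.
Qed.

(** x agrees with a combination of the y_j modulo m^2, and m^2 sends m^iM into m^{i+2}M, hence to
    zero in degree i + 1. *)
Lemma form_of_scalar : gr_presented y -> forall (M : lmodType R) (x : subm m),
  exists v, forall f : gr y M, lin v *: f = (grop x f : grspace p M) :> grspace p M.
Proof.
move=> hy M x; have [|v hv] := presented_mod_sq hy (a := val x); first exact/eqP/(valP x).
exists v => f; rewrite lin_act; apply: dsum_eq => -[|i].
  by rewrite (dsum_comp_sum (y := y) _ predT) /= big1 // => j _; rewrite scaler0.
rewrite (dsum_comp_sum (y := y) _ predT) /=.
have [z Ez] := fcls_surj (dcomp f i).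
transitivity (fcls p (\sum_j res_lift p (v 0 j) *: grmulr (y j) z)).
  rewrite fcls_sum; apply: eq_bigr => j _.
  by rewrite fclsZ res_liftK Ez grmulE.
rewrite Ez grmulE; set u := (X in fcls p X = _); set w := (X in _ = fcls p X).
apply: (@grcls_eq M i.+1 u w).2; rewrite /u /w val_lincomb /=.
under eq_bigr do rewrite scalerA.
rewrite -scaler_suml -scalerBl -opprB scaleNr rpredN.
by apply: ipow_sq_mul => //; exact: valP.
Qed.

End Classes.

Definition subm_elt (R : comNzRingType) (M : lmodType R) (L : submodClosed M) x
  (h : x \in L) : subm L := exist (fun x => x \in L) x h.

(** * Initial forms on the associated graded module *)

Section GrGood.
Variables (R : comNzRingType) (k : fieldType) (p : residue_map R k).
Variables (N : nat) (y : 'I_N -> subm (kerI p)) (M : lmodType R).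
Local Notation m := (kerI p).
Local Notation T := {mpoly k[N]}.
Local Notation hom := (pihomog (@mdeg N)).
Local Notation G := (gr y M).
Local Notation grM := (grspace p M).
Local Notation "''m^' n" := [set z : M | z \in ipow M m n] (at level 8, n at level 2).
Variable form : R -> 'rV[k]_N.
Hypothesis formE : forall (x : subm m) (f : G),
  lin (form (val x)) *: f = (grop x f : grM) :> grM.

Definition gr_below n : set G := [set f | forall i, (n <= i)%N -> dcomp f i = 0].

Lemma gr_below_ex (f : G) : exists n, gr_below n f.
Proof. by have [n hn] := dcomp_fin f; exists n. Qed.

Lemma form_act0 x (f : G) : p x = 0 -> dcomp (lin (form x) *: f) 0 = 0.
Proof.
move=> px; have xm : (x : R^o) \in m by rewrite mem_kerI px.
by have -> := formE (subm_elt xm) f.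
Qed.

Lemma form_actS x (f : G) n (z : subm (ipow M m n)) (w : subm (ipow M m n.+1)) :
  p x = 0 -> dcomp f n = fcls p z -> val w = x *: val z ->
  dcomp (lin (form x) *: f) n.+1 = fcls p w.
Proof.
move=> px Ez Ew; have xm : (x : R^o) \in m by rewrite mem_kerI px.
have -> := formE (subm_elt xm) f; rewrite /= Ez grmulE.
by congr fcls; apply: val_inj.
Qed.

Lemma isum_ipowS xs n : (forall x, x \in xs -> p x = 0) -> isum xs 'm^n `<=` 'm^(n.+1).
Proof.
move=> hx; apply: isum_sub; first exact: submodClosed_submod.
by move=> x a /hx px; exact: mem_ipowS.
Qed.

(** Membership of g in the submodule generated by the initial forms of xs, tested degree by degree
    on representatives in M. *)
Definition gr_comb xs (g : G) : Prop := dcomp g 0 = 0 /\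
  forall n, exists2 z : subm (ipow M m n.+1), isum xs 'm^n (val z) & dcomp g n.+1 = fcls p z.

Lemma isum_gr_comb xs (g : G) : (forall x, x \in xs -> p x = 0) ->
  isum (map (@lin k N) (map form xs)) setT g -> gr_comb xs g.
Proof.
elim: xs g => [|x xs IH] g hx /=.
  by move=> ->; split=> // n; exists 0; rewrite ?fcls0.
have px := hx x (mem_head _ _).
have hx' z : z \in xs -> p z = 0 by move=> zs; apply: hx; rewrite inE zs orbT.
move=> [a _ [b /(IH _ hx')[b0 hb] ->]].
split=> [|n]; first by rewrite dsum_compD form_act0 // b0 addr0.
have [u hu Eb] := hb n; have [w Ew] := fcls_surj (dcomp a n).
have xw : x *: val w \in ipow M m n.+1 by apply: mem_ipowS => //; exact: (valP w).
exists (subm_elt xw + u).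
  by exists (val w); [exact: (valP w) | exists (val u)].
rewrite dsum_compD Eb fclsD; congr (_ + _).
exact: form_actS Ew _.
Qed.

Lemma gr_comb_isum xs n (g : G) : (forall x, x \in xs -> p x = 0) ->
  gr_below n.+1 g -> gr_comb xs g ->
  isum (map (@lin k N) (map form xs)) (gr_below n) g.
Proof.
elim: xs g => [|x xs IH] g hx gn [g0 hg] /=.
  by apply: dsum_eq => -[//|i]; have [z z0 ->] := hg i;
    have -> : z = 0 by [apply: val_inj]; rewrite fcls0.
have px := hx x (mem_head _ _).
have hx' z : z \in xs -> p z = 0 by move=> zs; apply: hx; rewrite inE zs orbT.
(* Coefficients are chosen degree by degree; choosing 0 where g vanishes keeps their support finite
   and one degree below that of g. *)
have exw : forall i, exists w : subm (ipow M m i),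
    (dcomp g i.+1 = 0 -> fcls p w = 0) /\
    exists2 u : subm (ipow M m i.+1), isum xs 'm^i (val u) &
      forall v : subm (ipow M m i.+1), val v = x *: val w ->
      dcomp g i.+1 = fcls p v + fcls p u.
  move=> i; have [gi0|gi] := pselect (dcomp g i.+1 = 0).
    exists 0; split; first by rewrite fcls0.
    exists 0; first by case: (isum_submod xs (submodClosed_submod (ipow M m i))).
    move=> v; rewrite gi0 scaler0 => v0.
    have -> : v = 0 by apply: val_inj.
    by rewrite !fcls0 addr0.
  have [z [a am [b hb Ez]] E] := hg i; exists (subm_elt am); split=> //.
  exists (subm_elt (isum_ipowS hx' hb)) => // v Ev; rewrite E -fclsD; congr fcls.
  by apply: val_inj; rewrite Ez /= Ev.
pose w i := sval (cid (exw i)); have hw i := svalP (cid (exw i)).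
have fin : exists n, forall i, (n <= i)%N -> fcls p (w i) = 0 :> grpiece p M i.
  by exists n => i ni; apply: (hw i).1; exact: gn.
pose a : G := DSum fin; have an : gr_below n a by move=> i ni; apply: (hw i).1; exact: gn.
exists a => //; exists (g - lin (form x) *: a); last by rewrite addrC subrK.
have xw i : x *: val (w i) \in ipow M m i.+1 by apply: mem_ipowS => //; exact: (valP (w i)).
have aE i : dcomp (lin (form x) *: a) i.+1 =
    fcls p (subm_elt (xw i)) by apply: (@form_actS x a i (w i)).
have bE i : exists2 u : subm (ipow M m i.+1), isum xs 'm^i (val u) &
    dcomp (g - lin (form x) *: a) i.+1 = fcls p u.
  have [_ [u hu E]] := hw i; exists u => //.
  have -> : dcomp (g - lin (form x) *: a) i.+1 =
    dcomp g i.+1 - dcomp (lin (form x) *: a) i.+1 by [].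
  by rewrite aE (E (subm_elt (xw i))) // addrC addKr.
apply: IH => //; last first.
  split=> //; have -> : dcomp (g - lin (form x) *: a) 0 =
    dcomp g 0 - dcomp (lin (form x) *: a) 0 by [].
  by rewrite g0 form_act0 // subr0.
move=> [//|i] ni; have -> : dcomp (g - lin (form x) *: a) i.+1 =
    dcomp g i.+1 - dcomp (lin (form x) *: a) i.+1 by [].
rewrite gn // aE sub0r; have [w0 _] := hw i; have := w0 (gn _ ni).
move/grcls_eq0 => wi; apply/eqP; rewrite oppr_eq0; apply/eqP.
by apply: (@grcls_eq0 _ _ _ _ _ _).2; apply: mem_ipowS.
Qed.

Lemma gr_comb_isumT xs (g : G) : (forall x, x \in xs -> p x = 0) -> gr_comb xs g ->
  isum (map (@lin k N) (map form xs)) setT g.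
Proof.
move=> hx hg; have [n gn] := gr_below_ex g.
apply: (isum_mono (A := gr_below n)) => //; apply: gr_comb_isum => //.
by move=> i ni; apply: gn; exact: ltnW.
Qed.

Fixpoint forms_good (W : seq 'rV[k]_N) : Prop :=
  if W is v :: W' then forms_good W' /\ forall g : G, dcomp g 0 = 0 ->
    isum (map (@lin k N) W') setT (lin v *: g) -> isum (map (@lin k N) W') setT g
  else True.

Variable xs : seq R.
Hypothesis xs_good : good p M xs.
Hypothesis xs_complete : complete p M xs.

Lemma xs_ker x : x \in xs -> p x = 0. Proof. exact: good_ker xs_good x. Qed.

Lemma forms_good_xs : forms_good (map form xs).
Proof.
suff h pre W : pre ++ W = xs -> forms_good (map form W) by exact: (h [::]).
elim: W pre => [//|x W IH] pre E /=; split; first by apply: (IH (rcons pre x)); rewrite cat_rcons.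
have hW z : z \in W -> p z = 0 by move=> zW; apply: xs_ker; rewrite -E mem_cat inE zW !orbT.
have px : p x = 0 by apply: xs_ker; rewrite -E mem_cat mem_head orbT.
move=> g g0 /(isum_gr_comb hW) [_ hg]; apply: gr_comb_isumT => //; split=> // n.
have [w Ew] := fcls_surj (dcomp g n.+1); have [z hz Ez] := hg n.+1.
have xw : x *: val w \in ipow M m n.+2 by apply: mem_ipowS => //; exact: (valP w).
have := form_actS (w := subm_elt xw) px Ew erefl.
rewrite Ez => /grcls_eq /= h.
have gE : good p M (pre ++ x :: W) by rewrite E.
have cE : complete p M (pre ++ x :: W) by rewrite E.
have hd : x *: val w - val z \in ipow M m n.+3 by rewrite -opprB rpredN.
have Ed : x *: val w = val z + (x *: val w - val z) by rewrite addrC subrK.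
have [s hs ws] := good_gr gE cE (valP w) (isum_mono (fun _ _ => I) hz) hd Ed.
exists (subm_elt (isum_ipowS hW hs)) => //.
by rewrite Ew; apply: (@grcls_eq _ _ _ _ _ w (subm_elt (isum_ipowS hW hs))).2.
Qed.

Lemma gr_pos_comb (g : G) : dcomp g 0 = 0 -> gr_comb xs g.
Proof.
move=> g0; split=> // n; have [w Ew] := fcls_surj (dcomp g n.+1); exists w => //.
by apply: ipow_complete xs_complete _ _; exact: (valP w).
Qed.

(** Modulo the initial forms of xs nothing is left in positive degrees, so any forms may follow them
    in the sequence. *)
Lemma forms_good_cat V : forms_good (V ++ map form xs).
Proof.
elim: V => [|v V IH] /=; first exact: forms_good_xs.
split=> // g g0 _; rewrite map_cat; apply: isum_catr => //.
by apply: gr_comb_isumT; [exact: xs_ker | exact: gr_pos_comb].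
Qed.

(** Dropping a form that depends on those after it in the list keeps the span of every tail, so
    goodness survives while the family becomes free. *)
Fixpoint indep (W : seq 'rV[k]_N) : seq 'rV[k]_N :=
  if W is v :: W' then
    if v \in <<indep W'>>%VS then indep W' else v :: indep W'
  else [::].

Lemma indep_span W : <<indep W>>%VS = <<W>>%VS.
Proof.
elim: W => [//|v W IH] /=; rewrite span_cons -IH; case: ifP => h.
  by apply/esym/addv_idPr; rewrite -memvE.
by rewrite span_cons.
Qed.

Lemma indep_free W : free (indep W).
Proof.
elim: W => [|v W IH] /=; first exact: nil_free.
by case: ifP => h //; rewrite free_cons h.
Qed.

Lemma indep_good W : forms_good W -> forms_good (indep W).
Proof.
elim: W => [//|v W IH] /= [/IH gW hv]; case: ifP => // _; split=> // g g0.
have sT := setT_submod G.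
move=> /(isum_span sT (W' := W)) h; apply: (isum_span sT (W := W)).
  by move=> w wW; rewrite indep_span memv_span.
by apply: hv => //; apply: h => w wW; rewrite -indep_span memv_span.
Qed.

Hypothesis fgM : fg M.

Lemma gr_resolution : linear_resolution (@gr_homog R k p N y M).
Proof.
(* The variables stand in front of the list, that is, at the end of the sequence: they only complete
   the forms of xs to a spanning family. *)
pose t := indep ([seq delta_mx 0 j | j <- enum 'I_N] ++ map form xs).
have free_t : free t by exact: indep_free.
have span_t : <<t>>%VS = fullv.
  rewrite indep_span; apply/eqP; rewrite eqEsubv subvf /=; apply/subvP => v _.
  rewrite (row_sum_delta v); apply: memv_suml => j _; apply: memvZ; apply: memv_span.
  by rewrite mem_cat map_f // mem_enum.
have good_t : forms_good t by apply: indep_good; exact: forms_good_cat.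
have [r [e he]] : exists r (e : 'I_r -> grpiece p M 0), kbasis setT e.
  have [n [s hs]] := fgM; apply: (@exists_kbasis _ _ _ n) => // d e _ fe.
  apply: (@kfree_leq _ _ _ _ (fun i => fcls p (exist _ (s i) isT : subm (ipow M m 0))) e) => // j.
  have [x ->] := fcls_surj (e j); have [a Ea] := hs (val x); exists (fun i => p (a i)).
  transitivity (fcls p (\sum_i a i *: (exist _ (s i) isT : subm (ipow M m 0)))).
    by congr fcls; apply: val_inj; rewrite val_lincomb.
  by rewrite fcls_sum; apply: eq_bigr => i _; rewrite fclsZ.
move/kbasisTP: he => [fe se].
pose a0 j i : grpiece p M i := if i is 0 then e j else 0.
have fin j : exists n, forall i, (n <= i)%N -> a0 j i = 0 by exists 1%N => -[].
pose a j : G := DSum (fin j).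
have ha j : gr_homog 0 (a j) by case.
pose aug (v : 'rV[T]_r) : G := \sum_j v 0 j *: a j.
have aug_lin : linear aug.
  move=> c u v; rewrite /aug scaler_sumr -big_split; apply: eq_bigr => j _.
  by rewrite !mxE scalerDl scalerA.
pose augB := GRing.isLinear.Build T 'rV[T]_r G *:%R aug aug_lin.
pose augL : {linear 'rV[T]_r -> G} := HB.pack aug augB.
have aug_hom d v i : dcomp (aug (map_mx (hom d) v)) i = if i == d then dcomp (aug v) i else 0.
  rewrite /aug !(dsum_comp_sum _ predT); case: ifP => id.
    by apply: eq_bigr => j _; rewrite mxE hom_act // id.
  by rewrite big1 // => j _; rewrite mxE hom_act // id.
have aug0 v : dcomp (aug v) 0 = \sum_j (v 0 j)@_0%MM *: e j.
  have := aug_hom 0%N v 0%N; rewrite eqxx => <-.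
  rewrite /aug (dsum_comp_sum _ predT); apply: eq_bigr => j _.
  by rewrite mxE hom0E constant_act.
have onto g : exists v, aug v = g.
  (* Graded Nakayama, by induction on a degree bound: once degree 0 is matched, the rest is a
     combination of linear forms with coefficients of a smaller bound. *)
  have [n] := gr_below_ex g; elim: n g => [|n IH] g gn.
    exists 0; apply: dsum_eq => i; rewrite (gn i) //.
    by rewrite /aug (dsum_comp_sum _ predT) big1 // => j _; rewrite mxE scale0r.
  have [c Ec] := se (dcomp g 0); pose v := \row_j (c j)%:MP : 'rV[T]_r.
  have Ev : dcomp (aug v) 0 = dcomp g 0.
    by rewrite aug0 Ec; apply: eq_bigr => j _; rewrite mxE mcoeffC eqxx mulr1.
  have hv : map_mx (hom 0%N) v = v.
    by apply/rowP => j; rewrite !mxE hom0E mcoeffC eqxx mulr1.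
  have gv : gr_below n.+1 (g - aug v).
    move=> [//|i] ni; have -> : dcomp (g - aug v) i.+1 = dcomp g i.+1 - dcomp (aug v) i.+1 by [].
    by rewrite gn // -hv aug_hom subr0.
  have := gr_comb_isum xs_ker gv (gr_pos_comb _).
  have -> : dcomp (g - aug v) 0 = dcomp g 0 - dcomp (aug v) 0 by [].
  rewrite Ev subrr => /(_ erefl) h.
  suff [w Ew] : exists w, aug w = g - aug v.
    by exists (w + v); rewrite -[aug _]/(augL _) linearD /= Ew subrK.
  move: h; apply: (@isum_sub _ _ _ _ [set g' | exists w, aug w = g']).
    split; first by exists 0; rewrite -[aug _]/(augL _) linear0.
      by move=> _ _ [u <-] [w <-]; exists (u + w); rewrite -[aug _]/(augL _) linearD.
    by move=> b _ [u <-]; exists (b *: u); rewrite -[aug _]/(augL _) linearZ.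
  by move=> x b _ /IH[u <-]; exists (x *: u); rewrite -[aug _]/(augL _) linearZ.
apply: (linear_resolution_of_relations free_t span_t ha).
  by move=> g; have [v <-] := onto g; exists v.
split.
- exact: (ker_submod augL).
- move=> v d /= hv; apply: dsum_eq => i; rewrite aug_hom.
  by rewrite -[aug v]/(\sum_j v 0 j *: a j) hv; case: ifP.
- move=> v /= hv j u; rewrite ltnS leqn0 mdeg_eq0 => /eqP ->.
  move: j; apply: (fe (fun j => (v 0 j)@_0%MM)); rewrite -aug0.
  by rewrite -[aug v]/(\sum_j v 0 j *: a j) hv.
(* Under the identification of F / S with gr_m(M), this is [forms_good]: the image of an f of order
   at least 1 has no component in degree 0. *)
elim: (t) good_t => [//|v W IH] /= [gW hv]; split; first exact: IH.
have sT := surj_image (f := augL) onto.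
move=> f f1 [b hb Eb].
have {}Eb : lin v *: augL f = augL b.
  by apply/eqP; rewrite -subr_eq0 -linearZ -linearB; apply/eqP.
have af0 : dcomp (augL f) 0 = 0.
  rewrite [LHS]aug0 big1 // => j _; rewrite f1 ?scale0r // mdeg0 //.
have : isum (map (@lin k N) W) setT (augL f).
  by apply: hv => //; rewrite Eb -sT; exact: isum_map.
rewrite -{1}sT => /isum_lift[c hc Ec]; exists c => //.
by rewrite -[LHS]/(augL (f - c)) linearB Ec subrr.
Qed.

End GrGood.

Lemma gr_linear_of_good (R : comNzRingType) (k : fieldType) (p : residue_map R k)
  (M : lmodType R) xs : fg M -> good p M xs -> complete p M xs -> gr_linear_resolution p M.
Proof.
move=> fgM gx cx N y hy.
have h (x : R) : exists v, forall xm : (x : R^o) \in kerI p, forall f : gr y M,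
    lin v *: f = (grop (subm_elt xm) f : grspace p M) :> grspace p M.
  have [xm|nx] := pselect ((x : R^o) \in kerI p); last by exists 0 => xm; case: nx.
  have [v hv] := form_of_scalar hy M (subm_elt xm); exists v => xm' f.
  by rewrite hv; congr (grop _ f); exact: val_inj.
have [form hform] := choice h.
apply: (gr_resolution (form := form) _ gx cx fgM) => x f.
by rewrite (hform _ (valP x)); congr (grop _ f); exact: val_inj.
Qed.

(** * The local and the graded case *)

Section Trivial.
Variables (R : comNzRingType) (m : submodClosed R^o) (M : lmodType R).
Hypothesis M0 : forall z : M, z = 0.

Lemma nmax_eq0 (P : set nat) : (forall n, P n -> n = 0%N) -> nmax P = 0%N.
Proof. by move=> h; rewrite /nmax; case: xgetP => [n -> [/h ->]|]. Qed.

Lemma regseq_neq0 s (M' : lmodType R) : regseq s M' -> exists z : M', z <> 0.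
Proof.
elim: s M' => [//|x s IH] M' /= [_ /IH[q q0]].
by have [z Ez] := cls_surj q; exists z => z0; apply: q0; rewrite Ez z0 linear0.
Qed.

Lemma trivial_krull_dim : krull_dim M = 0%N.
Proof.
apply: nmax_eq0 => n [P [hP _]].
have : 1 \in P ord0 by apply: hP => z; exact: M0.
by rewrite idealr1.
Qed.

(** Depth and dimension are both maxima over empty sets, so axiom (3) applies to the zero module. *)
Lemma trivial_cohen_macaulay : cohen_macaulay m M.
Proof.
rewrite /cohen_macaulay trivial_krull_dim; apply: nmax_eq0 => n [s [_ _]].
by move=> /regseq_neq0[z]; rewrite (M0 z).
Qed.

Lemma trivial_length (M' : lmodType R) : (forall z : M', z = 0) -> mod_length M' = 0%N.
Proof.
move=> h; apply: nmax_eq0 => -[//|n] [F hF].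
have [|_ [x _]] := hF ord0 (lift ord0 ord0); first by [].
by rewrite (h x) rpred0.
Qed.

(** In dimension 0 the polynomial is constant, and its values are 0. This gives Deg = 0 at the end
    of the induction. *)
Lemma trivial_multiplicity : multiplicity m M = 0%N.
Proof.
rewrite /multiplicity trivial_krull_dim; case: xgetP => [e -> [P [[n0 hP] sP]]|//].
rewrite fact0 divr1; have /size1_polyC Pc := sP; have := hP _ (leqnn n0).
rewrite trivial_length => [|q]; last first.
  by have [z ->] := cls_surj q; rewrite (M0 z) linear0.
by rewrite Pc hornerC coefC /= => <- /eqP; rewrite eqr_nat => /eqP.
Qed.

End Trivial.

Lemma cls_eq0 (R : comNzRingType) (M : lmodType R) (L : submodClosed M) z :
  cls L z = 0 <-> z \in L.
Proof. by rewrite -(linear0 (cls L)) cls_eq subr0. Qed.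

Lemma xmulP (R : comNzRingType) (M : lmodType R) (x : R) z :
  z \in xmul M x <-> exists w, z = x *: w.
Proof. by split=> [/asboolP|h]; last exact/asboolP. Qed.

(** * Nakayama's lemma, local and graded *)

Section LocalNakayama.
Variables (R : comNzRingType) (k : fieldType) (p : residue_map R k).
Local Notation m := (kerI p).
Hypothesis accR : acc (R^o : lmodType R).
Hypothesis localR : local_ideal m.

(** Otherwise a maximal ideal contains 1 - a; it is m, which contains a. *)
Lemma local_unit (a : R) : p a = 0 -> exists b, b * (1 - a) = 1.
Proof.
move=> pa; apply: contrapT => nu.
pose F : set (set R^o) := [set I : set R^o | [/\ submod I, ~ I (1 : R) & I (1 - a : R)]].
have [||I [sI I1 Ia] hmax] := @acc_max _ _ F accR; first by move=> I [].
  exists [set b * (1 - a) | b in setT]; split.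
  - split; first by exists 0; rewrite ?mul0r.
      by move=> _ _ [b _ <-] [c _ <-]; exists (b + c); rewrite ?mulrDl.
    by move=> c _ [b _ <-]; exists (c * b); rewrite -?mulrA.
  - by move=> [b _ E]; apply: nu; exists b.
  - by exists 1; rewrite ?mul1r.
have [_ hI] := localR; have /hI E : maximal_ideal (mspan I).
  split; first by apply/negP => /(mem_mspan sI).
  move=> J IJ J1 x xJ; apply/(mem_mspan sI).
  apply: (hmax [set x | x \in J]) => //; last by move=> z Iz; apply: IJ; apply/(mem_mspan sI).
  split; [exact: submodClosed_submod | by apply/negP |].
  by apply: IJ; apply/(mem_mspan sI).
have : (1 - a : R^o) \in m by rewrite -E; apply/(mem_mspan sI).
by rewrite mem_kerI rmorphB rmorph1 pa subr0 oner_eq0.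
Qed.

(** A maximal proper submodule L contains mM: if ax is outside L, then x = n + rax with n in L, and
    1 - ra is a unit, so x is in L. *)
Lemma local_nakayama (M : lmodType R) : acc M -> (exists z : M, z <> 0) ->
  exists z, z \notin imul m (full M).
Proof.
move=> accM [z0 hz0].
have [||L [sL [z nz]] hmax] := @acc_max _ _ [set L : set M | submod L /\ exists z, ~ L z] accM.
- by move=> L [].
- exists [set 0]; split; last by exists z0.
  by split=> [//|x y -> ->|a x ->] /=; rewrite ?addr0 ?scaler0.
exists z; apply/negP => zm; apply: nz; move: z zm; have [L0 LD LZ] := sL.
apply: mspan_ind => // _ [a [x [am _ ->]]]; apply: contrapT => nax.
have full_gen w : ~ L w -> forall v, addr_gen L w v.
  move=> nw v; apply: contrapT => nv; apply: nw.
  apply: (hmax (addr_gen L w)); [|exact: sub_addr_gen|exact: addr_gen_mem].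
  by split; [exact: addr_gen_submod | exists v].
have [n Ln [r Ex]] := full_gen _ nax x.
have pra : p (r * (a : R)) = 0 by rewrite rmorphM (eqP am) mulr0.
have [b hb] := local_unit pra; apply: nax; apply: (LZ _ _).
rewrite -[x]scale1r -hb -scalerA; apply: LZ.
by rewrite scalerBl scale1r {1}Ex scalerA addrK.
Qed.

End LocalNakayama.

Section GradedNakayama.
Variables (k : fieldType) (R : comAlgType k) (Rg : nat -> set R) (p : residue_map R k).
Hypotheses (hR : homogeneous_algebra Rg) (hp : augmentation Rg p).
Local Notation m := (kerI p).
Variable M : gmod Rg.

Definition above (d : int) (x : M) : Prop :=
  exists s : seq M, (forall z, z \in s -> exists2 e, d <= e & gmG e z) /\
                    x = \sum_(z <- s) z.

Lemma above0 d : above d 0.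
Proof. by exists [::]; rewrite big_nil. Qed.

Lemma aboveD d x y : above d x -> above d y -> above d (x + y).
Proof.
move=> [s [hs ->]] [t [ht ->]]; exists (s ++ t); rewrite big_cat; split=> // z.
by rewrite mem_cat => /orP[/hs|/ht].
Qed.

Lemma above_sum d (I : eqType) (s : seq I) (F : I -> M) :
  (forall i, i \in s -> above d (F i)) -> above d (\sum_(i <- s) F i).
Proof.
move=> h; rewrite big_seq; elim/big_ind: _ => //; [exact: above0|exact: aboveD].
Qed.

Lemma above_homog d e (z : M) : d <= e -> gmG e z -> above d z.
Proof.
by move=> de ze; exists [:: z]; rewrite big_seq1; split=> // _ /[!inE] /eqP ->; exists e.
Qed.

Lemma above_mul d (i : nat) a x : Rg i a -> above d x -> above (i%:Z + d) (a *: x).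
Proof.
move=> ai [s [hs ->]]; rewrite scaler_sumr; apply: above_sum => z /hs[e de ze].
by apply: (@above_homog _ (i%:Z + e)); [rewrite lerD2l | exact: gm_mul].
Qed.

Lemma above_le d d' x : d' <= d -> above d x -> above d' x.
Proof.
move=> dd [s [hs ->]]; exists s; split=> // z /hs[e de ze]; exists e => //.
exact: le_trans de.
Qed.

Lemma aboveZ d a x : above d x -> above d (a *: x).
Proof.
move=> hx; have [s [f [_ hf ->]]] := grad_sum (ha_grading hR) a.
rewrite scaler_suml; apply: above_sum => i _.
by apply: (@above_le (i%:Z + d)); [rewrite lerDr | exact: above_mul].
Qed.

Lemma above_ex (x : M) : exists d, above d x.
Proof.
have [s [f [_ hf ->]]] := grad_sum (@gm_grading _ _ _ M) x.
elim: s => [|i s [d hd]]; first by exists 0; rewrite big_nil; exact: above0.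
exists (Num.min i d); rewrite big_cons; apply: aboveD.
  by apply: (above_homog (e := i)) => //; rewrite ge_min lexx.
by apply: above_le hd; rewrite ge_min lexx orbT.
Qed.

Lemma above_all : exists d, forall x : M, above d x.
Proof.
have [n [s hs]] := @gm_fg _ _ _ M.
have [d hd] : exists d, forall i, above d (s i).
  have /choice[f hf] := fun i => above_ex (s i).
  exists (\big[Num.min/0]_i f i) => i; apply: above_le (hf i).
  exact: bigmin_le_cond.
exists d => x; have [a ->] := hs x; apply: above_sum => i _; exact: aboveZ.
Qed.

Lemma above_mulI d : (forall x : M, above d x) ->
  forall x, x \in imul m (full M) -> above (d + 1) x.
Proof.
move=> hd; apply: mspan_ind; [exact: above0|exact: aboveD|by move=> a x; exact: aboveZ|].
move=> _ [a [x [am _ ->]]]; have [n [f [hf ->]]] := (aug_ker hp a).1 am.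
rewrite scaler_suml; apply: above_sum => i _.
apply: (@above_le (i.+1%:Z + d)); last exact: above_mul.
by rewrite addrC lerD2r.
Qed.

Lemma above_direct e z : gmG e z -> above (e + 1) z -> z = 0.
Proof.
move=> ze [s [hs Ez]]; have hG := @gm_grading _ _ _ M.
have /choice[dg hdg] : forall w : M, exists d, w \in s -> e < d /\ gmG d w.
  move=> w; have [/hs[d ed dw]|nw] := boolP (w \in s); last by exists 0.
  by exists d => _; rewrite -lezD1.
pose g j := \sum_(w <- s | (w \in s) && (dg w == j)) w.
have gG j : gmG j (g j).
  by apply: (grad_sumP hG) => w /andP[ws /eqP <-]; exact: (hdg w ws).2.
pose h j := if j == e then z else 0.
have hhG j : gmG j (h j) by rewrite /h; case: eqP => [->//|_]; exact: (grad0 hG).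
pose t := undup (e :: map dg s).
have E1 : \sum_(j <- t) h j = z.
  rewrite (bigD1_seq e) ?undup_uniq ?mem_undup ?mem_head //= big1 ?addr0 /h ?eqxx //.
  by move=> j /negPf ->.
have E2 : \sum_(j <- t) g j = z.
  rewrite Ez /g; under eq_bigr do rewrite big_mkcondr /=.
  rewrite exchange_big /= big_seq_cond [RHS]big_seq; apply: eq_big => [w|w]; first by rewrite andbb.
  move=> /andP[ws _]; rewrite (bigD1_seq (dg w)) ?undup_uniq //=; last first.
    by rewrite mem_undup inE map_f ?orbT.
  by rewrite eqxx big1 ?addr0 // => j; rewrite eq_sym => /negPf ->.
have := grad_direct hG (f := fun j => h j - g j) (undup_uniq _)
  (fun j => gradB hG (hhG j) (gG j)).
move=> /(_ (e :: map dg s)); rewrite sumrB E1 E2 subrr => /(_ erefl e).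
rewrite mem_undup mem_head /h eqxx => /(_ isT) /eqP; rewrite subr_eq0 => /eqP ->.
rewrite /g big_pred0 // => w; apply/negP => /andP[ws /eqP Ew].
by have [] := hdg w ws; rewrite Ew ltxx.
Qed.

(** Finite generation bounds the degrees of M from below. If mM = M, this bound can be raised
    indefinitely, so each homogeneous component of an element vanishes. *)
Lemma graded_nakayama : (exists z : M, z <> 0) -> exists z, z \notin imul m (full M).
Proof.
move=> [z0 z00]; apply: contrapT => h; apply: z00.
have hm (z : M) : z \in imul m (full M).
  by apply: contrapT => /negP nz; apply: h; exists z.
have [d hd] := above_all.
have hn (n : nat) (x : M) : above (d + n%:Z) x.
  elim: n x => [|n IH] x; first by rewrite addr0.
  by rewrite -addn1 PoszD addrA; exact: above_mulI.
have [s [f [_ hf ->]]] := grad_sum (@gm_grading _ _ _ M) z0.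
rewrite big1 // => i _; apply: (above_direct (hf i)).
apply: above_le (hn (absz (i + 1 - d)%R) (f i)).
by rewrite -lerBlDl abszE ler_norm.
Qed.

End GradedNakayama.

Lemma quo_surj (R : comNzRingType) (M : lmodType R) (L : submodClosed M) (q : quo L) :
  exists z, cls L z = q.
Proof. by have [z ->] := cls_surj q; exists z. Qed.

Theorem theorem3 :
  (forall (K : realType) (k : fieldType) (R : comNzRingType)
      (p : residue_map R k) (U : fgmod R -> set R) (Deg : fgmod R -> K)
      (M : fgmod R),
    noetherian R -> local_ideal (kerI p) -> infinite_set [set: k] ->
    genericity p U -> cohomological_degree p U Deg ->
    (nu p M)%:R = Deg M -> gr_linear_resolution p M)
  /\
  (forall (K : realType) (k : fieldType) (R : comAlgType k)
      (Rg : nat -> set R) (p : residue_map R k)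
      (hR : homogeneous_algebra Rg) (hp : augmentation Rg p)
      (U : gmod Rg -> set R) (Deg : gmod Rg -> K) (M : gmod Rg),
    infinite_set [set: k] ->
    graded_genericity p U -> graded_cohomological_degree hR hp U Deg ->
    (nu p M)%:R = Deg M -> gr_linear_resolution p M).
Proof.
split=> [K k R p U Deg M noethR localR _ hU hDeg | K k R Rg p hR hp U Deg M _ hU hDeg] E.
- have accR := noetherian_acc noethR.
  have [|||||xs [gxs cxs]] := @exists_good R k p accR K (fgmod R) (@fgm R) Deg _ _ _ _ _ M E.
  + exact: fgmP.
  + by move=> M'; apply: (local_nakayama accR localR); exact: acc_fg (fgmP M').
  + move=> M' M0; rewrite (cd_cm hDeg) ?trivial_multiplicity //.
    exact: trivial_cohen_macaulay.
  + move=> M'; exists (fgquo (gamma (kerI p) M')).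
    exists (cls (gamma (kerI p) M') : {linear M' -> quo _}).
    by split; [exact: quo_surj | move=> z; exact: cls_eq0 | exact: (cd_gamma hDeg)].
  + move=> M' dM; have [x Ux] := gen_nonempty hU M'.
    exists x, (fgquo (xmul M' x)), (cls (xmul M' x) : {linear M' -> quo _}); split.
    * by apply/eqP; case: (gen_sub hU Ux).
    * exact: (gen_reg hU dM Ux).
    * exact: quo_surj.
    * by move=> z; rewrite cls_eq0; exact: xmulP.
    * exact: (cd_generic hDeg dM Ux).
  by apply: gr_linear_of_good gxs cxs; exact: fgmP.
- have accR := homogeneous_acc hR.
  have [|||||xs [gxs cxs]] := @exists_good R k p accR K (gmod Rg) (@gm _ _ Rg) Deg _ _ _ _ _ M E.
  + exact: gm_fg.
  + by move=> M'; exact: graded_nakayama.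
  + move=> M' M0; rewrite (gcd_cm hDeg) ?trivial_multiplicity //.
    exact: trivial_cohen_macaulay.
  + move=> M'; exists (gquo (@gamma_homog _ _ _ _ hR hp M')).
    exists (cls (gamma (kerI p) M') : {linear M' -> quo _}).
    by split; [exact: quo_surj | move=> z; exact: cls_eq0 | exact: (gcd_gamma hDeg)].
  + move=> M' dM; have [x Ux] := ggen_nonempty hU M'; have x1 := ggen_sub hU Ux.
    exists x, (gquo (@xmul_homog _ _ _ M' x x1)), (cls (xmul M' x) : {linear M' -> quo _}); split.
    * apply/eqP; apply: (aug_ker hp x).2; exists 1%N, (fun=> x); split; last by rewrite big_ord1.
      by move=> i; rewrite ord1.
    * exact: (ggen_reg hU dM Ux).
    * exact: quo_surj.
    * by move=> z; rewrite cls_eq0; exact: xmulP.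
    * exact: (gcd_generic hDeg dM x1 Ux).
  by apply: gr_linear_of_good gxs cxs; exact: gm_fg.
Qed.
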